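(* Let $X_\infty(t)=\sum_{k=1}^\infty X^{(k)}(t)$ be an infinite superposition of OU type processes satisfying condition (A) for all $p\ge 2$ and condition (B) (both stated in the context), with $\lambda_k=\lambda/k$ for some $\lambda>0$ and $\delta_k=k^{-(1+2(1-H))}$, $\frac12<H<1$. Let $S_\infty(t)=\sum_{i=1}^{[t]}X_\infty(i)$, and for $t>0$ let $\kappa_{m,N}$ denote the $m$-th cumulant of $S_\infty([Nt])-\mathbb{E}S_\infty([Nt])$. Then for every integer $m\ge 2$, $$\kappa_{m,N}=D_m\,L(N)\,[Nt]^{m-2(1-H)}(1+o(1))\quad\text{as }N\to\infty,$$ where $D_m=C_mK$ for some positive constant $K$ (which may depend on $m$), and $L$ is the slowly varying at infinity function for which $\operatorname{Cov}(X_\infty(0),X_\infty(s))=L(s)/s^{2(1-H)}$, $s>0$.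
   Context: Condition (A) (for a given $p\ge2$): $X^{(k)}(t)$, $k\ge1$, are independent stationary processes, each $X^{(k)}$ being the stationary solution of $dX^{(k)}(t)=-\lambda_kX^{(k)}(t)dt+dZ^{(k)}(\lambda_kt)$, $t\ge0$, i.e. $X^{(k)}(t)=e^{-\lambda_k t}X^{(k)}(0)+\int_0^t e^{-\lambda_k(t-s)}dZ^{(k)}(\lambda_k s)$ with $X^{(k)}(0)$ independent of $Z^{(k)}$, where the $Z^{(k)}$ are independent L\'evy processes and $\lambda_k>0$ for all $k$. The self-decomposable marginal distribution of $X^{(k)}$ has finite moments of order $p$, and the cumulants of orders $2,\dots,p$ of $X^{(k)}$ are proportional to some parameter $\delta_k$ of the distribution of $X^{(k)}$: the $m$-th cumulant of $X^{(k)}$ is $C_m\delta_k$, with $C_m$ not depending on $k$. Condition (B): $\sum_{k=1}^\infty\mathbb{E}X^{(k)}(t)<\infty$ and $\sum_{k=1}^\infty\operatorname{Var}X^{(k)}(t)<\infty$; under it the series defining $X_\infty$ is well defined (mean-square or almost-sure convergence). The $m$-th cumulant of a random variable $X$ is $(-i)^m\frac{d^m}{dz^m}\log\mathbb{E}e^{izX}\big|_{z=0}$. $[x]$ is the integer part of $x$. *)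

(* Defs.v *)
From HB Require Import structures.
From mathcomp Require Import all_boot all_order all_algebra.
From mathcomp Require Import all_classical all_reals all_analysis.
From mathcomp Require Import complex.

Set Implicit Arguments.
Unset Strict Implicit.
Unset Printing Implicit Defensive.

Import Order.TTheory GRing.Theory Num.Theory.
Import numFieldNormedType.Exports.

Local Open Scope classical_set_scope.
Local Open Scope ring_scope.
Local Open Scope complex_scope.

Section characteristic_function_and_cumulants.
Context {R : realType}.

(* Principal value in ]-pi, pi]; smooth in the half-plane 0 < Re w. *)
Definition Carg (w : R[i]) : R :=
  let: x +i* y := w in
  if 0 < x then atan (y / x)
  else if x < 0 then (if 0 <= y then atan (y / x) + pi else atan (y / x) - pi)
  else Num.sg y * (pi / 2).

Definition Clog (w : R[i]) : R[i] :=
  let: x +i* y := w in ln (Num.sqrt (x ^+ 2 + y ^+ 2)) +i* Carg w.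

Context {d : measure_display} {T : measurableType d} (P : probability T R).

Definition charfun (X : T -> R) (z : R) : R[i] :=
  fine 'E_P[fun w => cos (z * X w)] +i* fine 'E_P[fun w => sin (z * X w)].

(* (-i)^m d^m/dz^m log E e^{izX} at z = 0, a C-valued function of a real
   variable being differentiated componentwise.  Since charfun X 0 = 1 and
   charfun X is continuous, the principal logarithm agrees near 0 with the
   continuous logarithm of charfun X vanishing at 0. *)
Definition cumulant (m : nat) (X : T -> R) : R[i] :=
  (0 -i* 1) ^+ m *
  (derive1n m (fun z => complex.Re (Clog (charfun X z))) 0 +i*
   derive1n m (fun z => complex.Im (Clog (charfun X z))) 0).

Definition centered (X : T -> R) : T -> R := fun w => X w - fine 'E_P[X].

End characteristic_function_and_cumulants.

Definition self_decomposable {R : realType} {d : measure_display}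
    {T : measurableType d} (P : probability T R) (X : T -> R) : Prop :=
  forall c : R, 0 < c < 1 ->
  exists nu : probability (measurableTypeR R) R,
  forall z, charfun P X z = charfun P X (c * z) * charfun nu idfun z.

(* Processes are indexed by the whole of R, but only times t >= 0 matter. *)
Section processes.
Context {R : realType} {d : measure_display} {T : measurableType d}.
Variable P : probability T R.
Implicit Types (X Y Z : R -> {RV P >-> R}).

Definition indep_systems (F G : set (set T)) : Prop :=
  forall A B, F A -> G B -> P (A `&` B) = (P A * P B)%E.

Definition mutual_indep_systems (I : eqType) (D : set I)
    (F : I -> set (set T)) : Prop :=
  forall (J : seq I) (E : I -> set T), uniq J ->
    (forall i, i \in J -> D i /\ F i (E i)) ->
    P (\big[setI/setT]_(i <- J) E i) = (\prod_(i <- J) fine (P (E i)))%:E.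

Definition sigma_rv (X : T -> R) : set (set T) :=
  preimage_set_system setT X measurable.

Definition sigma_process Y : set (set T) :=
  <<s [set A | exists2 t : R, 0 <= t & sigma_rv (Y t) A] >>.

Definition independent_processes (Y : nat -> R -> {RV P >-> R}) : Prop :=
  mutual_indep_systems [set k | (1 <= k)%N] (fun k => sigma_process (Y k)).

Definition stationary Y : Prop :=
  forall (n : nat) (t : n.-tuple R) (h : R), 0 <= h ->
    (forall i, 0 <= tnth t i) ->
  forall B : set (n.-tuple (measurableTypeR R)), measurable B ->
    P [set w | B [tuple Y (tnth t i + h) w | i < n]] =
    P [set w | B [tuple Y (tnth t i) w | i < n]].

Definition cvg_in_probability (U : nat -> T -> R) (V : T -> R) : Prop :=
  forall e : R, 0 < e -> P [set w | e < `|U n w - V w|] @[n --> \oo] --> 0%E.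

Definition independent_increments Y : Prop :=
  forall (n : nat) (t : nat -> R), 0 <= t 0%N ->
    (forall i, (i < n)%N -> t i < t i.+1) ->
  mutual_indep_systems [set i | (i < n)%N]
    (fun i => sigma_rv (fun w => Y (t i.+1) w - Y (t i) w)).

Definition stationary_increments Y : Prop :=
  forall s t : R, 0 <= s -> 0 <= t ->
  forall B : set R, measurable B ->
    P [set w | B (Y (s + t) w - Y s w)] = P [set w | B (Y t w - Y 0 w)].

Definition stochastically_continuous Y : Prop :=
  forall t e : R, 0 <= t -> 0 < e ->
    P [set w | e < `|Y s w - Y t w|] @[s --> within [set s | 0 <= s] (nbhs t)]
      --> 0%E.

Definition cadlag (f : R -> R) : Prop :=
  (forall t : R, 0 <= t -> f s @[s --> t^'+] --> f t) /\
  (forall t : R, 0 < t -> cvg (f s @[s --> t^'-])).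

Record levy_process Z : Prop := LevyProcess {
  levy_start : {ae P, forall w, Z 0 w = 0} ;
  levy_indep : independent_increments Z ;
  levy_stat : stationary_increments Z ;
  levy_cont : stochastically_continuous Z ;
  levy_cadlag : {ae P, forall w, cadlag (fun t => Z t w)} }.

Definition partition_of (a b : R) (n : nat) (x : nat -> R) : Prop :=
  [/\ x 0%N = a, x n = b & forall i, (i < n)%N -> x i <= x i.+1].

(* V is a version of \int_a^b f(s) dY(s), for f continuous: the limit in
   probability of Riemann-Stieltjes sums along every sequence of partitions
   of [a, b] whose mesh tends to 0. *)
Definition is_stochastic_integral (f : R -> R) Y (a b : R) (V : T -> R) :
    Prop :=
  forall (n : nat -> nat) (x : nat -> nat -> R),
    (forall j, partition_of a b (n j) (x j)) ->
    (forall e : R, 0 < e -> \forall j \near \oo,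
       forall i, (i < n j)%N -> x j i.+1 - x j i < e) ->
  cvg_in_probability
    (fun j w => \sum_(i < n j) f (x j i) * (Y (x j i.+1) w - Y (x j i) w)) V.

Record stationary_OU (lam : R) X Z : Prop := StationaryOU {
  OU_stationary : stationary X ;
  OU_initial : indep_systems (sigma_rv (X 0)) (sigma_process Z) ;
  OU_equation : exists2 V : R -> {RV P >-> R},
    (forall t : R, 0 <= t -> is_stochastic_integral
       (fun s => expR (- lam * (t - s))) (fun s => Z (lam * s)) 0 t (V t)) &
    (forall t : R, 0 <= t ->
       {ae P, forall w, X t w = expR (- lam * t) * X 0 w + V t w}) }.

(* The families are indexed by k >= 1; their values at k = 0 are ignored. *)
Record condition_A (X Z : nat -> R -> {RV P >-> R}) (lam delta C : nat -> R)
    (p : nat) : Prop := ConditionA {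
  A_rate : forall k, (1 <= k)%N -> 0 < lam k ;
  A_levy : forall k, (1 <= k)%N -> levy_process (Z k) ;
  A_levy_indep : independent_processes Z ;
  A_OU : forall k, (1 <= k)%N -> stationary_OU (lam k) (X k) (Z k) ;
  A_indep : independent_processes X ;
  A_self_decomposable : forall (k : nat) (t : R), (1 <= k)%N -> 0 <= t ->
    self_decomposable P (X k t) ;
  A_moment : forall (k : nat) (t : R), (1 <= k)%N -> 0 <= t ->
    ('E_P[(fun w => `|X k t w| ^+ p)%R] < +oo)%E ;
  A_cumulant : forall (k : nat) (t : R) (m : nat),
    (1 <= k)%N -> 0 <= t -> (2 <= m <= p)%N ->
    cumulant P m (X k t) = (C m * delta k)%:C }.

Definition condition_B (X : nat -> R -> {RV P >-> R}) : Prop :=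
  forall t : R, 0 <= t ->
    cvg ((\sum_(1 <= k < n) fine 'E_P[X k t]) @[n --> \oo]) /\
    (\sum_(1 <= k <oo) variance P (X k t) < +oo)%E.

(* Xinf t is the sum of the series of the X k t, k >= 1, almost surely or in
   mean square. *)
Definition superposition (X : nat -> R -> {RV P >-> R})
    (Xinf : R -> {RV P >-> R}) : Prop :=
  forall t : R, 0 <= t ->
    {ae P, forall w, (\sum_(1 <= k < n) X k t w) @[n --> \oo] --> Xinf t w} \/
    expectation P (fun w => (\sum_(1 <= k < n) X k t w - Xinf t w) ^+ 2)
      @[n --> \oo] --> 0%E.

Definition partial_sum Y (t : R) : T -> R :=
  fun w => \sum_(1 <= i < (Num.truncn t).+1) Y i%:R w.

End processes.

Definition slowly_varying {R : realType} (L : R -> R) : Prop :=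
  (exists2 a : R, 0 < a &
     measurable_fun `[a, +oo[ L /\ forall x, a <= x -> 0 < L x) /\
  forall c : R, 0 < c -> L (c * x) / L x @[x --> +oo] --> (1 : R).

(* Main.v *)
Require Import Defs.
From HB Require Import structures.
From mathcomp Require Import all_boot all_order all_algebra.
From mathcomp Require Import all_classical all_reals all_analysis.
From mathcomp Require Import measurable_realfun.
From mathcomp Require Import complex.
From mathcomp Require Import ring lra.

Set Implicit Arguments.
Unset Strict Implicit.
Unset Printing Implicit Defensive.

Import Order.TTheory GRing.Theory Num.Theory.
Import numFieldNormedType.Exports.

Local Open Scope classical_set_scope.
Local Open Scope ring_scope.
Local Open Scope complex_scope.

(** Why the theorem holds. Fix m >= 2 and put alpha = 2 (1 - H), which lies in
]0, 1[.

One component, observed at integer times, is a first-order autoregression: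
X_k(i+1) = rho_k X_k(i) + eps_i with rho_k = exp (- lam / k), where eps_i is a
stochastic integral over ]i, i+1] and is independent of the past
(OU_innovation_windep). Cumulants add over independent sums and are
homogeneous, so the m-th cumulant of eps_i is (1 - rho_k^m) C_m delta_k, and
that of X_k(1) + ... + X_k(n) is C_m delta_k G(n, rho_k) for an explicit
polynomial G in rho_k (cum_OU_partial_sum). Likewise X_k contributes
C_2 delta_k exp (- lam s / k) to the covariance at lag s.

Summing over k. All this is carried to the infinite series through moments
rather than through characteristic functions. For a variable with finite
moments the cumulants, defined as derivatives of the logarithm of the
characteristic function, are tied to the moments by the relation M' = K' M
between exponential generating functions (cumulants_of_moments), and this
relation determines either sequence from the other. Hence, if all cumulants of
the partial sums of a series of independent variables converge, so do all the
moments; they are then bounded, powers of the partial sums are uniformly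
integrable, and convergence in probability is enough to identify the moments,
and therefore the cumulants, of the sum (pcvg_moments, cum_series). Almost sure
and mean-square convergence both give convergence in probability.

It remains to find the behaviour of sum_k k^(-1-alpha) G(n, rho_k) and of
sum_k k^(-1-alpha) exp (- lam s / k). In both, the terms that matter have k of
the order of n or s; after rescaling, the sum is the integral of a step function
on the half-line, and dominated convergence (series_scaling) gives a positive
limit after division by n^(m-alpha), respectively by s^(-alpha). The majorant is
integrable at infinity because alpha > 0 and at 0 because alpha < 1 and m >= 2.

Thus L converges to a multiple of C_2, positive unless C_2 = 0, and K is the
quotient of the two limits. When C_2 = 0 all the components are almost surely
constant, so C_m = 0 and the statement is trivial. *)

(** * Integrable functions and moments on a probability space *)

Section integrable_functions.
Context {R : realType} {d : measure_display} {T : measurableType d}.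
Variable P : probability T R.
Implicit Types X Y f g : T -> R.

Definition L1 X := P.-integrable setT (EFin \o X).

Lemma L1_measurable X : L1 X -> measurable_fun setT X.
Proof. by move=> /integrableP[/measurable_EFinP]. Qed.

Lemma L1D X Y : L1 X -> L1 Y -> L1 (fun w => X w + Y w).
Proof. by move=> iX iY; exact: (integrableD measurableT iX iY). Qed.

Lemma L1Z c X : L1 X -> L1 (fun w => c * X w).
Proof. by move=> iX; exact: (integrableZl measurableT c iX). Qed.

Lemma L1B X Y : L1 X -> L1 Y -> L1 (fun w => X w - Y w).
Proof. by move=> iX iY; exact: (integrableB measurableT iX iY). Qed.

Lemma L1_cst c : L1 (fun=> c).
Proof. exact: finite_measure_integrable_cst. Qed.

Lemma L1_sum (I : Type) (s : seq I) (X : I -> T -> R) :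
  (forall i, L1 (X i)) -> L1 (fun w => \sum_(i <- s) X i w).
Proof.
move=> iX; elim: s => [|i s IH].
  by under eq_fun do rewrite big_nil; exact: L1_cst.
by under eq_fun do rewrite big_cons; exact: L1D.
Qed.

Lemma L1_le X Y : measurable_fun setT X -> L1 Y ->
  (forall w, `|X w| <= Y w) -> L1 X.
Proof.
move=> mX iY XY; apply: (le_integrable measurableT _ _ iY) => /=.
  exact/measurable_EFinP.
by move=> w _ /=; rewrite lee_fin (le_trans (XY w))// ler_norm.
Qed.

Lemma L1_bounded X c : measurable_fun setT X -> (forall w, `|X w| <= c) -> L1 X.
Proof. by move=> mX Xc; exact: (L1_le mX (L1_cst c)). Qed.

Lemma L1_norm X : L1 X -> L1 (fun w => `|X w|).
Proof. by move=> iX; exact: integrable_norm. Qed.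

Lemma eq_L1 X Y : X =1 Y -> L1 X -> L1 Y.
Proof. by move=> /funext ->. Qed.

Local Notation EE X := (\int[P]_w X w).

Lemma eq_EE X Y : X =1 Y -> EE X = EE Y.
Proof. by move=> XY; apply: eq_Rintegral => w _. Qed.

Lemma EED X Y : L1 X -> L1 Y ->
  \int[P]_w (X w + Y w) = EE X + EE Y.
Proof. by move=> iX iY; exact: RintegralD. Qed.

Lemma EEB X Y : L1 X -> L1 Y -> \int[P]_w (X w - Y w) = EE X - EE Y.
Proof. by move=> iX iY; exact: RintegralB. Qed.

Lemma EEZ c X : L1 X -> \int[P]_w (c * X w) = c * EE X.
Proof. by move=> iX; exact: RintegralZl. Qed.

Lemma EE_cst c : \int[P]_w c = c.
Proof. by rewrite Rintegral_cst// [X in fine X](probability_setT P) mulr1. Qed.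

Lemma EE_sum (I : Type) (s : seq I) (X : I -> T -> R) :
  (forall i, L1 (X i)) ->
  \int[P]_w (\sum_(i <- s) X i w) = \sum_(i <- s) EE (X i).
Proof.
move=> iX; elim: s => [|i s IH].
  by under eq_Rintegral do rewrite big_nil; rewrite big_nil EE_cst.
under eq_Rintegral do rewrite big_cons.
by rewrite big_cons EED// ?IH//; exact: L1_sum.
Qed.

Lemma EE_le X Y : L1 X -> L1 Y -> (forall w, X w <= Y w) -> EE X <= EE Y.
Proof. by move=> iX iY XY; apply: le_Rintegral. Qed.

Lemma EE_ge0 X : (forall w, 0 <= X w) -> 0 <= EE X.
Proof. by move=> X0; exact: Rintegral_ge0. Qed.

Lemma EE_norm X : L1 X -> `|EE X| <= \int[P]_w `|X w|.
Proof. by move=> iX; exact: le_normr_Rintegral. Qed.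

Lemma EE_dist X Y Z : L1 X -> L1 Y -> L1 Z ->
  (forall w, `|X w - Y w| <= Z w) -> `|EE X - EE Y| <= EE Z.
Proof.
move=> iX iY iZ XYZ; rewrite -EEB// (le_trans (EE_norm _))//; first exact: L1B.
by apply: EE_le => //; apply: L1_norm; exact: L1B.
Qed.

Lemma EE_ae X Y : measurable_fun setT X -> measurable_fun setT Y ->
  {ae P, forall w, X w = Y w} -> EE X = EE Y.
Proof.
move=> mX mY XY; congr fine; apply: ae_eq_integral => //.
- exact/measurable_EFinP.
- exact/measurable_EFinP.
- by apply: filterS XY => w /= -> _.
Qed.

Lemma L1_ae X Y : measurable_fun setT Y ->
  {ae P, forall w, X w = Y w} -> L1 X -> L1 Y.
Proof.
move=> mY XY iX; have mX := L1_measurable iX.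
apply/integrableP; split; first exact/measurable_EFinP.
case/integrableP: iX => _; apply: le_lt_trans.
rewrite le_eqVlt; apply/orP; left; apply/eqP.
apply: ae_eq_integral => //.
- by apply/measurable_EFinP; exact: measurableT_comp.
- by apply/measurable_EFinP; exact: measurableT_comp.
- by apply: filterS XY => w /= -> _.
Qed.

Lemma EE_expectation X : fine 'E_P[X] = EE X.
Proof. by rewrite unlock. Qed.

Lemma expectation_EE X : L1 X -> 'E_P[X]%E = (EE X)%:E.
Proof.
move=> iX; rewrite -EE_expectation fineK// unlock.
exact: integrable_fin_num.
Qed.

End integrable_functions.

Section moments.
Context {R : realType} {d : measure_display} {T : measurableType d}.
Variable P : probability T R.
Implicit Types X Y : T -> R.
Local Notation L1 := (L1 P).
Local Notation EE X := (\int[P]_w X w).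

Definition has_moments X := forall n, L1 (fun w => X w ^+ n).

Definition moment X n : R := \int[P]_w (X w ^+ n).

Lemma moment0 X : moment X 0 = 1.
Proof. by rewrite /moment; under eq_Rintegral do rewrite expr0; exact: EE_cst. Qed.

Lemma has_moments_L1 X : has_moments X -> L1 X.
Proof. by move=> /(_ 1%N); apply: eq_L1 => w; rewrite expr1. Qed.

Lemma moment1 X : moment X 1 = EE X.
Proof. by apply: eq_EE => w; rewrite expr1. Qed.

Lemma has_moments_measurable X : has_moments X -> measurable_fun setT X.
Proof. by move=> /has_moments_L1/L1_measurable. Qed.

(** Even powers suffice, because |X|^n <= 1 + X^(2n). *)
Lemma has_moments_even X : measurable_fun setT X ->
  (forall n, (0 < n)%N -> L1 (fun w => X w ^+ (2 * n))) -> has_moments X.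
Proof.
move=> mX iX n; have [->|n0] := posnP n.
  by apply: eq_L1 (L1_cst P 1) => w; rewrite expr0.
apply: (L1_le _ (L1D (L1_cst P 1) (iX _ n0))).
  exact: measurable_funX.
move=> w; have -> : X w ^+ (2 * n) = `|X w ^+ n| ^+ 2.
  by rewrite mulnC exprM real_normK// num_real.
have := sqr_ge0 (`|X w ^+ n| - 1); have : 0 <= `|X w ^+ n| by [].
rewrite !expr2; nra.
Qed.

Lemma has_moments_ae X Y : measurable_fun setT Y ->
  {ae P, forall w, X w = Y w} -> has_moments X -> has_moments Y.
Proof.
move=> mY XY hX n; apply: L1_ae (hX n); first exact: measurable_funX.
by apply: filterS XY => w /= ->.
Qed.

Lemma has_moments_norm X n : has_moments X -> L1 (fun w => `|X w| ^+ n).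
Proof.
by move=> hX; apply: eq_L1 (L1_norm (hX n)) => w; rewrite normrX.
Qed.

Lemma has_moments_cst c : has_moments (fun=> c).
Proof. by move=> n; exact: L1_cst. Qed.

Lemma has_momentsZ c X : has_moments X -> has_moments (fun w => c * X w).
Proof.
move=> hX n; apply: eq_L1 (L1Z (c ^+ n) (hX n)) => w.
by rewrite exprMn.
Qed.

(** $|xy| \le x^2 + y^2$ reduces mixed moments to pure ones. *)
Lemma L1_mixed X Y a b : has_moments X -> has_moments Y ->
  L1 (fun w => X w ^+ a * Y w ^+ b).
Proof.
move=> hX hY; apply: (L1_le _ (L1D (hX (a * 2)%N) (hY (b * 2)%N))).
  by apply: measurable_funM; apply: measurable_funX; exact: has_moments_measurable.
move=> w; rewrite !exprM; set x := X w ^+ a; set y := Y w ^+ b.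
rewrite ler_norml; have := sqr_ge0 (x - y); have := sqr_ge0 (x + y).
have := sqr_ge0 x; have := sqr_ge0 y.
rewrite !expr2; nra.
Qed.

Lemma has_momentsD X Y : has_moments X -> has_moments Y ->
  has_moments (fun w => X w + Y w).
Proof.
move=> hX hY n.
apply: (@eq_L1 _ _ _ _
  (fun w => \sum_(i < n.+1) X w ^+ (n - i) * Y w ^+ i *+ 'C(n, i))).
  by move=> w; rewrite exprDn.
apply: L1_sum => i.
apply: eq_L1 (L1Z 'C(n, i)%:R (L1_mixed (n - i) i hX hY)) => w.
by rewrite mulr_natl.
Qed.

Lemma has_momentsB X Y : has_moments X -> has_moments Y ->
  has_moments (fun w => X w - Y w).
Proof.
move=> hX hY.
have := has_momentsD hX (has_momentsZ (-1) hY).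
by under eq_fun do rewrite mulN1r.
Qed.

Lemma has_moments_sum (I : Type) (s : seq I) (X : I -> T -> R) :
  (forall i, has_moments (X i)) -> has_moments (fun w => \sum_(i <- s) X i w).
Proof.
move=> hX; elim: s => [|i s IH].
  by under eq_fun do rewrite big_nil; exact: has_moments_cst.
by under eq_fun do rewrite big_cons; exact: has_momentsD.
Qed.

Lemma momentD X Y n : has_moments X -> has_moments Y ->
  (forall a b, \int[P]_w (X w ^+ a * Y w ^+ b) = moment X a * moment Y b) ->
  moment (fun w => X w + Y w) n =
  \sum_(i < n.+1) 'C(n, i)%:R * (moment X i * moment Y (n - i)).
Proof.
move=> hX hY XY; rewrite /moment.
under eq_Rintegral => w _.
  rewrite addrC exprDn.
  under eq_bigr do rewrite -mulr_natl mulrC (mulrC (Y w ^+ _)) mulrC.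
  over.
rewrite EE_sum; last by move=> i; apply: L1Z; exact: L1_mixed.
by apply: eq_bigr => i _; rewrite EEZ ?XY//; exact: L1_mixed.
Qed.

Lemma momentZ c X n : has_moments X ->
  moment (fun w => c * X w) n = c ^+ n * moment X n.
Proof.
move=> hX; rewrite /moment; under eq_Rintegral do rewrite exprMn.
by rewrite EEZ.
Qed.

End moments.

(** * Binomial convolution and the moment-cumulant relation *)

Section binomial_convolution.
Context {F : numFieldType}.
Implicit Types a b c : nat -> F.

Definition bconv a b n : F := \sum_(i < n.+1) 'C(n, i)%:R * (a i * b (n - i)%N).

(** The exponential generating function, truncated so that it is a polynomial:
binomial convolution becomes a product below the truncation order. *)
Definition egf N a : {poly F} := \poly_(i < N) (a i / i`!%:R).

Lemma factr_neq0 n : n`!%:R != 0 :> F.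
Proof. by rewrite pnatr_eq0 -lt0n fact_gt0. Qed.

Lemma coef_egf N a n : (n < N)%N -> (egf N a)`_n = a n / n`!%:R.
Proof. by move=> nN; rewrite coef_poly nN. Qed.

Lemma bconvE N a b n : (n < N)%N ->
  bconv a b n = n`!%:R * (egf N a * egf N b)`_n.
Proof.
move=> nN; rewrite coefM big_distrr; apply: eq_bigr => -[i /= iN] _.
have iN' : (i <= n)%N by [].
rewrite !coef_egf ?(leq_ltn_trans _ nN)// ?leq_subr//.
rewrite -(bin_fact iN') !natrM.
by field; rewrite !factr_neq0.
Qed.

Lemma bconvC a b n : bconv a b n = bconv b a n.
Proof. by rewrite !(@bconvE n.+1)// [egf _ _ * _]mulrC. Qed.

Lemma bconvA a b c n : bconv (bconv a b) c n = bconv a (bconv b c) n.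
Proof.
rewrite !(@bconvE n.+1)//; congr (_ * _).
have E u v i : (i <= n)%N ->
    (egf n.+1 (bconv u v))`_i = (egf n.+1 u * egf n.+1 v)`_i.
  move=> iN; rewrite coef_egf// (@bconvE n.+1)//.
  by field; rewrite factr_neq0.
transitivity ((egf n.+1 a * egf n.+1 b * egf n.+1 c)`_n); [|rewrite -mulrA].
- by rewrite 2!coefM; apply: eq_bigr => -[i /= iN] _; rewrite E.
- by rewrite 2!coefM; apply: eq_bigr => -[i /= iN] _; rewrite E// leq_subr.
Qed.

Lemma bconvDl a b c n :
  bconv (fun i => a i + b i) c n = bconv a c n + bconv b c n.
Proof. by rewrite -big_split; apply: eq_bigr => i _ /=; ring. Qed.

Lemma eq_bconv a a' b b' n : (forall i, (i <= n)%N -> a i = a' i) ->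
  (forall i, (i <= n)%N -> b i = b' i) -> bconv a b n = bconv a' b' n.
Proof.
move=> aa bb; apply: eq_bigr => -[i /= iN] _.
by rewrite aa// bb// leq_subr.
Qed.

(** Differentiating exponential generating functions shifts the sequence, so
the shift is a derivation of the binomial convolution. *)
Lemma bconvS a b n : bconv a b n.+1 =
  bconv (fun i => a i.+1) b n + bconv a (fun i => b i.+1) n.
Proof.
have E u : (egf n.+2 u)^`() = egf n.+1 (fun i => u i.+1).
  apply/polyP => i; rewrite coef_deriv !coef_poly ltnS.
  case: ltnP => [_|_]; last by rewrite mul0rn.
  rewrite factS natrM -mulr_natr; field.
  by rewrite factr_neq0/= -[1 + _]/(1%:R + _) -natrD pnatr_eq0.
have -> : bconv a b n.+1 = n`!%:R * ((egf n.+2 a * egf n.+2 b)^`())`_n.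
  rewrite coef_deriv (@bconvE n.+2)// factS natrM -mulr_natr; ring.
rewrite derivM !E coefD mulrDr; congr (_ + _).
- rewrite (@bconvE n.+1)// !coefM; congr (_ * _); apply: eq_bigr => -[i iN] _.
  by congr (_ * _); rewrite !coef_poly !(leq_ltn_trans (leq_subr _ _)).
- rewrite (@bconvE n.+1)// !coefM; congr (_ * _); apply: eq_bigr => -[i iN] _.
  by congr (_ * _); rewrite !coef_poly iN ltnW.
Qed.

End binomial_convolution.

Section cumulant_relation.
Context {F : numFieldType}.
Implicit Types mu kap : nat -> F.

(** With M the exponential generating function of mu and K that of kap, this
says M' = K' M, that is M = exp K up to a constant: the moments mu have
cumulants kap. *)
Definition cumulants_of mu kap :=
  forall m, mu m.+1 = bconv (fun j => kap j.+1) mu m.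

(** In the relation of order m the last cumulant has coefficient mu 0 = 1, the
others being of lower order. *)
Lemma cumulants_of_uniq mu kap kap' : mu 0%N = 1 ->
  cumulants_of mu kap -> cumulants_of mu kap' ->
  forall m, (0 < m)%N -> kap m = kap' m.
Proof.
move=> mu0 h h' [//|m] _; elim/ltn_ind: m => m IH.
have := h m; rewrite h' /bconv !big_ord_recr/= subnn mu0 binn !mulr1 !mul1r.
rewrite [X in X + _](_ : _ =
  \sum_(i < m) 'C(m, i)%:R * (kap i.+1 * mu (m - i)%N)); last first.
  by apply: eq_bigr => i _; rewrite IH.
by move/addrI.
Qed.

Lemma eq_cumulants_of mu mu' kap kap' :
  mu =1 mu' -> (forall m, (0 < m)%N -> kap m = kap' m) ->
  cumulants_of mu kap -> cumulants_of mu' kap'.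
Proof.
move=> mm kk h m; rewrite -mm h; apply: eq_bconv => // i _.
by rewrite kk.
Qed.

(** With M' = K' M and N' = J' N, one has (M N)' = (K + J)' M N. *)
Lemma cumulants_of_add mu mu' kap kap' :
  cumulants_of mu kap -> cumulants_of mu' kap' ->
  cumulants_of (bconv mu mu') (fun m => kap m + kap' m).
Proof.
move=> h h' m; rewrite bconvS bconvDl -!bconvA; congr (_ + _).
  by apply: eq_bconv => // i _; rewrite h.
transitivity (bconv mu (bconv (fun j => kap' j.+1) mu') m).
  by apply: eq_bconv => // i _; rewrite h'.
by rewrite -bconvA; apply: eq_bconv => // i _; exact: bconvC.
Qed.

Lemma cumulants_of_scale c mu kap : cumulants_of mu kap ->
  cumulants_of (fun m => c ^+ m * mu m) (fun m => c ^+ m * kap m).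
Proof.
move=> h m; rewrite h /bconv big_distrr; apply: eq_bigr => -[i /= im] _.
rewrite exprS -{1}(subnKC (im : (i <= m)%N)) exprD exprS; ring.
Qed.

Lemma cumulants_of_cst c :
  cumulants_of (fun m => c ^+ m) (fun m => if m == 1%N then c else 0).
Proof.
move=> m; rewrite /bconv big_ord_recl/= bin0 subn0 mul1r big1 ?addr0 ?exprS//.
by move=> i _; rewrite mul0r mulr0.
Qed.

End cumulant_relation.

Lemma cvg_sumr {R : realType} {I : Type} (s : seq I) {T : Type}
    (F : set_system T) {FF : Filter F} (f : I -> T -> R) (l : I -> R) :
  (forall i, f i x @[x --> F] --> l i) ->
  \sum_(i <- s) f i x @[x --> F] --> \sum_(i <- s) l i.
Proof. by move=> h; apply: cvg_big => //; exact: add_continuous. Qed.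

(** The relation determines each moment from earlier moments and cumulants by a
polynomial formula, so limits of cumulants produce limits of moments. *)
Lemma cumulants_of_cvg {R : realType} (mu kap : nat -> nat -> R)
    (kap_ : nat -> R) :
  (forall n, mu n 0%N = 1) -> (forall n, cumulants_of (mu n) (kap n)) ->
  (forall m, (0 < m)%N -> kap n m @[n --> \oo] --> kap_ m) ->
  exists2 mu_ : nat -> R, cumulants_of mu_ kap_ &
    forall m, mu n m @[n --> \oo] --> mu_ m.
Proof.
move=> mu0 h kk.
have cmu m : cvg (mu n m @[n --> \oo]).
  elim/ltn_ind: m => -[|m] IH.
    have -> : (fun n => mu n 0%N) = cst 1 by apply/funext => n; rewrite mu0.
    exact: is_cvg_cst.
  rewrite (_ : (fun n => _) =
    (fun n => \sum_(i < m.+1) 'C(m, i)%:R * (kap n i.+1 * mu n (m - i)%N))); last first.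
    by apply/funext => n; rewrite h.
  apply/cvg_ex; exists (\sum_(i < m.+1) 'C(m, i)%:R *
    (kap_ i.+1 * lim (mu n (m - i)%N @[n --> \oo]))).
  apply: cvg_sumr => i; apply: cvgM; first exact: cvg_cst.
  apply: cvgM; first exact: kk.
  by apply: IH; rewrite ltnS leq_subr.
exists (fun m => lim (mu n m @[n --> \oo])) => [m|]; last exact: cmu.
apply/cvg_lim => //; rewrite (_ : (fun n => _) =
    (fun n => \sum_(i < m.+1) 'C(m, i)%:R * (kap n i.+1 * mu n (m - i)%N))); last first.
  by apply/funext => n; rewrite h.
apply: cvg_sumr => i; apply: cvgM; first exact: cvg_cst.
by apply: cvgM; [exact: kk|exact: cmu].
Qed.

(** * Derivatives of complex functions of a real variable *)

Section complex_valued_derivatives.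
Context {R : realType}.
Implicit Types (f g : R -> R[i]) (l : R[i]).

(** R[i] is not a normed module over R, so the real and imaginary parts are
differentiated separately. *)
Definition cderive f (z : R) l :=
  is_derive z 1 (fun t => complex.Re (f t)) (complex.Re l) /\
  is_derive z 1 (fun t => complex.Im (f t)) (complex.Im l).

Lemma ReM (x y : R[i]) : complex.Re (x * y) =
  complex.Re x * complex.Re y - complex.Im x * complex.Im y.
Proof. by case: x y => [a b] [c e]. Qed.

Lemma ImM (x y : R[i]) : complex.Im (x * y) =
  complex.Re x * complex.Im y + complex.Im x * complex.Re y.
Proof. by case: x y => [a b] [c e]. Qed.

Lemma ReD (x y : R[i]) :
  complex.Re (x + y) = complex.Re x + complex.Re y.
Proof. by case: x y => [a b] [c e]. Qed.

Lemma ImD (x y : R[i]) :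
  complex.Im (x + y) = complex.Im x + complex.Im y.
Proof. by case: x y => [a b] [c e]. Qed.

Lemma cplx_eq (x y : R[i]) : complex.Re x = complex.Re y ->
  complex.Im x = complex.Im y -> x = y.
Proof. by case: x y => [a b] [c e] /= -> ->. Qed.

Lemma cderive_uniq f z l l' : cderive f z l -> cderive f z l' -> l = l'.
Proof.
move=> [a b] [a' b']; apply: cplx_eq.
- by rewrite -(@derive_val _ _ _ _ _ _ _ a) -(@derive_val _ _ _ _ _ _ _ a').
- by rewrite -(@derive_val _ _ _ _ _ _ _ b) -(@derive_val _ _ _ _ _ _ _ b').
Qed.

Lemma near_cderive f g z l : (\forall t \near z, f t = g t) ->
  cderive f z l -> cderive g z l.
Proof.
move=> fg [a b]; split.
- by apply: near_eq_is_derive a; near=> t; congr complex.Re; near: t.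
- by apply: near_eq_is_derive b; near=> t; congr complex.Im; near: t.
Unshelve. all: by end_near. Qed.

Lemma cderive_cst l z : cderive (fun=> l) z 0.
Proof. by split; exact: is_derive_cst. Qed.

Lemma cderiveD f g z l m : cderive f z l -> cderive g z m ->
  cderive (fun t => f t + g t) z (l + m).
Proof.
move=> [a b] [a' b']; split.
- rewrite ReD; under eq_fun do rewrite ReD.
  exact: (@is_deriveD _ _ _ _ _ _ _ _ _ a a').
- rewrite ImD; under eq_fun do rewrite ImD.
  exact: (@is_deriveD _ _ _ _ _ _ _ _ _ b b').
Qed.

Lemma cderiveM f g z l m : cderive f z l -> cderive g z m ->
  cderive (fun t => f t * g t) z (l * g z + f z * m).
Proof.
move=> [a b] [a' b']; split.
- under eq_fun do rewrite ReM.
  apply: (@is_derive_eq _ _ _ _ _ _ _ _ (@is_deriveB _ _ _ _ _ _ _ _ _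
    (@is_deriveM _ _ _ _ _ _ _ _ a a') (@is_deriveM _ _ _ _ _ _ _ _ b b'))).
  rewrite ReD !ReM /GRing.scale /=; ring.
- under eq_fun do rewrite ImM.
  apply: (@is_derive_eq _ _ _ _ _ _ _ _ (@is_deriveD _ _ _ _ _ _ _ _ _
    (@is_deriveM _ _ _ _ _ _ _ _ a b') (@is_deriveM _ _ _ _ _ _ _ _ b a'))).
  rewrite ImD !ImM /GRing.scale /=; ring.
Qed.

Lemma cderiveZ c f z l : cderive f z l -> cderive (fun t => c * f t) z (c * l).
Proof.
by move=> h; have := cderiveM (cderive_cst c z) h; rewrite mul0r add0r.
Qed.

Lemma cderive_sum (I : Type) (s : seq I) (f : I -> R -> R[i]) z (l : I -> R[i]) :
  (forall i, cderive (f i) z (l i)) ->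
  cderive (fun t => \sum_(i <- s) f i t) z (\sum_(i <- s) l i).
Proof.
move=> h; elim: s => [|i s IH].
  by rewrite big_nil; under eq_fun do rewrite big_nil; exact: cderive_cst.
by rewrite big_cons; under eq_fun do rewrite big_cons; exact: cderiveD.
Qed.

Lemma cderiveV f z l : 0 < complex.Re (f z) -> cderive f z l ->
  exists m, cderive (fun t => (f t)^-1) z m.
Proof.
move=> f0 [a b].
have n0 : complex.Re (f z) ^+ 2 + complex.Im (f z) ^+ 2 != 0.
  by rewrite gt_eqF// ltr_pwDl ?sqr_ge0// exprn_gt0.
have dn := @is_deriveD _ _ _ _ _ _ _ _ _
  (@is_deriveX _ _ _ 2 _ _ _ a) (@is_deriveX _ _ _ 2 _ _ _ b).
have := @is_deriveV _ (fun t => complex.Re (f t) ^+ 2 + complex.Im (f t) ^+ 2)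
  _ _ _ n0 dn.
set c := (X in is_derive _ _ _ X) => dV.
have h1 := @is_deriveM _ _ _ _ _ _ _ _ a dV.
have h2 := @is_deriveM _ _ _ _ _ _ _ _ (@is_deriveN _ _ _ _ _ _ _ b) dV.
pose r := (complex.Re (f z) ^+ 2 + complex.Im (f z) ^+ 2)^-1.
exists ((complex.Re (f z) *: c + r *: complex.Re l) +i*
  (- complex.Im (f z) *: c + r *: - complex.Im l)); split.
- apply: near_eq_is_derive h1; near=> t.
  transitivity (complex.Re (f t) *
    (complex.Re (f t) ^+ 2 + complex.Im (f t) ^+ 2)^-1) => //.
  by case: (f t).
- apply: near_eq_is_derive h2; near=> t.
  transitivity (- complex.Im (f t) *
    (complex.Re (f t) ^+ 2 + complex.Im (f t) ^+ 2)^-1) => //.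
  by case: (f t) => p q; rewrite mulNr.
Unshelve. all: by end_near. Qed.

(** In the half-plane 0 < Re w the logarithm is ln |w| + i atan (Im w / Re w). *)
Lemma cderive_Clog f z l : 0 < complex.Re (f z) -> cderive f z l ->
  (\forall t \near z, 0 < complex.Re (f t)) ->
  cderive (fun t => Clog (f t)) z (l / f z).
Proof.
move=> f0 [a b] fnear.
set x := fun t => complex.Re (f t); set y := fun t => complex.Im (f t).
have n0 : 0 < x z ^+ 2 + y z ^+ 2 by rewrite ltr_pwDl ?sqr_ge0// exprn_gt0.
have dn := @is_deriveD _ _ _ _ _ _ _ _ _
  (@is_deriveX _ _ _ 2 _ _ _ a) (@is_deriveX _ _ _ 2 _ _ _ b).
have x0 : x z != 0 by rewrite gt_eqF.
split.
- have s0 : 0 < Num.sqrt (x z ^+ 2 + y z ^+ 2) by rewrite sqrtr_gt0.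
  have h := @is_derive1_comp _ (@ln R)
    (Num.sqrt \o (fun t => x t ^+ 2 + y t ^+ 2)) _ _ _ (is_derive1_ln s0)
    (@is_derive1_comp _ Num.sqrt (fun t => x t ^+ 2 + y t ^+ 2) _ _ _
      (is_derive1_sqrt n0) dn).
  apply: (@near_eq_is_derive _ _ _ (@ln R \o (Num.sqrt \o (fun t => x t ^+ 2 + y t ^+ 2)))).
    by near=> t; rewrite /x /y /=; case: (f t).
  apply: is_derive_eq h _.
  rewrite /= /GRing.scale /= ?expr1 /x /y.
  move: n0 s0; rewrite /x /y; case: (f z) => p q /=; case: l {a b dn} => u v /=.
  move=> n0 s0.
  have -> : forall s D : R, s^-1 * ((2 * s)^-1 * D) = (s ^+ 2)^-1 * 2^-1 * D.
    by move=> s D; rewrite -exprVn !invfM expr2; ring.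
  by rewrite sqr_sqrtr ?ltW//; field; rewrite gt_eqF.
- have h := @is_derive1_comp _ (@atan R) (fun t => y t / x t) _ _ _
    (is_derive1_atan (y z / x z))
    (@is_deriveM _ _ _ _ _ _ _ _ b (@is_deriveV _ x _ _ _ x0 a)).
  apply: (@near_eq_is_derive _ _ _ (@atan R \o (fun t => y t / x t))).
    near=> t; have : 0 < complex.Re (f t) by near: t.
    by rewrite /x /y /=; case: (f t) => p q /= ->.
  apply: is_derive_eq h _.
  rewrite /= /GRing.scale /= /x /y.
  move: n0 x0; rewrite /x /y; case: (f z) => p q /=; case: l {a b dn} => u v /=.
  move=> n0 x0; field; rewrite x0 /=.
  by rewrite (gt_eqF n0)/=.
Unshelve. all: by end_near. Qed.

End complex_valued_derivatives.

(** * Cumulants of a variable all of whose moments are finite *)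

Section logarithmic_derivatives.
Context {R : realType}.
Variable Phi : nat -> R -> R[i].
Hypothesis dPhi : forall n z, cderive (Phi n) z (Phi n.+1 z).
Hypothesis Phi0 : 0 < complex.Re (Phi 0%N 0).

Let logRe z := complex.Re (Clog (Phi 0%N z)).
Let logIm z := complex.Im (Clog (Phi 0%N z)).
Let D m z : R[i] := derive1n m logRe z +i* derive1n m logIm z.

Lemma near_Re_gt0 z : 0 < complex.Re (Phi 0%N z) ->
  \forall t \near z, 0 < complex.Re (Phi 0%N t).
Proof.
move=> z0; have [a _] := dPhi 0 z.
have /derivable1_diffP/differentiable_continuous c :
  derivable (fun t => complex.Re (Phi 0%N t)) z 1 by case: a.
exact: (cvgr_gt _ c).
Qed.

Lemma D_cderive m z l : cderive (D m) z l -> D m.+1 z = l.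
Proof.
case=> a b; apply: cplx_eq => /=.
- by rewrite -[LHS]/(derive1 (derive1n m logRe) z) derive1E (@derive_val _ _ _ _ _ _ _ a).
- by rewrite -[LHS]/(derive1 (derive1n m logIm) z) derive1E (@derive_val _ _ _ _ _ _ _ b).
Qed.

(** The Leibniz formula for Phi' = D_1 Phi. The same formula, solved for the last
factor, exhibits each derivative of the logarithm as a differentiable function
of the earlier ones, which is what lets the induction continue. *)
Lemma log_derivatives m z : 0 < complex.Re (Phi 0%N z) ->
  (forall j, (j < m)%N -> cderive (D j.+1) z (D j.+2 z)) /\
  Phi m.+1 z = bconv (fun j => D j.+1 z) (fun j => Phi j z) m.
Proof.
elim/ltn_ind: m z => -[|m] IH z z0.
  split=> //; rewrite /bconv big_ord1 bin0 subn0 mul1r.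
  have := @cderive_Clog _ _ _ _ z0 (dPhi 0 z) (near_Re_gt0 z0).
  move=> h; rewrite (@D_cderive 0 z (Phi 1%N z / Phi 0%N z)); last first.
    by case: h.
  by rewrite divfK//; apply: contraTneq z0 => ->; rewrite ltxx.
have [IHd IHe] := IH m (ltnSn m) z z0.
have nz := near_Re_gt0 z0.
have Dm : cderive (D m.+1) z (D m.+2 z).
  have [w dV] := cderiveV z0 (dPhi 0 z).
  pose S t := \sum_(i < m) 'C(m, i)%:R * (D i.+1 t * Phi (m - i)%N t).
  have E t : 0 < complex.Re (Phi 0%N t) ->
      (Phi m.+1 t + -1 * S t) * (Phi 0%N t)^-1 = D m.+1 t.
    move=> t0; have [_ ->] := IH m (ltnSn m) t t0.
    rewrite /bconv big_ord_recr/= subnn binn mul1r.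
    rewrite -/(S t) mulN1r [S t + _]addrC addrK mulfK//.
    by apply: contraTneq t0 => ->; rewrite ltxx.
  have [l dS] : exists l, cderive S z l.
    exists (\sum_(i < m) 'C(m, i)%:R *
      (D i.+2 z * Phi (m - i)%N z + D i.+1 z * Phi (m - i).+1%N z)).
    apply: (@cderive_sum _ _ _ (fun (i : 'I_m) t =>
      'C(m, i)%:R * (D i.+1 t * Phi (m - i)%N t))) => i.
    apply: (@cderiveZ _ _ (fun t => D i.+1 t * Phi (m - i)%N t)).
    exact: (@cderiveM _ (D i.+1) (Phi (m - i)%N) _ _ _ (IHd i _) (dPhi _ _)).
  have := cderiveM (cderiveD (dPhi m.+1 z) (cderiveZ (-1) dS)) dV.
  set l' := (X in cderive _ _ X) => h.
  have h' : cderive (D m.+1) z l'.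
    by apply: near_cderive h; near=> t; apply: E; near: t.
  by rewrite (D_cderive h').
have dall j : (j <= m)%N -> cderive (D j.+1) z (D j.+2 z).
  by rewrite leq_eqVlt => /predU1P[->//|]; exact: IHd.
split; first by move=> j; rewrite ltnS; exact: dall.
rewrite bconvS -big_split /=.
apply: (cderive_uniq (dPhi m.+1 z)).
apply: (@near_cderive _ (fun t => bconv (fun j => D j.+1 t) (fun j => Phi j t) m)).
  near=> t; suff t0 : 0 < complex.Re (Phi 0%N t).
    by have [_ ->] := IH m (ltnSn m) t t0.
  by near: t.
apply: (@cderive_sum _ _ _ (fun (i : 'I_m.+1) t =>
      'C(m, i)%:R * (D i.+1 t * Phi (m - i)%N t))) => i.
rewrite -mulrDr; apply: (@cderiveZ _ _ (fun t => D i.+1 t * Phi (m - i)%N t)).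
have im : (i <= m)%N by rewrite -ltnS.
exact: (@cderiveM _ (D i.+1) (Phi (m - i)%N) _ _ _ (dall i im) (dPhi _ _)).
Unshelve. all: by end_near. Qed.

End logarithmic_derivatives.

Section characteristic_function.
Context {R : realType} {d : measure_display} {T : measurableType d}.
Variable P : probability T R.
Variable X : T -> R.
Hypothesis hX : has_moments P X.

Let mX : measurable_fun setT X := has_moments_measurable hX.

(** Up to the factor i^n, the n-th derivative of the characteristic function. *)
Let Q n z : R[i] := (\int[P]_w (X w ^+ n * cos (z * X w))) +i*
                    (\int[P]_w (X w ^+ n * sin (z * X w))).

Lemma L1_trig (f : R -> R) n z : measurable_fun setT f ->
  (forall x, `|f x| <= 1) -> L1 P (fun w => X w ^+ n * f (z * X w)).
Proof.
move=> mf f1; apply: (L1_le _ (has_moments_norm n hX)).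
  apply: measurable_funM; first exact: measurable_funX.
  by apply: measurableT_comp => //; exact: measurable_funM.
by move=> w; rewrite normrM normrX ler_piMr// exprn_ge0.
Qed.

Lemma measurable_cosR : measurable_fun setT (@cos R).
Proof. by apply: continuous_measurable_fun; exact: continuous_cos. Qed.

Lemma measurable_sinR : measurable_fun setT (@sin R).
Proof. by apply: continuous_measurable_fun; exact: continuous_sin. Qed.

Lemma normr_cos_le1 (x : R) : `|cos x| <= 1.
Proof. by rewrite ler_norml cos_geN1 cos_le1. Qed.

Lemma normr_sin_le1 (x : R) : `|sin x| <= 1.
Proof. by rewrite ler_norml sin_geN1 sin_le1. Qed.

(** Differentiation under the mean, with |X|^(n+1) as the dominating function. *)
Lemma is_derive_trig_mean (f g : R -> R) (n : nat) (z : R) :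
  measurable_fun setT f -> (forall x, `|f x| <= 1) ->
  (forall x, `|g x| <= 1) -> (forall x : R, is_derive x 1 f (g x)) ->
  is_derive z 1 (fun t => \int[P]_w (X w ^+ n * f (t * X w)))
    (\int[P]_w (X w ^+ n.+1 * g (z * X w))).
Proof.
move=> mf f1 g1 dfg.
have dF (x : R) (w : T) : is_derive x 1 (fun t => X w ^+ n * f (t * X w))
    (X w ^+ n.+1 * g (x * X w)).
  have h1 : is_derive x 1 (fun t : R => t * X w) (X w).
    have h0 : is_derive x 1 (fun t : R => t * X w) (x *: 0 + X w *: 1) :=
      @is_deriveM _ _ id (fun=> X w) x 1 _ _ (is_derive_id _ _)
        (is_derive_cst _ _ _).
    by apply: is_derive_eq h0 _; rewrite /GRing.scale /= mulr0 add0r mulr1.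
  have h2 := @is_derive1_comp _ f (fun t => t * X w) _ _ _ (dfg _) h1.
  have h3 : is_derive x 1 (fun t => X w ^+ n * f (t * X w))
    (X w ^+ n *: (g (x * X w) * X w)) := @is_deriveZ _ _ _ _ (X w ^+ n) _ _ _ h2.
  apply: is_derive_eq h3 _.
  by rewrite /GRing.scale /= exprSr; ring.
pose F t w := X w ^+ n * f (t * X w).
have zI : [set` `]z - 1, z + 1[] z.
  by rewrite /= in_itv/= ltrBlDr ltrDl ltr01.
have dE x y : (partial1of2 F) x y = X y ^+ n.+1 * g (x * X y).
  by rewrite partial1of2E; apply: derive_val; exact: dF.
have iF x : [set` `]z - 1, z + 1[] x -> P.-integrable setT (EFin \o F x).
  by move=> _; exact: L1_trig.
have derF x y : [set` `]z - 1, z + 1[] x -> [set: T] y ->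
    derivable (F ^~ y) x 1.
  by move=> _ _; case: (dF x y).
have G0 y : 0 <= `|X y| ^+ n.+1 by rewrite exprn_ge0.
have GF x y : [set` `]z - 1, z + 1[] x -> [set: T] y ->
   `|partial1of2 F x y| <= `|X y| ^+ n.+1.
  by move=> _ _; rewrite dE normrM normrX ler_piMr// exprn_ge0.
have h1 := @derivable_under_integral _ _ _ P F setT measurableT z _ _ zI iF derF _ G0
  (has_moments_norm n.+1 hX) GF.
have h2 := @differentiation_under_integral _ _ _ P F setT measurableT z _ _ zI iF derF _ G0
  (has_moments_norm n.+1 hX) GF.
apply: DeriveDef => //.
by rewrite -derive1E h2; apply: eq_Rintegral => w _; rewrite dE.
Qed.

Lemma cderive_Q n z : cderive (Q n) z ('i * Q n.+1 z).
Proof.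
split; rewrite /= !mul0r mul1r ?mul0r ?sub0r ?add0r.
- rewrite (_ : - _ = \int[P]_w (X w ^+ n.+1 * - sin (z * X w))).
    apply: is_derive_trig_mean => //; first exact: measurable_cosR.
    - exact: normr_cos_le1.
    - by move=> x; rewrite normrN; exact: normr_sin_le1.
  rewrite -mulN1r -EEZ; last by apply: L1_trig; [exact: measurable_sinR|exact: normr_sin_le1].
  by apply: eq_EE => w; rewrite mulN1r mulrN.
- apply: is_derive_trig_mean => //; first exact: measurable_sinR.
  - exact: normr_sin_le1.
  - exact: normr_cos_le1.
Qed.

Lemma charfunE : charfun P X = Q 0.
Proof.
apply/funext => z; rewrite /charfun /Q !EE_expectation.
by congr (_ +i* _); apply: eq_EE => w; rewrite expr0 mul1r.
Qed.

(** The real number behind the complex-valued cumulant. *)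
Definition cum m : R := complex.Re (cumulant P m X).

Let Phi n z := 'i ^+ n * Q n z.

Lemma Phi_at0 n : Phi n 0 = 'i ^+ n * (moment P X n)%:C.
Proof.
rewrite /Phi /Q; congr (_ * (_ +i* _)).
  by apply: eq_EE => w; rewrite mul0r cos0 mulr1.
under eq_Rintegral do rewrite mul0r sin0 mulr0.
exact: EE_cst.
Qed.

(** The n-th derivative at 0 of the characteristic function is i^n times the
n-th moment, so the Leibniz formula at 0 is the moment-cumulant relation once
the powers of i are cancelled. *)
Lemma cumulants_of_cumulant : cumulants_of (fun m => (moment P X m)%:C)
  (fun m => cumulant P m X).
Proof.
have dPhi n z : cderive (Phi n) z (Phi n.+1 z).
  by rewrite /Phi exprSr -mulrA; apply: cderiveZ; exact: cderive_Q.
have Phi0 : 0 < complex.Re (Phi 0%N 0).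
  by rewrite Phi_at0 expr0 mul1r moment0 /=.
move=> m; have [_] := log_derivatives dPhi m Phi0.
rewrite Phi_at0.
have i1 : (0 -i* 1) * 'i = 1 :> R[i].
  by apply: cplx_eq; rewrite /=; ring.
move=> /(congr1 (fun x => (0 -i* 1) ^+ m.+1 * x)).
rewrite mulrA -exprMn i1 expr1n mul1r => ->.
rewrite /bconv big_distrr; apply: eq_bigr => -[i /= im] _.
rewrite Phi_at0 /cumulant.
have -> : charfun P X = Phi 0%N.
  by apply/funext => z; rewrite charfunE /Phi expr0 mul1r.
set D := (_ +i* _).
have -> : (0 -i* 1 : R[i]) ^+ m.+1 = (0 -i* 1) ^+ i.+1 * (0 -i* 1) ^+ (m - i).
  by rewrite -exprD addSn subnKC.
have : (0 -i* 1 : R[i]) ^+ (m - i) * 'i ^+ (m - i) = 1.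
  by rewrite -exprMn i1 expr1n.
move: (_ ^+ (m - i)) (_ ^+ i.+1) ('i ^+ (m - i)) => u v w uw.
rewrite -[RHS]mul1r -uw; ring.
Qed.

(** The moment-cumulant relation expresses cumulants through real moments. *)
Lemma cumulant_real m : (0 < m)%N -> cumulant P m X = (cum m)%:C.
Proof.
case: m => // m _; elim/ltn_ind: m => m IH.
have := cumulants_of_cumulant m.
rewrite /bconv big_ord_recr/= subnn moment0 binn mul1r mulr1.
rewrite (eq_bigr (fun i : 'I_m => ('C(m, i)%:R *
   (cum i.+1 * moment P X (m - i)))%:C)); last first.
  by move=> i _; rewrite IH// !rmorphM /= rmorph_nat.
rewrite -rmorph_sum /= => /eqP; rewrite addrC -subr_eq -rmorphB /= => /eqP E.
by rewrite /cum -E.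
Qed.

Lemma cumulants_of_moments : cumulants_of (moment P X) cum.
Proof.
move=> m; apply: (@complexI R); rewrite cumulants_of_cumulant /bconv rmorph_sum.
apply: eq_bigr => i _; rewrite cumulant_real// !rmorphM /=.
by rewrite rmorph_nat.
Qed.

End characteristic_function.

(** * Convergence in probability *)

Section convergence_in_mean_of_truncated_distance.
Context {R : realType} {d : measure_display} {T : measurableType d}.
Variable P : probability T R.
Local Notation L1 := (L1 P).
Local Notation EE X := (\int[P]_w X w).

Implicit Types (U : nat -> T -> R) (V X Y : T -> R).

Definition dist1 (x : R) : R := Num.min `|x| 1.

Lemma dist1_ge0 x : 0 <= dist1 x.
Proof. by rewrite le_min normr_ge0 ler01. Qed.

Lemma dist1_le1 x : dist1 x <= 1.
Proof. by rewrite ge_min lexx orbT. Qed.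

Lemma dist1_norm x : `|dist1 x| <= 1.
Proof. by rewrite ger0_norm ?dist1_ge0// dist1_le1. Qed.

Lemma dist1D x y : dist1 (x + y) <= dist1 x + dist1 y.
Proof.
rewrite /dist1; have := ler_normD x y; have := normr_ge0 x; have := normr_ge0 y.
move: `|x + y| `|x| `|y| => n a b b0 a0 nab; rewrite /Num.min.
by case: (ltP n 1) => n1; case: (ltP a 1) => a1; case: (ltP b 1) => b1; lra.
Qed.

Lemma dist1Z c x : dist1 (c * x) <= (1 + `|c|) * dist1 x.
Proof.
rewrite /dist1 normrM; have := normr_ge0 x; have := normr_ge0 c.
move: `|x| `|c| => a b b0 a0; rewrite /Num.min.
by case: (ltP a 1) => a1; case: (ltP (b * a) 1) => ba1; nra.
Qed.

Lemma measurable_dist1 X : measurable_fun setT X ->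
  measurable_fun [set: T] (fun w => dist1 (X w)).
Proof.
move=> mX; apply: measurable_minr => //.
exact: (measurableT_comp (@normr_measurable _ _) mX).
Qed.

Lemma L1_dist1 X : measurable_fun setT X -> L1 (fun w => dist1 (X w)).
Proof.
move=> mX; apply: (@L1_bounded _ _ _ _ _ 1); first exact: measurable_dist1.
by move=> w; exact: dist1_norm.
Qed.

(** The mean of min(|U_n - V|, 1) metrizes convergence in probability. In this
form limits add by the triangle inequality, and almost sure and mean-square
convergence are both special cases. *)
Definition pcvg (U : nat -> T -> R) (V : T -> R) : Prop :=
  [/\ forall n, measurable_fun setT (U n), measurable_fun setT V &
  \int[P]_w dist1 (U n w - V w) @[n --> \oo] --> 0].

Lemma pcvg_le (U : nat -> T -> R) V (b : nat -> R) :
  (forall n, measurable_fun setT (U n)) -> measurable_fun setT V ->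
  b n @[n --> \oo] --> 0 ->
  (forall n, \int[P]_w dist1 (U n w - V w) <= b n) -> pcvg U V.
Proof.
move=> mU mV b0 Ub; split => //.
apply: (@squeeze_cvgr _ _ _ _ (cst 0) b) => //; last exact: cvg_cst.
by apply: nearW => n; rewrite Ub andbT; apply: EE_ge0 => w; exact: dist1_ge0.
Qed.

Lemma pcvg_cst V : measurable_fun setT V -> pcvg (fun=> V) V.
Proof.
move=> mV; split => //.
under eq_fun do under eq_Rintegral do rewrite subrr /dist1 normr0 min_l//.
by rewrite EE_cst; exact: cvg_cst.
Qed.

Lemma pcvgD U V (U' : nat -> T -> R) (V' : T -> R) : pcvg U V -> pcvg U' V' ->
  pcvg (fun n w => U n w + U' n w) (fun w => V w + V' w).
Proof.
move=> [mU mV UV] [mU' mV' UV']; 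
have h : \int[P]_w dist1 (U n w - V w) + \int[P]_w dist1 (U' n w - V' w)
    @[n --> \oo] --> 0 by rewrite -[X in _ --> X]addr0; exact: cvgD.
apply: (@pcvg_le _ _ (fun n => \int[P]_w dist1 (U n w - V w) +
    \int[P]_w dist1 (U' n w - V' w)) _ _ h)
  => [n||n]; try exact: measurable_funD.
have m1 : measurable_fun setT (fun w => U n w - V w) by exact: measurable_funB.
have m2 : measurable_fun setT (fun w => U' n w - V' w) by exact: measurable_funB.
rewrite -[leRHS]EED; try exact: L1_dist1.
apply: EE_le => [||w].
- by apply: L1_dist1; apply: measurable_funB; exact: measurable_funD.
- by apply: L1D; exact: L1_dist1.
- by rewrite opprD addrACA; exact: dist1D.
Qed.

Lemma pcvgZ c U V : pcvg U V -> pcvg (fun n w => c * U n w) (fun w => c * V w).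
Proof.
move=> [mU mV UV]; 
have h : (1 + `|c|) * \int[P]_w dist1 (U n w - V w) @[n --> \oo] --> 0.
  by rewrite -(mulr0 (1 + `|c|)); apply: cvgM => //; exact: cvg_cst.
apply: (@pcvg_le _ _ (fun n => (1 + `|c|) * \int[P]_w dist1 (U n w - V w)) _ _ h)
  => [n||n]; try exact: measurable_funM.
have m1 : measurable_fun setT (fun w => U n w - V w) by exact: measurable_funB.
rewrite -[leRHS]EEZ; last exact: L1_dist1.
apply: EE_le => [||w].
- by apply: L1_dist1; apply: measurable_funB; exact: measurable_funM.
- by apply: L1Z; exact: L1_dist1.
- by rewrite -mulrBr; exact: dist1Z.
Qed.

Lemma pcvg_sum (I : Type) (s : seq I) (U : I -> nat -> T -> R) (V : I -> T -> R) :
  (forall i, pcvg (U i) (V i)) ->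
  pcvg (fun n w => \sum_(i <- s) U i n w) (fun w => \sum_(i <- s) V i w).
Proof.
move=> h; elim: s => [|i s IH].
  under eq_fun do under eq_fun do rewrite big_nil.
  by under [X in pcvg _ X]eq_fun do rewrite big_nil; exact: pcvg_cst.
under eq_fun do under eq_fun do rewrite big_cons.
by under [X in pcvg _ X]eq_fun do rewrite big_cons; exact: pcvgD.
Qed.


Lemma pcvg_ae U V (V' : T -> R) : measurable_fun setT V' ->
  {ae P, forall w, V w = V' w} -> pcvg U V -> pcvg U V'.
Proof.
move=> mV' VV' [mU mV UV]; split => //.
rewrite (_ : (fun n => _) = (fun n => \int[P]_w dist1 (U n w - V w)))//.
apply/funext => n; apply: EE_ae; [| |by apply: filterS VV' => w ->];
  by apply: measurable_dist1; exact: measurable_funB.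
Qed.

Lemma pcvg_in_probability (U : nat -> T -> R) V :
  (forall n, measurable_fun setT (U n)) -> measurable_fun setT V ->
  cvg_in_probability P U V -> pcvg U V.
Proof.
move=> mU mV UV; split => //; apply/cvgr0Pnorm_le => e e0.
have e20 : 0 < e / 2 by rewrite divr_gt0.
have := UV _ e20; move=> /fine_cvgP[_ /cvgr0Pnorm_le/(_ _ e20)] h.
near=> n; have hn : `|fine (P [set w | e / 2 < `|U n w - V w|])| <= e / 2.
  by near: n.
set A := [set w | _] in hn.
have mA : measurable A.
  have mY : measurable_fun setT (fun w => `|U n w - V w|).
    by apply: measurableT_comp => //; exact: measurable_funB.
  have -> : A = setT `&` (fun w => `|U n w - V w|) @^-1` [set` `]e / 2, +oo[].
    by rewrite setTI; apply/seteqP; split => w; rewrite /A /= in_itv /= andbT.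
  exact: mY.
have iA : L1 (\1_A) by exact: integrable_indic.
rewrite ger0_norm; last by apply: EE_ge0 => w; exact: dist1_ge0.
apply: (@le_trans _ _ (\int[P]_w (e / 2 + \1_A w))).
  apply: EE_le => [||w].
  - by apply: L1_dist1; exact: measurable_funB.
  - by apply: L1D => //; exact: L1_cst.
  - rewrite indicE; case: (boolP (w \in A)) => [_|].
      by rewrite (le_trans (dist1_le1 _))// lerDr ltW.
    rewrite notin_setE /A /= => /negP; rewrite -leNgt addr0 => ?.
    by rewrite ge_min; apply/orP; left.
rewrite EED//; last exact: L1_cst.
rewrite EE_cst [in leRHS](splitr e) lerD2l.
have -> : EE (\1_A) = fine (P A) by rewrite /Rintegral integral_indic// setIT.
by rewrite (le_trans (ler_norm _)).
Unshelve. all: by end_near. Qed.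

Lemma EE_dominated (f : nat -> T -> R) (g G : T -> R) :
  (forall n, measurable_fun setT (f n)) -> measurable_fun setT g ->
  {ae P, forall w, f n w @[n --> \oo] --> g w} ->
  L1 G -> (forall n w, `|f n w| <= G w) ->
  EE (f n) @[n --> \oo] --> EE g.
Proof.
move=> mf mg fg iG fG.
have mf' n : measurable_fun setT (EFin \o f n) by exact/measurable_EFinP.
have mg' : measurable_fun setT (EFin \o g) by exact/measurable_EFinP.
have cv : {ae P, forall w, setT w ->
    (EFin \o f n) w @[n --> \oo] --> (EFin \o g) w}.
  by apply: filterS fg => w h' _; apply/fine_cvgP; split => //; exact: nearW.
have bd : {ae P, forall w n, setT w -> (`|(EFin \o f n) w| <= (EFin \o G) w)%E}.
  by apply: aeW => w n _ /=; rewrite lee_fin.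
have [ig _ h] := dominated_convergence measurableT mf' mg' cv iG bd.
apply: fine_cvg; rewrite fineK; first exact: h.
exact: (integrable_fin_num measurableT ig).
Qed.

Lemma pcvg_ae_cvg (U : nat -> T -> R) V :
  (forall n, measurable_fun setT (U n)) -> measurable_fun setT V ->
  {ae P, forall w, U n w @[n --> \oo] --> V w} -> pcvg U V.
Proof.
move=> mU mV UV; split => //; rewrite -[X in _ --> X](EE_cst P 0).
apply: (@EE_dominated _ _ (fun=> 1)) => //.
- by move=> n; apply: measurable_dist1; exact: measurable_funB.
- apply: filterS UV => w h.
  have h0 : `|U n w - V w| @[n --> \oo] --> (0 : R).
    by rewrite -(@normr0 R R); apply: cvg_norm; apply/subr_cvg0.
  apply: (@squeeze_cvgr _ _ _ _ (cst 0) (fun n => `|U n w - V w|)) => //.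
    by apply: nearW => n; rewrite dist1_ge0 /= ge_min lexx.
  exact: cvg_cst.
- exact: L1_cst.
- by move=> n w; exact: dist1_norm.
Qed.

(** By the inequality y <= e / 2 + 2 y^2 / e. *)
Lemma pcvg_L2 (U : nat -> T -> R) V :
  (forall n, measurable_fun setT (U n)) -> measurable_fun setT V ->
  (expectation P (fun w => (U n w - V w) ^+ 2) @[n --> \oo] --> 0%E) ->
  pcvg U V.
Proof.
move=> mU mV UV; split => //; apply/cvgr0Pnorm_le => e e0.
have := UV; move=> /fine_cvgP[UVfin /cvgr0Pnorm_le/(_ (e * e / 4))] h.
have e40 : 0 < e * e / 4 by rewrite divr_gt0// mulr_gt0.
near=> n; have hn : `|fine (expectation P (fun w => (U n w - V w) ^+ 2))| <= e * e / 4.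
  by near: n; exact: h.
have fn : expectation P (fun w => (U n w - V w) ^+ 2) \is a fin_num by near: n.
have mUV : measurable_fun setT (fun w => U n w - V w) by exact: measurable_funB.
have i2 : L1 (fun w => (U n w - V w) ^+ 2).
  apply/integrableP; split.
    by apply/measurable_EFinP; exact: measurable_funX.
  under eq_integral => w _ do rewrite /= ger0_norm ?sqr_ge0//.
  by move: fn; rewrite unlock fin_numE -ltey => /andP[].
rewrite ger0_norm; last by apply: EE_ge0 => w; exact: dist1_ge0.
apply: (@le_trans _ _ (\int[P]_w (e / 2 + 2 / e * (U n w - V w) ^+ 2))).
  apply: EE_le => [||w].
  - exact: L1_dist1.
  - by apply: L1D; [exact: L1_cst|exact: L1Z].
  - rewrite (le_trans (_ : _ <= `|U n w - V w|))//; first by rewrite ge_min lexx.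
    rewrite -(real_normK (num_real (U n w - V w))).
    have := normr_ge0 (U n w - V w); set y := `|_|; move=> y0.
    rewrite -subr_ge0.
    have -> : e / 2 + 2 / e * y ^+ 2 - y = 2 / e * ((y - e / 4) ^+ 2 + 3 / 16 * e ^+ 2).
      by field; rewrite gt_eqF.
    apply: mulr_ge0; first by rewrite divr_ge0// ltW.
    have := sqr_ge0 (y - e / 4); have := sqr_ge0 e; lra.
rewrite EED; [|exact: L1_cst|exact: L1Z].
rewrite EE_cst EEZ//.
rewrite [in leRHS](splitr e) lerD2l.
move: hn; rewrite EE_expectation => /(le_trans (ler_norm _)) hn.
apply: (@le_trans _ _ (2 / e * (e * e / 4))).
  by rewrite ler_pM2l// divr_gt0.
rewrite le_eqVlt; apply/orP; left; apply/eqP; field.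
by rewrite gt_eqF.
Unshelve. all: by end_near. Qed.

End convergence_in_mean_of_truncated_distance.

(** * Independence tested on bounded Lipschitz functions *)

Section bounded_lipschitz_functions.
Context {R : realType}.
Implicit Types f g : R -> R.

(** Bounded Lipschitz functions, a single constant serving both as the bound and
as the Lipschitz constant for the truncated distance. *)
Definition blip f := measurable_fun setT f /\
  exists2 B, forall x, `|f x| <= B &
  forall x y, `|f x - f y| <= B * dist1 (x - y).

Definition clamp (M x : R) : R := Num.max (- M) (Num.min x M).

Lemma measurable_clamp M : measurable_fun setT (clamp M).
Proof. by apply: measurable_maxr => //; exact: measurable_minr. Qed.

Lemma clamp_norm M x : 0 <= M -> `|clamp M x| <= M.
Proof.
move=> M0; rewrite ler_norml /clamp le_max lexx /= ge_max ge_min lexx orbT andbT.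
lra.
Qed.

Lemma clamp_le M x : 0 <= M -> `|clamp M x| <= `|x|.
Proof.
move=> M0; rewrite /clamp /Num.max /Num.min.
case: (ltP x M) => xM; case: ltP => h //; rewrite ?normrN.
- by rewrite ger0_norm// ler0_norm; lra.
- by rewrite !ger0_norm; lra.
- by rewrite !ger0_norm; lra.
Qed.

Lemma clamp_id M x : `|x| <= M -> clamp M x = x.
Proof.
rewrite ler_norml => /andP[h1 h2].
by rewrite /clamp min_l// max_r.
Qed.

Lemma clamp_dist M x y : 0 <= M -> `|clamp M x - clamp M y| <= `|x - y|.
Proof.
move=> M0; rewrite /clamp /Num.max /Num.min ler_norml.
have := ler_norm (x - y); have := ler_norm (- (x - y)); rewrite normrN.
move: `|_| => n n1 n2.
case: (ltP x M) => xM; case: (ltP y M) => yM; case: ltP => h1; case: ltP => h2;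
 lra.
Qed.

Lemma blip_clamp M : 0 <= M -> blip (clamp M).
Proof.
move=> M0; split; first exact: measurable_clamp.
exists (1 + 2 * M) => [x|x y]; first by rewrite (le_trans (clamp_norm x M0))//; lra.
have := clamp_dist x y M0.
have : `|clamp M x - clamp M y| <= 2 * M.
  rewrite (le_trans (ler_normB _ _))//.
  by have := clamp_norm x M0; have := clamp_norm y M0; lra.
have := normr_ge0 (x - y).
rewrite /dist1; move: `|x - y| `|clamp M x - _| => a b a0 bM ba; rewrite /Num.min.
by case: (ltP a 1) => a1; nra.
Qed.

Lemma blip1 : blip (fun=> 1).
Proof.
split => //; exists 1 => [x|x y]; first by rewrite normr1.
by rewrite subrr normr0 mul1r dist1_ge0.
Qed.

Lemma blipM f g : blip f -> blip g -> blip (fun x => f x * g x).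
Proof.
move=> [mf [B Bf Lf]] [mg [C Cg Lg]]; split; first exact: measurable_funM.
have B0 : 0 <= B by rewrite (le_trans _ (Bf 0)).
have C0 : 0 <= C by rewrite (le_trans _ (Cg 0)).
exists (2 * B * C) => [x|x y].
  rewrite normrM (le_trans (ler_pM _ _ (Bf x) (Cg x)))//.
  by have := mulr_ge0 B0 C0; lra.
have -> : f x * g x - f y * g y = f x * (g x - g y) + (f x - f y) * g y by ring.
rewrite (le_trans (ler_normD _ _))// !normrM.
have h1 := ler_pM (normr_ge0 _) (normr_ge0 _) (Bf x) (Lg x y).
have h2 := ler_pM (normr_ge0 _) (normr_ge0 _) (Lf x y) (Cg y).
by move: h1 h2; set u := dist1 _; lra.
Qed.

Lemma blipX f n : blip f -> blip (fun x => f x ^+ n).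
Proof.
move=> bf; elim: n => [|n IH].
  by under eq_fun do rewrite expr0; exact: blip1.
by under eq_fun do rewrite exprS; exact: blipM.
Qed.

Lemma blip_comp_affine f a c : blip f -> blip (fun x => f (a * x + c)).
Proof.
move=> [mf [B Bf Lf]]; split.
  have mg : measurable_fun setT (fun x : R => a * x + c).
    by apply: measurable_funD => //; exact: measurable_funM.
  exact: (measurableT_comp mf mg).
have B0 : 0 <= B by rewrite (le_trans _ (Bf 0)).
exists (B * (1 + `|a|)) => [x|x y].
  rewrite (le_trans (Bf _))//; have := normr_ge0 a; nra.
rewrite (le_trans (Lf _ _))// -mulrA ler_wpM2l//.
have -> : a * x + c - (a * y + c) = a * (x - y) by ring.
exact: dist1Z.
Qed.

End bounded_lipschitz_functions.

Lemma cvg_uniqR {R : realType} (u v : nat -> R) (a b : R) : u =1 v ->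
  u n @[n --> \oo] --> a -> v n @[n --> \oo] --> b -> a = b.
Proof.
move=> /funext -> ua vb.
by rewrite -(cvg_lim (@Rhausdorff R) ua) -(cvg_lim (@Rhausdorff R) vb).
Qed.

Lemma cvg_exprn {R : realType} (u : nat -> R) (l : R) q :
  u n @[n --> \oo] --> l -> u n ^+ q @[n --> \oo] --> l ^+ q.
Proof.
move=> ul; elim: q => [|q IH].
  by under eq_fun do rewrite expr0; rewrite expr0; exact: cvg_cst.
by under eq_fun do rewrite exprS; rewrite exprS; exact: cvgM.
Qed.

Section weak_independence.
Context {R : realType} {d : measure_display} {T : measurableType d}.
Variable P : probability T R.
Implicit Types X Y U V : T -> R.
Local Notation EE X := (\int[P]_w X w).

Lemma L1_blip f X : blip f -> measurable_fun setT X -> L1 P (fun w => f (X w)).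
Proof.
move=> [mf [B Bf _]] mX; apply: (@L1_bounded _ _ _ _ _ B) => //.
exact: measurableT_comp.
Qed.

Lemma pcvg_blip f (U : nat -> T -> R) V : blip f -> pcvg P U V ->
  \int[P]_w f (U n w) @[n --> \oo] --> \int[P]_w f (V w).
Proof.
move=> bf [mU mV UV]; have [mf [B Bf Lf]] := bf.
apply/subr_cvg0; apply: norm_cvg0.
have h : B * \int[P]_w dist1 (U n w - V w) @[n --> \oo] --> (0 : R).
  by rewrite -(mulr0 B); apply: cvgM => //; exact: cvg_cst.
apply: (@squeeze_cvgr _ _ _ _ (cst 0) (fun n => B * \int[P]_w dist1 (U n w - V w))) => //.
  apply: nearW => n; rewrite normr_ge0 /=.
  have m1 : measurable_fun setT (fun w => U n w - V w) by exact: measurable_funB.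
  rewrite -EEZ; last exact: L1_dist1.
  apply: EE_dist; try exact: L1_blip.
    by apply: L1Z; exact: L1_dist1.
  by move=> w; exact: Lf.
exact: cvg_cst.
Qed.

(** Independence in the form that survives limits in probability. *)
Definition windep U V := forall f g, blip f -> blip g ->
  \int[P]_w (f (U w) * g (V w)) = \int[P]_w f (U w) * \int[P]_w g (V w).

Lemma windep_pcvg (U V : nat -> T -> R) X Y : pcvg P U X -> pcvg P V Y ->
  (forall n, windep (U n) (V n)) -> windep X Y.
Proof.
move=> UX VY UV f g bf bg.
have h1 : \int[P]_w f (U n w) * \int[P]_w g (V n w) @[n --> \oo] -->
    \int[P]_w f (X w) * \int[P]_w g (Y w).
  exact: cvgM (pcvg_blip bf UX) (pcvg_blip bg VY).
suff h2 : \int[P]_w (f (U n w) * g (V n w)) @[n --> \oo] -->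
    \int[P]_w (f (X w) * g (Y w)).
  by apply: (cvg_uniqR _ h2 h1) => n; exact: UV.
have [mU mX UX0] := UX; have [mV mY VY0] := VY.
have [mf [B Bf Lf]] := bf; have [mg [C Cg Lg]] := bg.
apply/subr_cvg0; apply: norm_cvg0.
have h : B * C * \int[P]_w dist1 (U n w - X w) +
         B * C * \int[P]_w dist1 (V n w - Y w) @[n --> \oo] --> (0 : R).
  rewrite -[X in _ --> X](addr0 0) -(mulr0 (B * C)).
  by apply: cvgD; apply: cvgM => //; exact: cvg_cst.
apply: (@squeeze_cvgr _ _ _ _ (cst 0) (fun n => B * C * \int[P]_w dist1 (U n w - X w) +
         B * C * \int[P]_w dist1 (V n w - Y w))) => //; last exact: cvg_cst.
apply: nearW => n; rewrite normr_ge0 /=.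
have m1 : measurable_fun setT (fun w => U n w - X w) by exact: measurable_funB.
have m2 : measurable_fun setT (fun w => V n w - Y w) by exact: measurable_funB.
have l1 := L1_dist1 P m1; have l2 := L1_dist1 P m2.
have lfg (X' Y' : T -> R) : measurable_fun setT X' -> measurable_fun setT Y' ->
    L1 P (fun w => f (X' w) * g (Y' w)).
  move=> mX' mY'; apply: (@L1_bounded _ _ _ _ _ (B * C)).
    by apply: measurable_funM; exact: measurableT_comp.
  by move=> w; rewrite normrM ler_pM.
rewrite -!EEZ// -EED; try exact: L1Z.
apply: EE_dist; try exact: lfg.
  by apply: L1D; exact: L1Z.
move=> w.
have -> : f (U n w) * g (V n w) - f (X w) * g (Y w) =
  (f (U n w) - f (X w)) * g (V n w) + f (X w) * (g (V n w) - g (Y w)) by ring.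
rewrite (le_trans (ler_normD _ _))// !normrM.
have k1 := ler_pM (normr_ge0 _) (normr_ge0 _) (Lf (U n w) (X w)) (Cg (V n w)).
have k2 := ler_pM (normr_ge0 _) (normr_ge0 _) (Bf (X w)) (Lg (V n w) (Y w)).
by move: k1 k2; set u := dist1 _; set v := dist1 _; lra.
Qed.

Lemma clamp_cvg (x : R) : clamp n%:R x @[n --> \oo] --> x.
Proof.
apply: cvg_near_cst; near=> n; apply: clamp_id.
near: n; exact: nbhs_infty_ger.
Unshelve. all: by end_near. Qed.

(** Powers are limits of powers of truncations, which are bounded Lipschitz. *)
Lemma windep_moments U V a b : has_moments P U -> has_moments P V ->
  windep U V -> \int[P]_w (U w ^+ a * V w ^+ b) = moment P U a * moment P V b.
Proof.
move=> hU hV UV; have mU := has_moments_measurable hU.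
have mV := has_moments_measurable hV.
have mc (X : T -> R) (q n : nat) : measurable_fun setT X ->
    measurable_fun setT (fun w => clamp n%:R (X w) ^+ q).
  move=> mX; apply: measurable_funX; apply: measurableT_comp => //.
  exact: measurable_clamp.
have c1 (X : T -> R) q : has_moments P X ->
    \int[P]_w (clamp n%:R (X w) ^+ q) @[n --> \oo] --> moment P X q.
  move=> hX; have mX := has_moments_measurable hX.
  apply: (@EE_dominated _ _ _ _ _ _ (fun w => `|X w| ^+ q)).
  - by move=> n; exact: mc.
  - exact: measurable_funX.
  - by apply: aeW => w; apply: cvg_exprn; exact: clamp_cvg.
  - exact: has_moments_norm.
  - by move=> n w; rewrite normrX lerXn2r ?nnegrE// clamp_le.
have h1 : \int[P]_w (clamp n%:R (U w) ^+ a) * \int[P]_w (clamp n%:R (V w) ^+ b)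
    @[n --> \oo] --> moment P U a * moment P V b.
  exact: cvgM (c1 U a hU) (c1 V b hV).
suff h2 : \int[P]_w (clamp n%:R (U w) ^+ a * clamp n%:R (V w) ^+ b) @[n --> \oo]
    --> \int[P]_w (U w ^+ a * V w ^+ b).
  apply: (cvg_uniqR _ h2 h1) => n.
  by apply: (UV (fun x => clamp n%:R x ^+ a) (fun x => clamp n%:R x ^+ b));
    apply: blipX; exact: blip_clamp.
apply: (@EE_dominated _ _ _ _ _ _ (fun w => `|U w ^+ a * V w ^+ b|)).
- by move=> n; apply: measurable_funM; exact: mc.
- by apply: measurable_funM; exact: measurable_funX.
- by apply: aeW => w; apply: cvgM; apply: cvg_exprn; exact: clamp_cvg.
- by apply: L1_norm; exact: L1_mixed.
- by move=> n w; rewrite !normrM !normrX ler_pM// lerXn2r ?nnegrE// clamp_le.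
Qed.

Lemma windepZ U V a c a' c' : windep U V ->
  windep (fun w => a * U w + c) (fun w => a' * V w + c').
Proof.
move=> h f g bf bg.
exact: (h _ _ (blip_comp_affine a c bf) (blip_comp_affine a' c' bg)).
Qed.

Lemma moment_windepD U V n : has_moments P U -> has_moments P V -> windep U V ->
  moment P (fun w => U w + V w) n = bconv (moment P U) (moment P V) n.
Proof.
by move=> hU hV UV; rewrite momentD// => a b; exact: windep_moments.
Qed.

(** Moments of an independent sum are the binomial convolution of the moments,
and convolution of moments is addition of cumulants. *)
Lemma cum_windepD U V m : (0 < m)%N ->
  has_moments P U -> has_moments P V -> windep U V ->
  cum P (fun w => U w + V w) m = cum P U m + cum P V m.
Proof.
move=> m0 hU hV UV; have hUV := has_momentsD hU hV.
apply: (@cumulants_of_uniq _ _ _ (fun m => cum P U m + cum P V m)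
  (moment0 P _) (cumulants_of_moments hUV)) => //.
have := cumulants_of_add (cumulants_of_moments hU) (cumulants_of_moments hV).
by apply: eq_cumulants_of => // n; rewrite moment_windepD.
Qed.

Lemma cumZ c U m : (0 < m)%N -> has_moments P U ->
  cum P (fun w => c * U w) m = c ^+ m * cum P U m.
Proof.
move=> m0 hU; have hcU := has_momentsZ c hU.
apply: (@cumulants_of_uniq _ _ _ (fun m => c ^+ m * cum P U m)
  (moment0 P _) (cumulants_of_moments hcU)) => //.
have := cumulants_of_scale c (cumulants_of_moments hU).
by apply: eq_cumulants_of => // n; rewrite momentZ.
Qed.

Lemma cum_cst c m : (2 <= m)%N -> cum P (fun=> c) m = 0.
Proof.
move=> m2; have hc := has_moments_cst P c.
rewrite (@cumulants_of_uniq _ _ _ (fun m => if m == 1%N then c else 0)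
  (moment0 P _) (cumulants_of_moments hc)).
- by case: eqP m2 => // ->.
- by have := cumulants_of_cst c; apply: eq_cumulants_of => // n; rewrite /moment EE_cst.
- by rewrite (leq_trans _ m2).
Qed.

Lemma cum1 U : has_moments P U -> cum P U 1 = EE U.
Proof.
move=> hU; have := cumulants_of_moments hU 0.
by rewrite /bconv big_ord1 moment0 mulr1 mul1r moment1.
Qed.

(** Cumulants are functions of the moments. *)
Lemma cum_ae U V m : measurable_fun setT V -> has_moments P U ->
  {ae P, forall w, U w = V w} -> (0 < m)%N -> cum P U m = cum P V m.
Proof.
move=> mV hU UV m0; have hV := has_moments_ae mV UV hU.
apply: (@cumulants_of_uniq _ _ _ (cum P V)
  (moment0 P _) (cumulants_of_moments hU)) => //.
have := cumulants_of_moments hV; apply: eq_cumulants_of => // n.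
apply: EE_ae; [exact: measurable_funX| |by apply: filterS UV => w ->].
by apply: measurable_funX; exact: has_moments_measurable hU.
Qed.

End weak_independence.

(** * Moments of limits in probability *)

Section moments_of_limits.
Context {R : realType} {d : measure_display} {T : measurableType d}.
Variable P : probability T R.
Local Notation EE X := (\int[P]_w X w).

Lemma normr_clamp (M x : R) : 0 <= M -> `|clamp M x| = Num.min `|x| M.
Proof.
move=> M0; have [xM|] := leP `|x| M; first by rewrite clamp_id.
rewrite lter_normr /clamp => /orP[Mx|Mx].
- by rewrite min_r ?(ltW Mx)// max_r ?ger0_norm//; lra.
- by rewrite min_l ?max_l ?normrN ?ger0_norm//; lra.
Qed.

Lemma clamp_homo (M N x : R) : 0 <= M -> M <= N -> `|clamp M x| <= `|clamp N x|.
Proof.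
move=> M0 MN; rewrite !normr_clamp//; last exact: le_trans MN.
by rewrite le_min ge_min lexx /= ge_min MN orbT.
Qed.

(** Monotone convergence along the truncation levels. *)
Lemma L1_clamp_bounded V q (C : R) : measurable_fun setT V ->
  (forall n, \int[P]_w (clamp n%:R (V w) ^+ (2 * q)) <= C) ->
  L1 P (fun w => V w ^+ (2 * q)).
Proof.
move=> mV VC; apply/integrableP; split.
  by apply/measurable_EFinP; exact: measurable_funX.
have even0 (x : R) : 0 <= x ^+ (2 * q) by rewrite exprM exprn_ge0// sqr_ge0.
pose g n w := (clamp n%:R (V w) ^+ (2 * q))%:E.
have mg n : measurable_fun setT (g n).
  apply/measurable_EFinP; apply: measurable_funX; apply: measurableT_comp => //.
  exact: measurable_clamp.
have := @monotone_convergence _ _ _ P setT measurableT g mg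
  (fun n w _ => even0 _).
move=> h; apply: (@le_lt_trans _ _ C%:E); last exact: ltry.
rewrite (_ : (\int[P]_w _)%E = (\int[P]_w (limn (g ^~ w)))%E); last first.
  apply: eq_integral => w _ /=; rewrite ger0_norm//; apply/esym/cvg_lim => //.
  apply/fine_cvgP; split; first exact: nearW.
  by apply: cvg_exprn; exact: clamp_cvg.
have nd w : setT w -> nondecreasing_seq (g ^~ w).
  move=> _ m n mn; rewrite lee_fin !exprM -!(real_normK (num_real (clamp _ _))).
  have := @clamp_homo m%:R n%:R (V w) (ler0n _ _); rewrite ler_nat => /(_ mn) mn'.
  by apply: lerXn2r; rewrite ?nnegrE ?exprn_ge0//; apply: lerXn2r.
rewrite h//; apply: lime_le.
  by apply: ereal_nondecreasing_is_cvgn => m n mn; apply: ge0_le_integral => // t _;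
    [rewrite /g lee_fin; exact: even0|exact: nd].
apply: nearW => n; rewrite /g.
have iL : L1 P (fun w => clamp n%:R (V w) ^+ (2 * q)).
  apply: (@L1_blip _ _ _ P (fun x => clamp n%:R x ^+ (2 * q))) => //.
  by apply: blipX; exact: blip_clamp.
rewrite -(fineK (integrable_fin_num measurableT iL)) lee_fin.
exact: VC.
Qed.

(** On |x| > M, $|x|^q \le x^{2q} / M^q$. *)
Lemma clamp_pow_dist (M x : R) q : 1 <= M -> (0 < q)%N ->
  `|x ^+ q - clamp M x ^+ q| <= 2 / M * x ^+ (2 * q).
Proof.
move=> M1 q0; have M0 : 0 < M by lra.
have even0 : 0 <= x ^+ (2 * q) by rewrite exprM exprn_ge0// sqr_ge0.
have [xM|Mx] := leP `|x| M.
  by rewrite clamp_id// subrr normr0 mulr_ge0// divr_ge0// ltW.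
have h1 : `|x| ^+ q <= M^-1 * x ^+ (2 * q).
  have -> : x ^+ (2 * q) = `|x| ^+ q * `|x| ^+ q.
    by rewrite -expr2 -exprM mulnC !exprM -!normrX ger0_norm// sqr_ge0.
  rewrite mulrA ler_peMl ?exprn_ge0// mulrC ler_pdivlMr// mul1r.
  case: q q0 {even0} => // q _; rewrite exprSr.
  rewrite (le_trans (ltW Mx))// ler_peMl// exprn_ege1//; lra.
have h2 : `|clamp M x| ^+ q <= `|x| ^+ q.
  by apply: lerXn2r; rewrite ?nnegrE// clamp_le// ltW.
rewrite (le_trans (ler_normB _ _))// !normrX; move: h1 h2.
by rewrite -mulrA; lra.
Qed.

(** A bound on the moments of order 2q makes the q-th powers uniformly
integrable: truncation at level M changes the q-th moment by at most
2 C / M, and truncated powers are bounded Lipschitz functions. *)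
Theorem pcvg_moments (U : nat -> T -> R) V :
  (forall n, has_moments P (U n)) -> pcvg P U V ->
  (forall q, exists C, forall n, moment P (U n) (2 * q) <= C) ->
  has_moments P V /\ forall q, moment P (U n) q @[n --> \oo] --> moment P V q.
Proof.
move=> hU UV Ub; have [mU mV _] := UV.
have bl (M : R) q : 0 <= M -> blip (fun x => clamp M x ^+ q).
  by move=> M0; apply: blipX; exact: blip_clamp.
have even0 q (x : R) : 0 <= x ^+ (2 * q) by rewrite exprM exprn_ge0// sqr_ge0.
have Vb q C : (forall n, moment P (U n) (2 * q) <= C) ->
    forall k, \int[P]_w (clamp k%:R (V w) ^+ (2 * q)) <= C.
  move=> UC k; have h := pcvg_blip (bl k%:R (2 * q)%N (ler0n _ _)) UV.
  rewrite -(cvg_lim (@Rhausdorff R) h); apply: limr_le.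
    by apply/cvg_ex; eexists; exact: h.
  apply: nearW => n; apply: le_trans (UC n); apply: EE_le.
  - by apply: (L1_blip P (bl _ _ _)) => //.
  - exact: hU.
  - move=> w; rewrite !exprM; apply: lerXn2r; rewrite ?nnegrE ?sqr_ge0//.
    rewrite -(real_normK (num_real (clamp _ _))) -(real_normK (num_real (U n w))).
    by apply: lerXn2r; rewrite ?nnegrE// clamp_le.
have hV : has_moments P V.
  apply: has_moments_even => // q _; have [C UC] := Ub q.
  exact: (L1_clamp_bounded mV (Vb _ _ UC)).
split=> // q; case: (posnP q) => [->|q0].
  rewrite moment0 (_ : (fun n => _) = cst 1); first exact: cvg_cst.
  by apply/funext => n; rewrite moment0.
have [C UC] := Ub q.
have C0 : 0 <= C by apply: le_trans (UC 0%N); apply: EE_ge0.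
have VC : moment P V (2 * q) <= C.
  have h : \int[P]_w (clamp k%:R (V w) ^+ (2 * q)) @[k --> \oo] --> moment P V (2 * q).
    apply: (@EE_dominated _ _ _ _ _ _ (fun w => `|V w| ^+ (2 * q))).
    - move=> n; apply: measurable_funX; apply: measurableT_comp => //.
      exact: measurable_clamp.
    - exact: measurable_funX.
    - by apply: aeW => w; apply: cvg_exprn; exact: clamp_cvg.
    - exact: has_moments_norm.
    - by move=> n w; rewrite normrX; apply: lerXn2r; rewrite ?nnegrE// clamp_le.
  rewrite -(cvg_lim (@Rhausdorff R) h); apply: limr_le.
    by apply/cvg_ex; eexists; exact: h.
  by apply: nearW => n; exact: Vb.
have tail (X : T -> R) M : has_moments P X -> 1 <= M -> moment P X (2 * q) <= C ->
    `|moment P X q - \int[P]_w (clamp M (X w) ^+ q)| <= 2 / M * C.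
  move=> hX M1 XC; have mX := has_moments_measurable hX.
  have M0 : 0 < M by lra.
  apply: (@le_trans _ _ (\int[P]_w (2 / M * X w ^+ (2 * q)))).
    apply: EE_dist => //.
    - by apply: (L1_blip P (bl _ _ _)) => //; exact: ltW.
    - exact: L1Z.
    - by move=> w; exact: clamp_pow_dist.
  by rewrite EEZ// ler_wpM2l// divr_ge0// ltW.
apply/cvgrPdist_le => e e0.
(* With this level both truncation errors are at most e / 4. *)
pose M := 1 + 8 * C / e.
have M1 : 1 <= M by rewrite lerDl divr_ge0 ?mulr_ge0// ltW.
have M0 : 0 < M by lra.
have MC : 2 / M * C <= e / 4.
  rewrite mulrAC ler_pdivrMr// /M.
  have -> : e / 4 * (1 + 8 * C / e) = e / 4 + 2 * C by field; rewrite gt_eqF.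
  lra.
have e2 : 0 < e / 2 by rewrite divr_gt0.
have /cvgrPdist_le/(_ _ e2) hc := pcvg_blip (bl M q (ltW M0)) UV.
near=> n.
have hn : `|\int[P]_w (clamp M (V w) ^+ q) - \int[P]_w (clamp M (U n w) ^+ q)| <= e / 2.
  by near: n.
have t1 := tail _ _ hV M1 VC; have t2 := tail _ _ (hU n) M1 (UC n).
move: hn t1 t2; rewrite !ler_norml => /andP[a1 a2] /andP[b1 b2] /andP[c1 c2].
by apply/andP; split; lra.
Unshelve. all: by end_near. Qed.

End moments_of_limits.

(** * Independence of generated sigma-algebras *)

Section independence_of_generated_sigma_algebras.
Context {R : realType} {d : measure_display} {T : measurableType d}.
Variable P : probability T R.
Implicit Types (F G : set (set T)) (U V X : T -> R).

Lemma gen_sigma_measurable G : G `<=` measurable -> <<s G >> `<=` measurable.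
Proof. by move=> Gm; apply: smallest_sub => //; exact: sigma_algebra_measurable. Qed.

(** The pi-lambda argument: the sets independent of a fixed event form a
lambda-system. *)
Lemma indep_systems_gen F G : setI_closed F ->
  F `<=` measurable -> G `<=` measurable ->
  indep_systems P F G -> indep_systems P <<s F >> G.
Proof.
move=> FI Fm Gm FG A B FA GB; have mB := Gm _ GB.
have sm := gen_sigma_measurable Fm.
apply: (@dynkin_induction _ (g_sigma_algebraType F) F
  (fun A => P (A `&` B) = (P A * P B)%E)) FA => //.
- by rewrite setTI (probability_setT P) mul1e.
- by move=> S FS; exact: FG.
- move=> S' /sm mS PS'; pose S : set T := S'.
  have PS : P (S `&` B) = (P S * P B)%E := PS'.
  rewrite -[LHS]/(P (~` S `&` B)) -[RHS]/(P (~` S) * P B)%E.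
  rewrite setIC -setDE measureD//; last first.
    by rewrite ltey_eq fin_num_measure.
  rewrite probability_setC// setIC.
  have compl (x y : \bar R) : x \is a fin_num -> y \is a fin_num ->
      (y - x * y = (1 - x) * y)%E.
    case: x => // x _; case: y => // y _.
    by rewrite -EFinM -!EFinB -EFinM mulrBl mul1r.
  transitivity (P B - P S * P B)%E; first by congr (_ - _)%E; exact: PS.
  by apply: compl; exact: fin_num_measure.
- move=> S mS tS PS.
  have mS' n : measurable (S n : set T) by apply: sm; exact: mS.
  have h1 : (\sum_(0 <= i < n) P (S i `&` B))%E @[n --> \oo] -->
      P (\bigcup_k (S k) `&` B).
    rewrite setI_bigcupl; apply: measure_sigma_additive.
      by move=> i; exact: measurableI.
    by move=> i j _ _ [w [[w1 _] [w2 _]]]; apply: tS => //; exists w.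
  have h2 : (\sum_(0 <= i < n) P (S i))%E @[n --> \oo] --> P (\bigcup_k (S k)).
    exact: measure_sigma_additive.
  have h3 := cvgeZr (fin_num_measure P _ mB) h2.
  move: h1; rewrite (_ : (fun n => _) = (fun n => (\sum_(0 <= i < n) P (S i)) * P B)%E).
    by move=> /cvg_lim <- //; move/cvg_lim : h3 => <-.
  apply/funext => n; rewrite ge0_sume_distrl; last by move=> i _; exact: measure_ge0.
  by apply: eq_bigr => i _; exact: PS.
Qed.

Lemma indep_systemsC F G : indep_systems P F G -> indep_systems P G F.
Proof. by move=> h A B GA FB; rewrite setIC h// muleC. Qed.

Lemma indep_systems_gen2 F G : setI_closed F -> setI_closed G ->
  F `<=` measurable -> G `<=` measurable ->
  indep_systems P F G -> indep_systems P <<s F >> <<s G >>.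
Proof.
move=> FI GI Fm Gm FG; apply: indep_systemsC; apply: indep_systems_gen => //.
  exact: gen_sigma_measurable.
by apply: indep_systemsC; exact: indep_systems_gen.
Qed.

Lemma indep_systemsS F F' G G' : F' `<=` F -> G' `<=` G ->
  indep_systems P F G -> indep_systems P F' G'.
Proof. by move=> FF GG h A B /FF FA /GG GB; exact: h. Qed.

Lemma sigma_rvP U A : sigma_rv U A <-> exists2 B, measurable B & A = U @^-1` B.
Proof.
by split=> [[B mB <-]|[B mB ->]]; exists B; rewrite ?setTI.
Qed.

Lemma sigma_rv_measurable U : measurable_fun setT U -> sigma_rv U `<=` measurable.
Proof. by move=> mU A [B mB <-]; exact: mU. Qed.

Lemma setI_closed_sigma_rv U : setI_closed (sigma_rv U).
Proof.
move=> A B /sigma_rvP[A' mA ->] /sigma_rvP[B' mB ->].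
by apply/sigma_rvP; exists (A' `&` B'); [exact: measurableI|].
Qed.

Lemma sigma_rvT U : sigma_rv U setT.
Proof. by apply/sigma_rvP; exists setT. Qed.

(** Measurability with respect to a sub-sigma-algebra is measurability on
the same set with a coarser measurable structure. *)
Lemma sigma_rv_sub G U : (sigma_rv U `<=` <<s G >>) <->
  measurable_fun (setT : set (g_sigma_algebraType G)) (U : g_sigma_algebraType G -> R).
Proof.
split=> [h _ B mB|h A [B mB <-]]; first by apply: h; exists B.
exact: h.
Qed.

Lemma sigma_rv_lincomb G (I : Type) (s : seq I) (c : I -> R) (U : I -> T -> R) :
  (forall i, sigma_rv (U i) `<=` <<s G >>) ->
  sigma_rv (fun w => \sum_(i <- s) c i * U i w) `<=` <<s G >>.
Proof.
move=> h; apply/sigma_rv_sub.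
apply: (@measurable_sum _ (g_sigma_algebraType G) R setT I s
  (fun i w => c i * U i w)) => i.
by apply: measurable_funM => //; apply/sigma_rv_sub.
Qed.

Lemma sigma_rvD G U V : sigma_rv U `<=` <<s G >> -> sigma_rv V `<=` <<s G >> ->
  sigma_rv (fun w => U w + V w) `<=` <<s G >>.
Proof.
by move=> /sigma_rv_sub hU /sigma_rv_sub hV; apply/sigma_rv_sub; exact: measurable_funD.
Qed.

Lemma sigma_rvZ G c U : sigma_rv U `<=` <<s G >> ->
  sigma_rv (fun w => c * U w) `<=` <<s G >>.
Proof.
by move=> /sigma_rv_sub hU; apply/sigma_rv_sub; exact: measurable_funM.
Qed.

Section cylinders.
Context {I : eqType}.
Variables (D : set I) (F : I -> set (set T)).
Hypothesis FI : forall i, D i -> setI_closed (F i).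
Hypothesis FT : forall i, D i -> F i setT.
Hypothesis Fm : forall i, D i -> F i `<=` measurable.

(** A pi-system generating the joint sigma-algebra of the members of J. *)
Definition cylinders (J : seq I) : set (set T) :=
  [set A | exists2 E : I -> set T, (forall i, i \in J -> F i (E i)) &
    A = \big[setI/setT]_(i <- J) E i].

Definition uniq_in (J : seq I) := uniq J /\ forall i, i \in J -> D i.

Lemma setI_closed_cylinders J : uniq_in J -> setI_closed (cylinders J).
Proof.
move=> [_ JD] A B [E hE ->] [E' hE' ->]; exists (fun i => E i `&` E' i).
  by move=> i iJ; apply: FI; [exact: JD|exact: hE|exact: hE'].
by rewrite big_split.
Qed.

Lemma cylinders_measurable J : uniq_in J -> cylinders J `<=` measurable.
Proof.
move=> [_ JD] A [E hE ->]; rewrite big_seq; apply: big_ind => //.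
  exact: measurableI.
by move=> i iJ; apply: (Fm (JD _ iJ)); exact: hE.
Qed.

Lemma sub_cylinders J i : uniq_in J -> i \in J -> F i `<=` cylinders J.
Proof.
move=> [uJ JD] iJ A FA; exists (fun j => if j == i then A else setT).
  by move=> j jJ; case: eqP => [->//|_]; exact: FT (JD _ jJ).
rewrite (bigD1_seq i)//= eqxx big1 ?setIT// => j /negPf.
by move=> ->.
Qed.

Lemma cylinders_indep J J' : mutual_indep_systems P D F ->
  uniq_in J -> uniq_in J' -> (forall i, i \in J -> i \notin J') ->
  indep_systems P <<s cylinders J >> <<s cylinders J' >>.
Proof.
move=> FP hJ hJ' JJ'; apply: indep_systems_gen2;
  [exact: setI_closed_cylinders..|exact: cylinders_measurable|exact: cylinders_measurable|].
have [uJ JD] := hJ; have [uJ' JD'] := hJ'.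
move=> A B [E hE ->] [E' hE' ->].
pose E2 i := if i \in J then E i else E' i.
have e1 : \big[setI/setT]_(i <- J) E i = \big[setI/setT]_(i <- J) E2 i.
  by apply: eq_big_seq => i iJ; rewrite /E2 iJ.
have e2 : \big[setI/setT]_(i <- J') E' i = \big[setI/setT]_(i <- J') E2 i.
  apply: eq_big_seq => i iJ'; rewrite /E2; case: ifPn => // /JJ'.
  by rewrite iJ'.
have hE2 i : i \in J ++ J' -> D i /\ F i (E2 i).
  rewrite mem_cat /E2 => /orP[] iJ; first by rewrite iJ; split; [exact: JD|exact: hE].
  case: ifPn => iJ2; first by have := JJ' _ iJ2; rewrite iJ.
  by split; [exact: JD'|exact: hE'].
have uJJ : uniq (J ++ J').
  rewrite cat_uniq uJ uJ' andbT /=; apply/hasPn => i iJ'.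
  by apply/negP => /JJ'; rewrite iJ'.
have E0 := FP (J ++ J') E2 uJJ hE2; rewrite !big_cat /= in E0.
have EJ : P (\big[setI/setT]_(i <- J) E2 i) = (\prod_(i <- J) fine (P (E2 i)))%:E.
  by apply: FP => // i iJ; apply: hE2; rewrite mem_cat iJ.
have EJ' : P (\big[setI/setT]_(i <- J') E2 i) = (\prod_(i <- J') fine (P (E2 i)))%:E.
  by apply: FP => // i iJ; apply: hE2; rewrite mem_cat iJ orbT.
by rewrite e1 e2 EJ EJ' -EFinM; exact: E0.
Qed.

End cylinders.

(** The joint law agrees with the product of the marginal laws on rectangles,
hence everywhere, and Fubini's theorem factorizes the mean. *)
Lemma indep_windep U V : measurable_fun setT U -> measurable_fun setT V ->
  indep_systems P (sigma_rv U) (sigma_rv V) -> windep P U V.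
Proof.
move=> mU mV UV f g bf bg.
have [mf [B Bf _]] := bf; have [mg [C Cg _]] := bg.
pose U' : {mfun T >-> R} := mfun_Sub (mem_set mU).
pose V' : {mfun T >-> R} := mfun_Sub (mem_set mV).
have mUV : measurable_fun setT (fun w => (U w, V w)) by exact: measurable_fun_pair.
pose UV' : {mfun T >-> (R * R)%type} := mfun_Sub (mem_set mUV).
pose h (z : R * R) := (f z.1 * g z.2)%:E.
have mh : measurable_fun setT h.
  by apply/measurable_EFinP; apply: measurable_funM; exact: measurableT_comp.
have ih : P.-integrable setT (h \o UV').
  have : L1 P (fun w => f (U w) * g (V w)).
    apply: (@L1_bounded _ _ _ _ _ (B * C)).
      by apply: measurable_funM; exact: measurableT_comp.
    by move=> w; rewrite normrM ler_pM.
  by [].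
have e1 : (\int[P]_w (f (U w) * g (V w))%:E = \int[distribution P UV']_z h z)%E.
  by rewrite integral_distribution.
pose PU := distribution P U'; pose PV := distribution P V'.
have eA A : measurable A -> (PU \x PV)%E A = distribution P UV' A.
  apply: product_measure_unique => A1 A2 mA1 mA2.
  apply: (UV (U @^-1` A1) (V @^-1` A2)); first by apply/sigma_rvP; exists A1.
  by apply/sigma_rvP; exists A2.
have e2 : (\int[distribution P UV']_z h z = \int[PU \x PV]_z h z)%E.
  by apply: eq_measure_integral => A mA _; exact/esym/eA.
have fT : ((PU \x PV)%E setT < +oo)%E.
  rewrite eA//; apply: (@le_lt_trans _ _ 1%E); last exact: ltry.
  exact: (probability_le1 (distribution P UV')).
have ip : (PU \x PV)%E.-integrable setT h.
  apply: (@measurable_bounded_integrable _ _ _ _ (fun z => f z.1 * g z.2)) => //.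
  - by apply/measurable_EFinP.
  - exists (B * C); split => [|M BM z _ /=]; first exact: num_real.
    by rewrite (le_trans _ (ltW BM))// normrM ler_pM.
have ig : L1 PV g by apply: (@L1_bounded _ _ _ PV _ C).
have igx : L1 PU f by apply: (@L1_bounded _ _ _ PU _ B).
have eg : \int[PV]_y g y = \int[P]_w g (V w).
  congr fine; rewrite integral_distribution//; first exact/measurable_EFinP.
  by apply: (@L1_blip _ _ _ P g).
have ef : \int[PU]_y f y = \int[P]_w f (U w).
  congr fine; rewrite integral_distribution//; first exact/measurable_EFinP.
  by apply: (@L1_blip _ _ _ P f).
rewrite {1}/Rintegral e1 e2 -integral12_prod_meas1//.
rewrite -ef -eg /=.
transitivity (\int[PU]_x (f x * \int[PV]_y g y)); last first.
  under eq_Rintegral do rewrite mulrC.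
  by rewrite EEZ// mulrC.
congr fine; apply: eq_integral => x _; rewrite /fubini_F /h /=.
rewrite -[RHS]/((f x * \int[PV]_y g y)%:E) -EEZ//.
rewrite /Rintegral fineK//.
exact: (integrable_fin_num measurableT (L1Z (f x) ig)).
Qed.

End independence_of_generated_sigma_algebras.

(** * Innovations of a stationary Ornstein-Uhlenbeck type process *)

Section Ornstein_Uhlenbeck_innovations.
Context {R : realType} {d : measure_display} {T : measurableType d}.
Variable P : probability T R.
Variables (lam : R) (Y Z : R -> {RV P >-> R}).
Hypothesis lam0 : 0 < lam.
Hypothesis Zlevy : levy_process Z.
Hypothesis YZ : stationary_OU lam Y Z.
Variables (h : R) (h0 : 0 < h).

(** Uniform partitions of mesh h / (J + 1): every multiple of h is a node, so the
partition of [0, (n + 1) h] extends the one of [0, n h]. *)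
Let node (J l : nat) : R := l%:R * (h / J.+1%:R).

Let incr J l : T -> R := fun w => Z (lam * node J l.+1) w - Z (lam * node J l) w.

Let riemann J i : T -> R := fun w =>
  \sum_(l < i * J.+1) expR (- lam * (i%:R * h - node J l)) * incr J l w.

Let approx J i : T -> R := fun w =>
  expR (- lam * (i%:R * h)) * Y 0 w + riemann J i w.

Let step0 J : 0 < h / J.+1%:R. Proof. by rewrite divr_gt0. Qed.

Let node_ge0 J l : 0 <= node J l.
Proof. by rewrite mulr_ge0// ltW. Qed.

Let node_lt J l : node J l < node J l.+1.
Proof. by rewrite /node ltr_pM2r// ltr_nat. Qed.

Let node_end J i : node J (i * J.+1) = i%:R * h.
Proof. by rewrite /node natrM -mulrA [_ * (h / _)]mulrC divfK. Qed.

Let mincr J l : measurable_fun setT (incr J l).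
Proof. exact: measurable_funB. Qed.

Let mriemann J i : measurable_fun setT (riemann J i).
Proof. by apply: measurable_sum => l; exact: measurable_funM. Qed.

Let riemann_cvg (V : R -> {RV P >-> R}) i :
  is_stochastic_integral (fun s => expR (- lam * (i%:R * h - s)))
    (fun s => Z (lam * s)) 0 (i%:R * h) (V (i%:R * h)) ->
  pcvg P (fun J => riemann J i) (V (i%:R * h)).
Proof.
move=> /(_ (fun J => i * J.+1)%N node) H; apply: pcvg_in_probability => //.
apply: H => [J|e e0].
  split; [by rewrite /node mul0r|exact: node_end|by move=> l _; exact/ltW].
have c0 : h / J.+1%:R @[J --> \oo] --> (0 : R).
  rewrite -(mulr0 h); apply: cvgM; first exact: cvg_cst.
  exact: cvg_harmonic.
near=> J => l _.
have -> : node J l.+1 - node J l = h / J.+1%:R.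
  by rewrite /node -mulrBl -natrB// subSnn mul1r.
rewrite -[ltLHS]ger0_norm ?ltW//; near: J.
by move/cvgr0Pnorm_lt : c0; exact.
Unshelve. all: by end_near. Qed.

Let approx_cvg i : pcvg P (fun J => approx J i) (Y (i%:R * h)).
Proof.
have [V Vint Veq] := OU_equation YZ.
have ih0 : 0 <= i%:R * h by rewrite mulr_ge0// ltW.
apply: (@pcvg_ae _ _ _ _ _ (fun w => expR (- lam * (i%:R * h)) * Y 0 w + V (i%:R * h) w)) => //.
  by apply: filterS (Veq _ ih0) => w ->.
apply: pcvgD; first by apply: pcvgZ; exact: pcvg_cst.
exact/riemann_cvg/Vint.
Qed.

Let rho := expR (- lam * h).

(** The factor rho turns the kernel of the integral up to n h into the kernel of
the integral up to (n + 1) h, so the common increments cancel. *)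
Let innovE J n w : approx J n.+1 w - rho * approx J n w =
  \sum_(k < J.+1) expR (- lam * (n.+1%:R * h - node J (k + n * J.+1)%N))
     * incr J (k + n * J.+1)%N w.
Proof.
have E x : rho * expR (- lam * (n%:R * h - x)) = expR (- lam * (n.+1%:R * h - x)).
  by rewrite /rho -expRD; congr expR; rewrite -natr1; ring.
pose f l := expR (- lam * (n.+1%:R * h - node J l)) * incr J l w.
have e1 : riemann J n.+1 w = \sum_(0 <= l < n.+1 * J.+1) f l by rewrite big_mkord.
have e2 : rho * riemann J n w = \sum_(0 <= l < n * J.+1) f l.
  by rewrite big_mkord /riemann big_distrr; apply: eq_bigr => l _; rewrite /= mulrA E.
have := E 0; rewrite !subr0 => E0.
rewrite /approx mulrDr mulrA E0 opprD addrACA subrr add0r e1 e2.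
rewrite (@big_cat_nat _ _ _ (n * J.+1))//=; last by rewrite leq_mul2r leqnSn orbT.
rewrite addrC addKr -{1}[(n * J.+1)%N]add0n big_addn.
by rewrite mulSn addnK big_mkord.
Qed.

Let M J n := (n.+1 * J.+1)%N.

Let incr_indep J n : mutual_indep_systems P [set i | (i < M J n)%N]
  (fun l => sigma_rv (incr J l)).
Proof.
apply: (levy_indep Zlevy (n := M J n) (t := fun l => lam * node J l)).
  by rewrite mulr_ge0// ltW.
by move=> l _; rewrite ltr_pM2l.
Qed.

Let sigma_incr J l : sigma_rv (incr J l) `<=` sigma_process Z.
Proof.
have hZ t : 0 <= t -> sigma_rv (Z t) `<=` sigma_process Z.
  by move=> t0 A ZA; apply: sub_sigma_algebra; exists t.
rewrite (_ : incr J l = fun w => Z (lam * node J l.+1) w + -1 * Z (lam * node J l) w).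
  apply: sigma_rvD; first by apply: hZ; rewrite mulr_ge0// ltW.
  by apply: sigma_rvZ; apply: hZ; rewrite mulr_ge0// ltW.
by apply/funext => w; rewrite mulN1r.
Qed.

Lemma sub_gen_cylinders (I : eqType) (F : I -> set (set T)) (J : seq I)
    (G : set (set T)) :
  (forall i, i \in J -> F i `<=` <<s G >>) -> <<s cylinders F J >> `<=` <<s G >>.
Proof.
move=> FG; apply: smallest_sub; first exact: smallest_sigma_algebra.
move=> A [E hE ->]; rewrite big_seq; apply: big_ind.
- exact: (@measurableT _ (g_sigma_algebraType G)).
- by move=> B C mB mC; exact: (@measurableI _ (g_sigma_algebraType G)).
- by move=> i iJ; apply: (FG _ iJ); exact: hE.
Qed.

(** Every approximation of the past is a function of Y 0 and of the first
n (J+1) increments of Z, the innovation is a function of the next J+1. *)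
Let approx_windep J n (a : nat -> R) :
  windep P (fun w => \sum_(i < n.+1) a i * approx J i w)
    (fun w => approx J n.+1 w - rho * approx J n w).
Proof.
pose F l := sigma_rv (incr J l).
pose D := [set i | (i < M J n)%N].
pose s1 := iota 0 (n * J.+1); pose s2 := iota (n * J.+1) J.+1.
have FI i : D i -> setI_closed (F i) by move=> _; exact: setI_closed_sigma_rv.
have FT i : D i -> F i setT by move=> _; exact: sigma_rvT.
have Fm i : D i -> F i `<=` measurable by move=> _; exact: sigma_rv_measurable.
have w1 : uniq_in D s1.
  split; first exact: iota_uniq.
  move=> i; rewrite mem_iota add0n /= => /leq_trans; apply.
  by rewrite leq_mul2r leqnSn orbT.
have w2 : uniq_in D s2.
  by split; [exact: iota_uniq|move=> i; rewrite mem_iota -mulSnr => /andP[]].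
have s12 i : i \in s1 -> i \notin s2.
  by rewrite !mem_iota add0n /= => i1; rewrite negb_and -ltnNge i1.
have I12 := cylinders_indep FI Fm (@incr_indep J n) w1 w2 s12.
have m1 := gen_sigma_measurable (cylinders_measurable Fm w1).
have m2 := gen_sigma_measurable (cylinders_measurable Fm w2).
have sZ s : <<s cylinders F s >> `<=` sigma_process Z.
  by apply: sub_gen_cylinders => i _; exact: sigma_incr.
have mY0 : measurable_fun setT (Y 0) by [].
(* The past: events of Y 0 intersected with events of the first increments. *)
pose Q := [set C | exists A B, [/\ sigma_rv (Y 0) A, <<s cylinders F s1 >> B & C = A `&` B]].
have cI s B C : <<s cylinders F s >> B -> <<s cylinders F s >> C ->
    <<s cylinders F s >> (B `&` C).
  exact: (@measurableI _ (g_sigma_algebraType (cylinders F s))).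
have QI : setI_closed Q.
  move=> _ _ [A [B [hA hB ->]]] [A' [B' [hA' hB' ->]]].
  exists (A `&` A'), (B `&` B'); split; last by rewrite setIACA.
    exact: setI_closed_sigma_rv.
  exact: cI.
have Qm : Q `<=` measurable.
  move=> _ [A [B [hA hB ->]]]; apply: measurableI; last exact: m1.
  exact: sigma_rv_measurable hA.
have Yind := OU_initial YZ.
have Q2 : indep_systems P Q <<s cylinders F s2 >>.
  move=> _ C [A [B [hA hB ->]]] hC.
  have zB := sZ _ _ hB; have zC := sZ _ _ hC.
  have zBC : sigma_process Z (B `&` C).
    exact: (@measurableI _ (g_sigma_algebraType
      [set A | exists2 t : R, 0 <= t & sigma_rv (Z t) A])).
  have e1 := Yind _ _ hA zBC; have e2 := I12 _ _ hB hC; have e3 := Yind _ _ hA zB.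
  rewrite -setIA; apply: (etrans e1); rewrite e2 muleA; congr (_ * _)%E.
  exact: esym e3.
have I2 := indep_systems_gen QI Qm m2 Q2.
have cyl1 l : (l < n * J.+1)%N -> sigma_rv (incr J l) `<=` <<s Q >>.
  move=> ln A hA; apply: sub_sigma_algebra; exists setT, A; split.
  - exact: sigma_rvT.
  - apply: sub_sigma_algebra; apply: (sub_cylinders FT w1 _ hA).
    by rewrite mem_iota.
  - by rewrite setTI.
have cyl0 : sigma_rv (Y 0) `<=` <<s Q >>.
  move=> A hA; apply: sub_sigma_algebra; exists A, setT; split=> //.
  - exact: (@measurableT _ (g_sigma_algebraType (cylinders F s1))).
  - by rewrite setIT.
have mapprox i : measurable_fun setT (approx J i).
  by apply: measurable_funD => //; exact: measurable_funM.
apply: indep_windep.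
- by apply: measurable_sum => i; exact: measurable_funM.
- by apply: measurable_funB => //; exact: measurable_funM.
apply: (indep_systemsS _ _ I2).
- apply: sigma_rv_lincomb => i; apply: sigma_rvD; first exact: sigma_rvZ.
  apply: sigma_rv_lincomb => l; apply: cyl1.
  by rewrite (leq_trans (ltn_ord l))// leq_mul2r -ltnS ltn_ord orbT.
- rewrite (_ : (fun w => _) = fun w => \sum_(k < J.+1)
      expR (- lam * (n.+1%:R * h - node J (k + n * J.+1)%N)) *
      incr J (k + n * J.+1)%N w); last first.
    by apply/funext => w; exact: innovE.
  apply: sigma_rv_lincomb => k A hA; apply: sub_sigma_algebra.
  apply: (sub_cylinders FT w2 _ hA).
  by rewrite mem_iota leq_addl /= addnC ltn_add2l.
Qed.

(** The increment Y ((n+1) h) - rho Y (n h) is a stochastic integral over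
]n h, (n+1) h], independent of the past because Z has independent increments
and Y 0 is independent of Z. Riemann sums make this exact, and independence
passes to the limit in probability. *)
Theorem OU_innovation_windep n (a : nat -> R) :
  windep P (fun w => \sum_(i < n.+1) a i * Y (i%:R * h) w)
    (fun w => Y (n.+1%:R * h) w - expR (- lam * h) * Y (n%:R * h) w).
Proof.
apply: (@windep_pcvg _ _ _ _
  (fun J w => \sum_(i < n.+1) a i * approx J i w)
  (fun J w => approx J n.+1 w - rho * approx J n w)).
- by apply: pcvg_sum => i; exact: pcvgZ.
- have := pcvgD (approx_cvg n.+1) (pcvgZ (- rho) (approx_cvg n)).
  under eq_fun do under eq_fun do rewrite mulNr.
  by under [X in pcvg _ _ X]eq_fun do rewrite mulNr.
- by move=> J; exact: approx_windep.
Qed.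

End Ornstein_Uhlenbeck_innovations.

(** * Cumulants of series of independent variables *)

Section sums_of_independent_variables.
Context {R : realType} {d : measure_display} {T : measurableType d}.
Variable P : probability T R.
Implicit Types (W : nat -> T -> R).
Local Notation EE X := (\int[P]_w X w).

Lemma mutual_indep_windep W (F : nat -> set (set T)) :
  mutual_indep_systems P [set k | (1 <= k)%N] F ->
  (forall k, (1 <= k)%N -> measurable_fun setT (W k)) ->
  (forall k, (1 <= k)%N -> sigma_rv (W k) `<=` F k) ->
  forall K, (1 <= K)%N -> windep P (fun w => \sum_(1 <= k < K) W k w) (W K).
Proof.
move=> FP mW WF K K1.
pose D := [set k | (1 <= k)%N]; pose G k := sigma_rv (W k).
have GP : mutual_indep_systems P D G.
  move=> J E uJ JE; apply: FP => // i iJ; have [Di Gi] := JE i iJ.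
  by split=> //; exact: (WF i Di).
have FI i : D i -> setI_closed (G i) by move=> _; exact: setI_closed_sigma_rv.
have FT i : D i -> G i setT by move=> _; exact: sigma_rvT.
have Fm i : D i -> G i `<=` measurable by move=> Di; apply: sigma_rv_measurable; exact: mW.
have w1 : uniq_in D (index_iota 1 K).
  by split; [exact: iota_uniq|move=> i; rewrite mem_index_iota => /andP[]].
have w2 : uniq_in D [:: K] by split=> // i; rewrite inE => /eqP ->.
have s12 i : i \in index_iota 1 K -> i \notin [:: K].
  by rewrite mem_index_iota inE => /andP[_ iK]; rewrite ltn_eqF.
have I12 := cylinders_indep FI Fm GP w1 w2 s12.
have mS : measurable_fun setT (fun w => \sum_(1 <= k < K) W k w).
  rewrite (_ : (fun w => _) = fun w => \sum_(i < K - 1) W (i + 1)%N w); last first.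
    apply/funext => w; rewrite -{1}[1%N]add0n big_addn.
    by rewrite big_mkord.
  by apply: measurable_sum => i; apply: mW; rewrite addn1.
apply: indep_windep => //; first exact: mW.
apply: (indep_systemsS _ _ I12).
- rewrite (_ : (fun w => _) = fun w => \sum_(i < K - 1) 1 * W (i + 1)%N w); last first.
    apply/funext => w; rewrite -{1}[1%N]add0n big_addn big_mkord.
    by apply: eq_bigr => i _; rewrite mul1r.
  apply: sigma_rv_lincomb => i A hA; apply: sub_sigma_algebra.
  apply: (sub_cylinders FT w1 _ hA); rewrite mem_index_iota addn1 /=.
  by have := ltn_ord i; rewrite ltn_subRL add1n.
- move=> A hA; apply: sub_sigma_algebra; apply: (sub_cylinders FT w2 _ hA).
  by rewrite inE.
Qed.

Lemma cvg_bounded_above (u : nat -> R) (l : R) : u n @[n --> \oo] --> l ->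
  exists C, forall n, u n <= C.
Proof.
move=> ul; have /cvg_seq_bounded[M [Mr hM]] : cvgn u by apply/cvg_ex; exists l.
exists (M + 1) => n; apply: (le_trans (ler_norm _)).
by apply: (hM (M + 1)) => //; rewrite ltrDl.
Qed.

Lemma has_moments_sum_nat W K : (forall k, (1 <= k)%N -> has_moments P (W k)) ->
  has_moments P (fun w => \sum_(1 <= k < K) W k w).
Proof.
move=> hW; elim: K => [|K IH].
  by under eq_fun do rewrite big_geq//; exact: has_moments_cst.
case: K IH => [|K] IH.
  by under eq_fun do rewrite big_geq//; exact: has_moments_cst.
under eq_fun do rewrite big_nat_recr//=.
by apply: has_momentsD => //; exact: hW.
Qed.

Lemma cum0 m : (0 < m)%N -> cum P (fun=> 0) m = 0.
Proof.
case: m => // -[|m] _; last exact: cum_cst.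
by rewrite cum1 ?EE_cst//; exact: has_moments_cst.
Qed.

Lemma cum_sum_nat W K m : (0 < m)%N ->
  (forall k, (1 <= k)%N -> has_moments P (W k)) ->
  (forall K, (1 <= K)%N -> windep P (fun w => \sum_(1 <= k < K) W k w) (W K)) ->
  cum P (fun w => \sum_(1 <= k < K) W k w) m = \sum_(1 <= k < K) cum P (W k) m.
Proof.
move=> m0 hW WI; elim: K => [|K IH].
  rewrite big_geq// (_ : (fun w => _) = fun=> 0) ?cum0//.
  by apply/funext => w; rewrite big_geq.
case: K IH => [|K] IH.
  rewrite big_geq// (_ : (fun w => _) = fun=> 0) ?cum0//.
  by apply/funext => w; rewrite big_geq.
rewrite big_nat_recr//= -IH -cum_windepD//; [|exact: has_moments_sum_nat|exact: hW|exact: WI].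
by congr (cum P _ m); apply/funext => w; rewrite big_nat_recr.
Qed.

(** Cumulants of finite sums add. Convergence of all the cumulants of the partial
sums gives convergence of all their moments, which are thus bounded, so the
moments of the limit variable are the limits of the moments; its cumulants are
then identified by the moment-cumulant relation. *)
Theorem cum_series W V (s : nat -> R) :
  (forall k, (1 <= k)%N -> has_moments P (W k)) ->
  (forall K, (1 <= K)%N -> windep P (fun w => \sum_(1 <= k < K) W k w) (W K)) ->
  pcvg P (fun n w => \sum_(1 <= k < n) W k w) V ->
  (forall m, (0 < m)%N -> \sum_(1 <= k < n) cum P (W k) m @[n --> \oo] --> s m) ->
  has_moments P V /\ forall m, (0 < m)%N -> cum P V m = s m.
Proof.
move=> hW WI WV Ws.
pose U n w := \sum_(1 <= k < n) W k w.
have hU n : has_moments P (U n) by exact: has_moments_sum_nat.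
have Us m : (0 < m)%N -> cum P (U n) m @[n --> \oo] --> s m.
  move=> m0; have := Ws m m0.
  by under eq_fun do rewrite -cum_sum_nat//.
have [mu muc Umu] := cumulants_of_cvg (fun n => moment0 P (U n))
  (fun n => cumulants_of_moments (hU n)) Us.
have [hV UV] := pcvg_moments hU WV (fun q => cvg_bounded_above (Umu (2 * q)%N)).
split=> // m m0.
apply: (cumulants_of_uniq (moment0 P _) (cumulants_of_moments hV) _ m0).
apply: eq_cumulants_of muc => // q.
by apply: (cvg_uniqR _ (Umu q) (UV q)).
Qed.

Lemma cum_shift X c m : (2 <= m)%N -> has_moments P X ->
  cum P (fun w => X w + c) m = cum P X m.
Proof.
move=> m2 hX; have m0 : (0 < m)%N by exact: leq_trans m2.
have hc := has_moments_cst P c.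
rewrite cum_windepD// ?cum_cst ?addr0// => f g bf bg; rewrite EE_cst.
under eq_Rintegral do rewrite mulrC.
rewrite [RHS]mulrC; apply: (@EEZ _ _ _ P (g c) (fun w => f (X w))).
by apply: L1_blip => //; exact: has_moments_measurable.
Qed.

End sums_of_independent_variables.

(** * Cumulants of sums of an Ornstein-Uhlenbeck type process *)

Section Ornstein_Uhlenbeck_cumulants.
Context {R : realType} {d : measure_display} {T : measurableType d}.
Variable P : probability T R.
Variables (lam : R) (Y Z : R -> {RV P >-> R}).
Hypothesis lam0 : 0 < lam.
Hypothesis Zlevy : levy_process Z.
Hypothesis YZ : stationary_OU lam Y Z.
Hypothesis hY : forall t, 0 <= t -> has_moments P (Y t).
Variables (h : R) (h0 : 0 < h).
Variables (m : nat) (kap : R).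
Hypothesis m2 : (2 <= m)%N.
Hypothesis kapY : forall t, 0 <= t -> cum P (Y t) m = kap.

Let rho := expR (- lam * h).
Let m0 : (0 < m)%N. Proof. exact: leq_trans m2. Qed.

Let eps n w := Y (n.+1%:R * h) w - rho * Y (n%:R * h) w.

Let ih_ge0 i : 0 <= i%:R * h. Proof. by rewrite mulr_ge0// ltW. Qed.

Lemma has_moments_innovation n : has_moments P (eps n).
Proof. by apply: has_momentsB; [exact: hY|apply: has_momentsZ; exact: hY]. Qed.

Let single n c : (fun w => c * Y (n%:R * h) w) =
  (fun w => \sum_(i < n.+1) (if i == n :> nat then c else 0) * Y (i%:R * h) w).
Proof.
apply/funext => w; rewrite (bigD1 ord_max)//= eqxx big1 ?addr0// => i /negPf.
by rewrite -val_eqE /= => ->; rewrite mul0r.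
Qed.

(** Y ((n+1) h) is the independent sum of rho Y (n h) and the innovation, and
its m-th cumulant is the same as that of Y (n h). *)
Lemma cum_innovation n : cum P (eps n) m = (1 - rho ^+ m) * kap.
Proof.
have W := OU_innovation_windep lam0 Zlevy YZ h0 n
  (fun i => if i == n then rho else 0).
rewrite -single -/rho in W.
have := cum_windepD m0 (has_momentsZ rho (hY (ih_ge0 n))) (has_moments_innovation n) W.
rewrite (_ : (fun w => _) = Y (n.+1%:R * h)); last first.
  by apply/funext => w; rewrite /eps addrC subrK.
rewrite cumZ ?kapY//; last exact: hY.
by move=> e; rewrite mulrBl mul1r {1}e addrC addKr.
Qed.

Lemma cum_OU_sum0 : cum P (fun w => Y 0 w + Y h w) m =
  ((1 + rho) ^+ m + (1 - rho ^+ m)) * kap.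
Proof.
have W := OU_innovation_windep lam0 Zlevy YZ h0 0 (fun=> 1 + rho).
rewrite (_ : (fun w => Y 0 w + Y h w) = (fun w =>
  \sum_(i < 1) (1 + rho) * Y (i%:R * h) w + eps 0 w)); last first.
  by apply/funext => w; rewrite big_ord1 /eps !mul0r !mul1r; ring.
rewrite cum_windepD//; last exact: has_moments_innovation.
  rewrite cum_innovation; under eq_fun do rewrite big_ord1.
  by rewrite cumZ ?kapY ?mulrDl//; exact: hY.
by under eq_fun do rewrite big_ord1; apply: has_momentsZ; exact: hY.
Qed.

Let geo (b : R) := 1 + rho * b.

(** Peeling off the last innovation, of coefficient b, replaces the coefficient
of the previous term by 1 + rho b; keeping b general makes induction on n
possible. *)
Let partial n b w := \sum_(i < n) Y (i.+1%:R * h) w + b * Y (n.+1%:R * h) w.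

Let has_moments_partial n b : has_moments P (partial n b).
Proof.
by apply: has_momentsD; [apply: has_moments_sum => i|apply: has_momentsZ]; exact: hY.
Qed.

Let partialE n b w : partial n.+1 b w = partial n (geo b) w + b * eps n.+1 w.
Proof. by rewrite /partial big_ord_recr /= /geo /eps; ring. Qed.

Let cum_partial n b : cum P (partial n b) m =
  ((rho * iter n geo b) ^+ m +
   (1 - rho ^+ m) * \sum_(j < n.+1) iter j geo b ^+ m) * kap.
Proof.
elim: n b => [|n IH] b.
  have W := OU_innovation_windep lam0 Zlevy YZ h0 0 (fun=> rho * b).
  have := windepZ 1 0 b 0 W; rewrite -/rho.
  under eq_fun do rewrite big_ord1 mul1r addr0.
  under [X in windep _ _ X]eq_fun do rewrite addr0.
  move=> W'; rewrite (_ : partial 0 b = fun w => rho * b * Y (0%:R * h) w + b * eps 0 w).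
    rewrite cum_windepD//; [|apply: has_momentsZ; exact: hY|
      by apply: has_momentsZ; exact: has_moments_innovation].
    rewrite !cumZ//; [|exact: has_moments_innovation|exact: hY].
    by rewrite cum_innovation kapY// big_ord1 /=; ring.
  by apply/funext => w; rewrite /partial big_ord0 /eps; ring.
pose a i : R := if i == 0%N then 0 else if i == n.+1 then geo b else 1.
have W := OU_innovation_windep lam0 Zlevy YZ h0 n.+1 a.
have aE w : \sum_(i < n.+2) a i * Y (i%:R * h) w = partial n (geo b) w.
  rewrite big_ord_recl /a /= mul0r add0r big_ord_recr /= eqxx; congr (_ + _).
  by apply: eq_bigr => i _ /=; rewrite eqSS (ltn_eqF (ltn_ord i)) mul1r.
have := windepZ 1 0 b 0 W; rewrite -/rho.
under eq_fun do rewrite aE mul1r addr0.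
under [X in windep _ _ X]eq_fun do rewrite addr0.
move=> W'; rewrite (_ : partial n.+1 b =
  fun w => partial n (geo b) w + b * eps n.+1 w); last first.
  by apply/funext => w; exact: partialE.
rewrite cum_windepD//; last by apply: has_momentsZ; exact: has_moments_innovation.
rewrite IH cumZ//; last exact: has_moments_innovation.
rewrite cum_innovation -iterSr [in RHS]big_ord_recl.
rewrite [in RHS](eq_bigr (fun i : 'I_n.+1 => iter i geo (geo b) ^+ m)); last first.
  by move=> i _; rewrite lift0 iterSr.
by rewrite [iter (ord0 : 'I_n.+2) _ _]/=; ring.
Qed.

Lemma cum_OU_partial_sum n : cum P (fun w => \sum_(i < n.+1) Y (i.+1%:R * h) w) m =
  ((rho * \sum_(i < n.+1) rho ^+ i) ^+ m +
   (1 - rho ^+ m) * \sum_(j < n.+1) (\sum_(i < j.+1) rho ^+ i) ^+ m) * kap.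
Proof.
have E j : iter j geo 1 = \sum_(i < j.+1) rho ^+ i.
  elim: j => [|j IH]; first by rewrite big_ord1 expr0.
  rewrite iterS IH [in RHS]big_ord_recl expr0 /geo big_distrr; congr (_ + _).
  by apply: eq_bigr => i _; rewrite lift0 exprS.
have := cum_partial n 1; rewrite E.
rewrite [X in _ + _ * X](eq_bigr
  (fun j : 'I_n.+1 => (\sum_(i < j.+1) rho ^+ i) ^+ m));
  last by move=> j _; rewrite E.
move=> <-; congr (cum P _ m); apply/funext => w.
by rewrite big_ord_recr /= /partial mul1r.
Qed.

End Ornstein_Uhlenbeck_cumulants.

(** * An integrable majorant on the half-line *)

Section power_function_integrals.
Context {R : realType}.
Local Notation mu := (@lebesgue_measure R).
Variable b : R.
Hypothesis b0 : 0 < b.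

(** Up to the factor b, the derivative of x^b / (1 + x^b): of order x^(b-1) at
0 and of order x^(-1-b) at infinity, with an explicit bounded primitive. *)
Definition bump_fun (x : R) : R := x `^ (b - 1) * ((1 + x `^ b) ^- 2).

Let F (x : R) : R := - b^-1 * (1 + x `^ b)^-1.

Lemma is_derive_bump (x : R) : 0 < x -> is_derive x 1 F (bump_fun x).
Proof.
move=> x0; have n0 : 1 + x `^ b != 0 by rewrite gt_eqF// ltr_pwDl// powR_ge0.
have h1 : is_derive x 1 (fun t : R => 1 + t `^ b) (0 + b * x `^ (b - 1)) :=
  @is_deriveD _ _ _ (fun=> 1 : R) (fun t : R => t `^ b) _ _ _ _
    (is_derive_cst _ _ _) (@is_derive1_powR R b x x0).
have h2 := @is_deriveV _ (fun t => 1 + t `^ b) _ _ _ n0 h1.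
have h3 : is_derive x 1 F _ := @is_deriveZ _ _ _ _ (- b^-1) _ _ _ h2.
apply: is_derive_eq h3 _.
rewrite /bump_fun /GRing.scale /= add0r.
by field; rewrite n0 gt_eqF.
Qed.

Lemma bump_ge0 (x : R) : 0 <= bump_fun x.
Proof. by rewrite mulr_ge0 ?powR_ge0// invr_ge0 sqr_ge0. Qed.

Lemma bump_continuous (x : R) : 0 < x -> {for x, continuous bump_fun}.
Proof.
move=> x0; have n0 : 1 + x `^ b != 0 by rewrite gt_eqF// ltr_pwDl// powR_ge0.
have cp a : {for x, continuous (fun t : R => t `^ a)}.
  apply/differentiable_continuous/derivable1_diffP.
  by have := @is_derive1_powR R a x x0; case.
apply: cvgM; first exact: cp.
apply: cvgV; first by rewrite expf_neq0.
rewrite expr2; under eq_fun do rewrite expr2.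
by apply: cvgM; apply: cvgD; try exact: cvg_cst; exact: cp.
Qed.

Lemma integral_bump_itv (n : nat) :
  (\int[mu]_(x in [set` `[n.+2%:R^-1, n.+2%:R]%R]) (bump_fun x)%:E <= (b^-1)%:E)%E.
Proof.
have a0 : 0 < n.+2%:R^-1 :> R by rewrite invr_gt0.
have ab : n.+2%:R^-1 < n.+2%:R :> R.
  by rewrite (@lt_trans _ _ 1)// ?invf_lt1// ltr1n.
have cF (x : R) : 0 < x -> {for x, continuous F}.
  move=> x0; apply/differentiable_continuous/derivable1_diffP.
  by have := is_derive_bump x0; case.
rewrite (@continuous_FTC2 _ bump_fun F)//.
- rewrite -EFinB lee_fin /F.
  have P0 (x : R) : 0 < 1 + x `^ b by rewrite ltr_pwDl// powR_ge0.
  set u := (1 + _)^-1; set v := (1 + _)^-1.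
  have u0 : 0 <= u by rewrite invr_ge0 ltW.
  have v1 : v <= 1 by rewrite invf_le1// lerDl powR_ge0.
  have : 0 < b^-1 by rewrite invr_gt0.
  by nra.
- apply: continuous_in_subspaceT => x; rewrite inE /= in_itv /= => /andP[ax _].
  by apply: bump_continuous; exact: lt_le_trans ax.
- split.
  + move=> x; rewrite in_itv /= => /andP[ax _].
    by have := is_derive_bump (lt_trans a0 ax); case.
  + by apply: cvg_at_right_filter; exact: cF.
  + by apply: cvg_at_left_filter; apply: cF; exact: lt_trans ab.
- move=> x; rewrite in_itv /= => /andP[ax _].
  rewrite derive1E; apply: derive_val; apply: is_derive_bump.
  exact: lt_trans ax.
Qed.

Lemma measurable_bump : measurable_fun ([set` `]0, +oo[] : set R) bump_fun.
Proof.
apply: open_continuous_measurable_fun => // x; rewrite inE /= in_itv /= andbT.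
exact: bump_continuous.
Qed.

Lemma integrable_bump : mu.-integrable ([set` `]0, +oo[] : set R) (EFin \o bump_fun).
Proof.
apply/integrableP; split; first by apply/measurable_EFinP; exact: measurable_bump.
pose I n := [set` `[n.+2%:R^-1, n.+2%:R :> R]].
pose g n := (EFin \o bump_fun) \_ (I n).
have mI n : measurable (I n) by exact: measurable_itv.
have ID n : I n `<=` `]0, +oo[.
  move=> x; rewrite /I /= !in_itv /= => /andP[ax _]; rewrite andbT.
  by rewrite (lt_le_trans _ ax)// invr_gt0.
have mg n : measurable_fun ([set` `]0, +oo[] : set R) (g n).
  apply/measurable_restrict => //; rewrite setIidr//.
  by apply/measurable_EFinP; apply: measurable_funS measurable_bump.
have g0 n x : (0 <= g n x)%E.
  by rewrite /g /patch; case: ifP => // _; rewrite lee_fin bump_ge0.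
have nd x : ([set` `]0, +oo[] : set R) x -> nondecreasing_seq (g ^~ x).
  move=> _ m n mn; rewrite /g /patch; case: ifPn => [xm|_]; last exact: g0.
  rewrite ifT//; move: xm; rewrite !inE /I /= !in_itv /= => /andP[h1 h2].
  apply/andP; split; last by rewrite (le_trans h2)// ler_nat !ltnS.
  by rewrite (le_trans _ h1)// lef_pV2 ?posrE// ler_nat !ltnS.
have mD : measurable ([set` `]0, +oo[] : set R) by exact: measurable_itv.
have h := @monotone_convergence _ _ _ mu _ mD g mg (fun n x _ => g0 n x) nd.
rewrite (_ : (\int[mu]_(x in _) _)%E = (\int[mu]_(x in [set` `]0, +oo[%R]) (limn (g ^~ x)))%E); last first.
  apply: eq_integral => x; rewrite inE /= in_itv /= andbT => x0.
  rewrite ger0_norm ?bump_ge0//; apply/esym/cvg_lim => //.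
  apply: cvg_near_cst; near=> n; rewrite /g /patch ifT// inE /I /= in_itv /=.
  apply/andP; split.
    rewrite invf_ple ?posrE//; apply: (@le_trans _ _ n%:R); last by rewrite ler_nat -addn2 leq_addr.
    by near: n; exact: nbhs_infty_ger.
  apply: (@le_trans _ _ n%:R); last by rewrite ler_nat -addn2 leq_addr.
  by near: n; exact: nbhs_infty_ger.
rewrite h; apply: (@le_lt_trans _ _ (b^-1)%:E); last exact: ltry.
apply: lime_le.
  apply: ereal_nondecreasing_is_cvgn => m n mn.
  apply: ge0_le_integral => //; [exact: mg|exact: mg|].
  by move=> x Dx; exact: (nd x Dx _ _ mn).
apply: nearW => n; rewrite /g -integral_mkcondr.
by rewrite setIidr//; exact: integral_bump_itv.
Unshelve. all: by end_near. Qed.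

End power_function_integrals.

(** * Scaling limits of power-weighted series *)

Lemma cvg_truncnS {R : realType} (s : nat -> R) (x : R) :
  (forall n, 0 < s n) -> s n @[n --> \oo] --> +oo -> 0 < x ->
  (Num.truncn (s n * x)).+1%:R / s n @[n --> \oo] --> x.
Proof.
move=> s0 s_infty x0.
  have is0 : (s n)^-1 @[n --> \oo] --> (0 : R).
    by apply/gtr0_cvgV0 => //; near=> n; exact: s0.
  have h2 : x + (s n)^-1 @[n --> \oo] --> x.
    by rewrite -[X in _ --> X]addr0; apply: cvgD => //; exact: cvg_cst.
  apply: (@squeeze_cvgr _ _ _ _ (cst x) (fun n => x + (s n)^-1)) => //; last exact: cvg_cst.
  apply: nearW => n; have sx0 : 0 <= s n * x by rewrite mulr_ge0 ?ltW.
  apply/andP; split; first by rewrite /cst ler_pdivlMr// mulrC ltW// truncnS_gt.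
  rewrite ler_pdivrMr// mulrDl mulVf ?gt_eqF// -natr1 lerD2r [x * _]mulrC.
  by rewrite truncn_le.
Unshelve. all: by end_near. Qed.

Section power_weighted_series.
Context {R : realType}.
Local Notation mu := (@lebesgue_measure R).
Variables (alpha c : R) (s : nat -> R) (phi : nat -> nat -> R) (g : R -> R).
Hypothesis alpha01 : 0 < alpha < 1.
Hypothesis s0 : forall n, 0 < s n.
Hypothesis phi0 : forall n k, (1 <= k)%N -> 0 <= phi n k.
Hypothesis phic : forall n k, (1 <= k)%N -> phi n k <= c.
Hypothesis phik : forall n k, (1 <= k)%N -> phi n k <= c * (k%:R / s n).

Local Notation D := ([set` `]0, +oo[] : set R).

Definition weighted_integral : R :=
  fine (\int[mu]_(x in D) (x `^ (- (1 + alpha)) * g x)%:E).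

Let mD : measurable D. Proof. exact: measurable_itv. Qed.

Let int_fin h : mu.-integrable D h -> (\int[mu]_(x in D) h x)%E \is a fin_num.
Proof. by apply: integrable_fin_num; exact: measurable_itv. Qed.

Let in_D x : D x <-> 0 < x.
Proof. by rewrite /= in_itv /= andbT. Qed.

Let a n k : R := (k.+1%:R / s n) `^ (- (1 + alpha)) * phi n k.+1.

Let J n k : set R := [set` `[k%:R / s n, k.+1%:R / s n[].

Let a_ge0 n k : 0 <= a n k.
Proof. by rewrite mulr_ge0 ?powR_ge0// phi0. Qed.

Let JP n k x : 0 <= x -> J n k x <-> Num.truncn (s n * x) = k.
Proof.
move=> x0; have sx0 : 0 <= s n * x by rewrite mulr_ge0// ltW.
rewrite /J /= in_itv /= ler_pdivrMr// ltr_pdivlMr// mulrC.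
by rewrite -truncn_eq//; split => [/eqP|->].
Qed.

Let stepE n x : 0 <= x -> (a n (Num.truncn (s n * x)))%:E =
  (\sum_(k <oo) (a n k * \1_(J n k) x)%:E)%E.
Proof.
move=> x0; rewrite (@nneseriesD1 _ _ (Num.truncn (s n * x)))//; last first.
  by move=> k _; rewrite lee_fin mulr_ge0.
rewrite eseries0 ?adde0.
  rewrite indicE mem_set ?mulr1//; exact/JP.
move=> k _ /= ktr; rewrite indicE memNset ?mulr0//.
by move=> /(JP n k x0) e; rewrite e eqxx in ktr.
Qed.

Let measure_J n k : mu (J n k `&` D) = ((s n)^-1)%:E.
Proof.
have ks : k%:R / s n < k.+1%:R / s n by rewrite ltr_pM2r ?invr_gt0// ltr_nat.
have e : ((k.+1%:R / s n)%R%:E - (k%:R / s n)%R%:E = ((s n)^-1)%R%:E)%E.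
  by rewrite -EFinB -mulrBl -natrB// subSnn mul1r.
case: k ks e => [|k] ks e.
  rewrite (_ : _ `&` _ = [set` `]0, 1 / s n[]).
    by rewrite lebesgue_measure_itv /= lte_fin divr_gt0// -EFinB subr0 mul1r.
  apply/seteqP; split => x; rewrite /J /= !in_itv /= mul0r ?andbT.
    by move=> [/andP[_ ->] ->].
  by move=> /andP[x0 ->]; rewrite x0 ltW.
rewrite setIidl.
  by rewrite lebesgue_measure_itv /= lte_fin ks.
move=> x; rewrite /J /= !in_itv /= => /andP[h _]; rewrite andbT.
by rewrite (lt_le_trans _ h)// divr_gt0.
Qed.

Let mstep n k : measurable_fun D (fun x => (a n k * \1_(J n k) x)%:E).
Proof.
apply/measurable_EFinP; apply: measurable_funM => //.
by apply: measurable_indic; exact: measurable_itv.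
Qed.

Let f n x := (a n (Num.truncn (s n * x)))%:E.

Let mf n : measurable_fun D (f n).
Proof.
apply: (eq_measurable_fun (fun x => \sum_(k <oo) (a n k * \1_(J n k) x)%:E)%E).
  by move=> x; rewrite inE => /in_D/ltW x0; rewrite -stepE.
by apply: ge0_emeasurable_sum => k; [move=> x _ _; rewrite lee_fin mulr_ge0|].
Qed.

Let int_f n : (\int[mu]_(x in D) f n x = \sum_(k <oo) (a n k / s n)%:E)%E.
Proof.
have -> : (\int[mu]_(x in D) f n x =
    \int[mu]_(x in D) \sum_(k <oo) (a n k * \1_(J n k) x)%:E)%E.
  by apply: eq_integral => x; rewrite inE => /in_D/ltW x0; rewrite -stepE.
rewrite integral_nneseries//; last 2 first.
- by move=> k; exact: mstep.
- by move=> k x _; rewrite lee_fin mulr_ge0.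
apply: eq_eseriesr => k _.
under eq_integral do rewrite EFinM.
rewrite ge0_integralZl_EFin//.
- rewrite integral_indic//; last exact: measurable_itv.
  rewrite [RHS]EFinM; exact: (congr1 (fun y => (a n k)%:E * y)%E (measure_J n k)).
- by apply/measurable_EFinP; apply: measurable_indic; exact: measurable_itv.
Qed.

(** The largest exponent for which the majorant dominates x^(-alpha) at 0 and
x^(-1-alpha) at infinity. *)
Let b := Num.min alpha (1 - alpha).

Let b0 : 0 < b.
Proof. by move/andP: alpha01 => [h1 h2]; rewrite lt_min h1 subr_gt0. Qed.

Let c0 : 0 <= c.
Proof. by apply: le_trans (phic 0 (leqnn 1)); exact: phi0. Qed.

Let powR_lt1 (x : R) (p q : R) : 0 < x -> x <= 1 -> q <= p -> x `^ p <= x `^ q.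
Proof. by move=> x0 x1; apply: ger_powR; rewrite x0. Qed.

(** With y = k / s >= x: for x <= 1 the bound phi <= c y gives y^(-alpha), for
x > 1 the bound phi <= c gives y^(-1-alpha); both powers are decreasing. *)
Let dom (x : R) : 0 < x -> forall n, a n (Num.truncn (s n * x)) <= c * (4 * bump_fun b x).
Proof.
move=> x0 n; have [al0 al1] := andP alpha01.
have b1 : b <= alpha by rewrite ge_min lexx.
have b2 : b <= 1 - alpha by rewrite ge_min lexx orbT.
set k := Num.truncn _; rewrite /a.
set y := k.+1%:R / s n.
have xy : x <= y by rewrite ler_pdivlMr// mulrC ltW// truncnS_gt.
have y0 : 0 < y by exact: lt_le_trans xy.
have anti p : 0 <= p -> y `^ (- p) <= x `^ (- p).
  move=> p0; rewrite !powRN lef_pV2 ?posrE ?powR_gt0//.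
  by apply: ge0_ler_powR => //; rewrite nnegrE ltW.
have P0 : 0 < 1 + x `^ b by rewrite ltr_pwDl// powR_ge0.
case: (leP x 1) => x1.
- have h1 : y `^ (- (1 + alpha)) * phi n k.+1 <= c * x `^ (- alpha).
    apply: (@le_trans _ _ (y `^ (- (1 + alpha)) * (c * y))).
      by rewrite ler_wpM2l ?powR_ge0// phik.
    rewrite mulrCA; apply: ler_wpM2l => //.
    have -> : y `^ (- (1 + alpha)) * y = y `^ (- alpha).
      rewrite -{2}(powRr1 (ltW y0)) -powRD; last by rewrite (gt_eqF y0) implybT.
      by congr (_ `^ _); ring.
    by apply: anti; exact: ltW.
  apply: (le_trans h1); apply: ler_wpM2l => //; rewrite /bump_fun.
  have h2 : x `^ (- alpha) <= x `^ (b - 1) by apply: powR_lt1 => //; lra.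
  apply: (le_trans h2); rewrite mulrCA ler_peMr ?powR_ge0//.
  rewrite ler_pdivlMr ?exprn_gt0// mul1r.
  have : x `^ b <= 1 by rewrite -(powRr0 x); apply: powR_lt1 => //; exact: ltW.
  move=> xb1; have := powR_ge0 x b; nra.
- have h1 : y `^ (- (1 + alpha)) * phi n k.+1 <= c * x `^ (- (1 + alpha)).
    rewrite mulrC; apply: ler_pM; rewrite ?powR_ge0 ?phi0 ?phic//.
    by apply: anti; lra.
  apply: (le_trans h1); apply: ler_wpM2l => //; rewrite /bump_fun.
  have x1' : 1 <= x by exact: ltW.
  have h2 : x `^ (- (1 + alpha)) <= x `^ (b - 1 - 2 * b) by apply: ler_powR => //; lra.
  apply: (le_trans h2); rewrite powRB; last by rewrite (gt_eqF x0) implybT.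
  rewrite mulrCA; apply: ler_wpM2l; first exact: powR_ge0.
  have xb1 : 1 <= x `^ b by rewrite -(powRr0 x); apply: ler_powR => //; exact: ltW.
  rewrite ler_pdivlMr ?exprn_gt0// mulrC ler_pdivrMr ?powR_gt0//.
  have -> : x `^ (2 * b) = x `^ b * x `^ b.
    by rewrite -powRD ?(gt_eqF x0) ?implybT//; congr (_ `^ _); ring.
  nra.
Qed.

Hypothesis phig : forall x, 0 < x ->
  phi n (Num.truncn (s n * x)).+1 @[n --> \oo] --> g x.
Hypothesis g0 : forall x, 0 < x -> 0 < g x.
Hypothesis s_infty : s n @[n --> \oo] --> +oo.

Let limit x := x `^ (- (1 + alpha)) * g x.

Let a_cvg x : 0 < x -> a n (Num.truncn (s n * x)) @[n --> \oo] --> limit x.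
Proof.
move=> x0; apply: cvgM; last exact: phig.
have h := cvg_truncnS s0 s_infty x0.
suff cp : {for x, continuous (fun y : R => y `^ (- (1 + alpha)))}.
  exact: (cvg_comp _ _ h cp).
apply/differentiable_continuous/derivable1_diffP.
by have := @is_derive1_powR R (- (1 + alpha)) x x0; case.
Qed.

Let dominated : mu.-integrable D (EFin \o limit) /\
  (\int[mu]_(x in D) f n x @[n --> \oo] --> \int[mu]_(x in D) (limit x)%:E)%E.
Proof.
have cv x : D x -> f n x @[n --> \oo] --> (limit x)%:E.
  move=> /in_D x0; apply/fine_cvgP; split; first exact: nearW.
  exact: a_cvg.
have ml : measurable_fun D (EFin \o limit).
  by have := @emeasurable_fun_cvg _ _ R D f _ mf cv.
have idom : mu.-integrable D (fun x => c%:E * (4%:E * (bump_fun b x)%:E))%E.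
  by do 2 apply: integrableZl => //; exact: integrable_bump.
have H := fun acv abd => @dominated_convergence _ _ _ mu D mD f (EFin \o limit)
  _ mf ml acv idom abd.
case: H => [||il _ cvI] //.
- by apply: aeW => x /cv.
- apply: aeW => x n /in_D x0 /=; rewrite ger0_norm ?a_ge0//.
  by rewrite -!EFinM lee_fin; exact: dom.
Qed.

Lemma weighted_integral_gt0 : 0 < weighted_integral.
Proof.
have [il _] := dominated.
have l0 x : D x -> 0 < limit x.
  by move=> /in_D x0; rewrite mulr_gt0 ?powR_gt0// g0.
have ge0 : (0 <= \int[mu]_(x in D) (limit x)%:E)%E.
  by apply: integral_ge0 => x /l0/ltW; rewrite lee_fin.
rewrite /weighted_integral lt_neqAle fine_ge0// andbT eq_sym; apply/negP => /eqP I0.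
have int0 : (\int[mu]_(x in D) (limit x)%:E = 0)%E.
  by rewrite -(fineK (int_fin il)) I0.
have ml : measurable_fun D (EFin \o limit) by case/integrableP : il.
have : (\int[mu]_(x in D) `|(EFin \o limit) x| = 0)%E.
  rewrite -int0; apply: eq_integral => x; rewrite inE => /l0/ltW lx.
  by rewrite /= ger0_norm.
move=> /(ae_eq_integral_abs mu mD ml) [N [mN N0 DN]].
have : (mu D <= mu N)%E.
  apply: le_measure; rewrite ?inE// => x Dx; apply: DN => /= /(_ Dx) /eqP.
  by rewrite eqe gt_eqF// l0.
by rewrite N0 lebesgue_measure_itv /= ltry addye// leye_eq.
Qed.

(** For each n, s^alpha times the sum of the series is the integral over the
half-line of the step function with value (k / s)^(-1-alpha) phi_k on
[(k - 1) / s, k / s[, and dominated convergence applies to these functions. *)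
Theorem series_scaling : exists2 A : nat -> R,
  (forall n, \sum_(1 <= k < N) k%:R `^ (- (1 + alpha)) * phi n k @[N --> \oo] --> A n) &
  s n `^ alpha * A n @[n --> \oo] --> weighted_integral.
Proof.
have [il cvI] := dominated; have Ifin := int_fin il.
pose w n k := k.+1%:R `^ (- (1 + alpha)) * phi n k.+1.
have wE n k : a n k / s n = s n `^ alpha * w n k.
  rewrite /a /w powRM// ?invr_ge0 ?(ltW (s0 n))//.
  have -> : (s n)^-1 `^ (- (1 + alpha)) = s n `^ alpha * s n.
    rewrite -powR_inv1 ?(ltW (s0 n))// -powRrM.
    rewrite -{3}(powRr1 (ltW (s0 n))) -powRD; last by rewrite (gt_eqF (s0 n)) implybT.
    by congr (_ `^ _); ring.
  by field; rewrite gt_eqF.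
have fin_f n : (\int[mu]_(x in D) f n x)%E \is a fin_num.
  apply: int_fin; apply: (@le_integrable _ _ _ mu D _ (f n)
    (fun x => c%:E * (4%:E * (bump_fun b x)%:E))%E).
  - exact: measurable_itv.
  - exact: mf.
  - move=> x /in_D x0 /=; rewrite ger0_norm// lee_fin.
    by rewrite (le_trans (dom x0 n))// ler_norm.
  - by do 2 apply: integrableZl => //; exact: integrable_bump.
have cw n : \sum_(0 <= k < N) w n k @[N --> \oo] -->
    (s n `^ alpha)^-1 * fine (\int[mu]_(x in D) f n x)%E.
  have p0 : s n `^ alpha != 0 by rewrite gt_eqF// powR_gt0.
  have h : (\sum_(0 <= k < N) (a n k / s n)%:E)%E @[N --> \oo] -->
      ((fine (\int[mu]_(x in D) f n x)%E)%:E).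
    rewrite fineK// int_f; apply: is_cvg_nneseries => k _ _.
    by rewrite lee_fin divr_ge0// ltW.
  have := h; under eq_fun do rewrite sumEFin; move=> /fine_cvgP[_] /= h'.
  rewrite (_ : (fun N => _) = (fun N => (s n `^ alpha)^-1 * \sum_(0 <= k < N) (a n k / s n))).
    by apply: cvgM => //; exact: cvg_cst.
  apply/funext => N; rewrite big_distrr; apply: eq_bigr => k _ /=.
  by rewrite wE mulKf.
exists (fun n => (s n `^ alpha)^-1 * fine (\int[mu]_(x in D) f n x)%E) => [n|].
  rewrite -(cvg_shiftn 1) /=; have := cw n.
  rewrite (_ : (fun N => _) = (fun N => \sum_(1 <= k < N + 1) k%:R `^ (- (1 + alpha)) * phi n k))//.
  by apply/funext => N; rewrite addn1 big_add1.
rewrite (_ : (fun n => _) = (fun n => fine (\int[mu]_(x in D) f n x)%E)).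
  by apply: fine_cvg; rewrite fineK.
apply/funext => n; rewrite mulrA mulfV ?mul1r//.
by rewrite gt_eqF// powR_gt0.
Qed.

End power_weighted_series.

(** * Cumulants of partial sums of a first-order autoregression *)

Section partial_sum_kernel.
Context {R : realType}.
Variables (lam : R) (m : nat).
Hypothesis lam0 : 0 < lam.
Hypothesis m2 : (2 <= m)%N.

Definition geom_sum (rho : R) j : R := \sum_(i < j.+1) rho ^+ i.

(** The factor of the m-th cumulant for the sum of n + 1 consecutive terms of a
stationary autoregression following its initial value: this value enters with
coefficient rho (1 + ... + rho^n), and the innovations, whose cumulants carry
the factor 1 - rho^m, enter with coefficients 1 + ... + rho^j, j <= n. *)
Definition ar_kernel (rho : R) n : R := (rho * geom_sum rho n) ^+ m +
  (1 - rho ^+ m) * \sum_(j < n.+1) geom_sum rho j ^+ m.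

Lemma one_sub_expN_le (y : R) : 1 - expR (- y) <= y.
Proof. by have := expR_ge1Dx (- y); lra. Qed.

Lemma one_sub_expN_ge (y : R) : 0 <= y -> y / (1 + y) <= 1 - expR (- y).
Proof.
move=> y0; have y1 : 0 < 1 + y by lra.
have -> : y / (1 + y) = 1 - (1 + y)^-1 by field; rewrite gt_eqF.
by rewrite lerD2l lerN2 expRN lef_pV2 ?posrE ?expR_gt0// expR_ge1Dx.
Qed.

Lemma geom_sumE (rho : R) j : rho != 1 ->
  geom_sum rho j = (1 - rho ^+ j.+1) / (1 - rho).
Proof.
move=> r1; have r0 : 1 - rho != 0 by rewrite subr_eq0 eq_sym.
apply: (mulIf r0); rewrite divfK//.
rewrite /geom_sum; elim: j => [|j IH]; first by rewrite big_ord1 expr0 expr1 mul1r.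
by rewrite big_ord_recr mulrDl IH /= [rho ^+ j.+2]exprS; ring.
Qed.

Lemma geom_sum_ge0 (rho : R) j : 0 <= rho -> 0 <= geom_sum rho j.
Proof. by move=> r0; apply: sumr_ge0 => i _; exact: exprn_ge0. Qed.

Lemma geom_sum_mono (rho : R) i j : 0 <= rho -> (i <= j)%N ->
  geom_sum rho i <= geom_sum rho j.
Proof.
move=> r0; elim: j => [|j IH]; first by rewrite leqn0 => /eqP ->.
rewrite leq_eqVlt => /predU1P[->//|]; rewrite ltnS => /IH h.
rewrite (le_trans h)// /geom_sum [leRHS]big_ord_recr/= lerDl exprn_ge0//.
Qed.

Lemma geom_sum_le (rho : R) j : 0 <= rho <= 1 -> geom_sum rho j <= j.+1%:R.
Proof.
move=> /andP[r0 r1]; rewrite -[j.+1 in leRHS]card_ord -sum1_card natr_sum.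
by apply: ler_sum => i _; exact: exprn_ile1.
Qed.

Section bounds.
Variables (n k : nat).
Hypothesis k1 : (1 <= k)%N.
Let N : R := n.+1%:R.
Let y : R := lam / k%:R.
Let rho := expR (- y).

Let k0 : 0 < k%:R :> R. Proof. by rewrite ltr0n. Qed.
Let N0 : 0 < N. Proof. by rewrite ltr0n. Qed.
Let y0 : 0 < y. Proof. by rewrite divr_gt0. Qed.
Let rho0 : 0 < rho. Proof. exact: expR_gt0. Qed.
Let rho1 : rho < 1. Proof. by rewrite expR_lt1 oppr_lt0. Qed.
Let rho01 : 0 <= rho <= 1. Proof. by rewrite !ltW. Qed.

(** Since 1 - exp (-y) >= y / (1 + y), the geometric sums for y = lam / k are at
most kernel_const * k. *)
Definition kernel_const : R := (1 + lam) / lam.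

Let C0 : 0 < kernel_const. Proof. by rewrite divr_gt0// addr_gt0. Qed.

Let geom_sum_leC : geom_sum rho n <= kernel_const * k%:R.
Proof.
have r1 : 0 < 1 - rho by rewrite subr_gt0.
rewrite geom_sumE ?lt_eqF// ler_pdivrMr//.
apply: (@le_trans _ _ 1); first by rewrite gerBl exprn_ge0// ltW.
have h : y / (1 + y) <= 1 - rho by apply: one_sub_expN_ge; exact: ltW.
have Ck : 0 < kernel_const * k%:R by rewrite mulr_gt0.
apply: le_trans (_ : kernel_const * k%:R * (y / (1 + y)) <= _); last first.
  by rewrite ler_wpM2l// ltW.
have kge1 : 1 <= k%:R :> R by rewrite ler1n.
rewrite /kernel_const /y.
have -> : (1 + lam) / lam * k%:R * (lam / k%:R / (1 + lam / k%:R)) =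
    (1 + lam) * k%:R / (k%:R + lam).
  field; rewrite !gt_eqF//= ?addr_gt0//.
rewrite ler_pdivlMr ?addr_gt0// mul1r.
have : 0 <= lam * (k%:R - 1) by rewrite mulr_ge0 ?subr_ge0// ltW.
by rewrite mulrBr mulrDl mul1r; lra.
Qed.

Lemma ar_kernel_ge0 : 0 <= ar_kernel rho n.
Proof.
rewrite addr_ge0// ?exprn_ge0 ?mulr_ge0 ?geom_sum_ge0 ?subr_ge0 ?(ltW rho0)//.
  by apply: exprn_ile1; exact: ltW.
by apply: sumr_ge0 => j _; apply: exprn_ge0; apply: geom_sum_ge0; exact: ltW.
Qed.

Let q := geom_sum rho n / N.

Let q_bounds : 0 <= q /\ q <= 1 /\ q <= kernel_const * (k%:R / N).
Proof.
rewrite /q divr_ge0 ?geom_sum_ge0 ?(ltW rho0) ?(ltW N0)//; split=> //; split.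
  by rewrite ler_pdivrMr// mul1r geom_sum_le.
by rewrite mulrA ler_wpM2r ?invr_ge0 ?(ltW N0).
Qed.

(** Uses 1 - rho^m <= m y, that the geometric sums increase with j, and m >= 2. *)
Lemma ar_kernel_le : ar_kernel rho n / N ^+ m <= q ^+ 2 + m%:R * (y * N) * q ^+ 2.
Proof.
have [q0 [q1 _]] := q_bounds.
have qN : geom_sum rho n = q * N by rewrite /q divfK ?gt_eqF.
have Nm : 0 < N ^+ m by rewrite exprn_gt0.
have qm : q ^+ m <= q ^+ 2 by rewrite ler_wiXn2l.
rewrite ler_pdivrMr// mulrDl; apply: lerD.
  apply: (@le_trans _ _ ((q * N) ^+ m)).
    have g0 : 0 <= geom_sum rho n by rewrite geom_sum_ge0// ltW.
    rewrite -qN; apply: lerXn2r; rewrite ?nnegrE//.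
      by rewrite mulr_ge0// ltW.
    by rewrite ler_piMl// ltW.
  by rewrite exprMn ler_wpM2r// ltW.
have s1 : \sum_(j < n.+1) geom_sum rho j ^+ m <= N * (q * N) ^+ m.
  rewrite -qN mulr_natl -[n.+1 in leRHS]card_ord -sumr_const.
  apply: ler_sum => j _; apply: lerXn2r; rewrite ?nnegrE ?geom_sum_ge0 ?(ltW rho0)//.
  by apply: geom_sum_mono; [exact: ltW|rewrite -ltnS].
have s0 : 0 <= \sum_(j < n.+1) geom_sum rho j ^+ m.
  by apply: sumr_ge0 => j _; apply: exprn_ge0; apply: geom_sum_ge0; exact: ltW.
have r1 : 1 - rho ^+ m <= m%:R * y.
  by rewrite /rho -expRM_natl mulrN mulr_natl -mulr_natl; exact: one_sub_expN_le.
have r0 : 0 <= 1 - rho ^+ m by rewrite subr_ge0; apply: exprn_ile1; exact: ltW.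
apply: le_trans (ler_pM r0 s0 r1 s1) _.
rewrite exprMn.
have -> : m%:R * y * (N * (q ^+ m * N ^+ m)) = m%:R * (y * N) * q ^+ m * N ^+ m by ring.
apply: ler_wpM2r; first exact: ltW.
apply: ler_wpM2l => //; apply: mulr_ge0 => //.
by rewrite mulr_ge0// ltW.
Qed.

Definition kernel_bound : R :=
  (1 + kernel_const) + m%:R * lam * (kernel_const + kernel_const ^+ 2).

Let aux : m%:R * (y * N) * q ^+ 2 <= m%:R * lam * kernel_const * q.
Proof.
have [q0 [q1 q2]] := q_bounds.
have -> : m%:R * (y * N) * q ^+ 2 = m%:R * q * (y * N * q) by rewrite expr2; ring.
have -> : m%:R * lam * kernel_const * q = m%:R * q * (lam * kernel_const) by ring.
apply: ler_wpM2l; first exact: mulr_ge0.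
apply: (@le_trans _ _ (y * N * (kernel_const * (k%:R / N)))).
  by apply: ler_wpM2l => //; apply: mulr_ge0; exact: ltW.
rewrite le_eqVlt; apply/orP; left; apply/eqP; rewrite /y; field.
by rewrite !gt_eqF.
Qed.

Let ml0 : 0 <= m%:R * lam. Proof. by apply: mulr_ge0 => //; exact: ltW. Qed.

Let mlC : 0 <= m%:R * lam * kernel_const.
Proof. by apply: mulr_ge0 => //; exact: ltW. Qed.

Lemma ar_kernel_le1 : ar_kernel rho n / N ^+ m <= kernel_bound.
Proof.
have [q0 [q1 q2]] := q_bounds; apply: (le_trans ar_kernel_le).
have := aux; have mlC2 : 0 <= m%:R * lam * kernel_const ^+ 2.
  by apply: mulr_ge0 => //; exact: sqr_ge0.
have q2' : q ^+ 2 <= 1 by rewrite exprn_ile1.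
rewrite /kernel_bound mulrDr; have := C0; nra.
Qed.

Lemma ar_kernel_lek : ar_kernel rho n / N ^+ m <= kernel_bound * (k%:R / N).
Proof.
have [q0 [q1 q2]] := q_bounds; apply: (le_trans ar_kernel_le).
have kN : 0 <= k%:R / N by rewrite divr_ge0// ltW.
have q2' : q ^+ 2 <= q by rewrite expr2 ler_piMl.
apply: (@le_trans _ _ (q + m%:R * lam * kernel_const * q)).
  by apply: lerD => //; exact: aux.
have h : m%:R * lam * kernel_const * q <=
    m%:R * lam * kernel_const * (kernel_const * (k%:R / N)) by rewrite ler_wpM2l.
rewrite /kernel_bound expr2; move: h q2 kN mlC.
by move: (k%:R / N) => z; nra.
Qed.

End bounds.

(** Squeezed between N y / (1 + y) and N y. *)
Lemma cvg_scaled_one_sub_exp (N y : nat -> R) (v : R) :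
  (forall n, 0 < N n) -> (forall n, 0 < y n) ->
  y n @[n --> \oo] --> 0 -> N n * y n @[n --> \oo] --> v ->
  N n * (1 - expR (- y n)) @[n --> \oo] --> v.
Proof.
move=> N0 y0 yc Nyc.
have h : N n * y n * (1 + y n)^-1 @[n --> \oo] --> v.
  rewrite -[X in _ --> X]mulr1 -[X in _ * X]invr1; apply: cvgM => //.
  apply: cvgV; first exact: oner_neq0.
  by rewrite -[X in _ --> X]addr0; apply: cvgD => //; exact: cvg_cst.
apply: (squeeze_cvgr _ h Nyc); apply: nearW => n.
rewrite -mulrA !ler_pM2l// one_sub_expN_le one_sub_expN_ge//.
exact: ltW.
Qed.

End partial_sum_kernel.

(** * Asymptotics of the sums over the components *)

Lemma cvg_expR {R : realType} (u : nat -> R) (l : R) :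
  u n @[n --> \oo] --> l -> expR (u n) @[n --> \oo] --> expR l.
Proof. by move=> ul; exact: (cvg_comp _ _ ul (@continuous_expR R l)). Qed.

Section partial_sum_kernel_limit.
Context {R : realType}.
Variables (lam : R) (m : nat).
Hypothesis lam0 : 0 < lam.
Hypothesis m2 : (2 <= m)%N.

Definition exp_mean (v : R) : R := (1 - expR (- v)) / v.

Lemma exp_mean_gt0 v : 0 < v -> 0 < exp_mean v.
Proof.
by move=> v0; rewrite divr_gt0// subr_gt0 expR_lt1 oppr_lt0.
Qed.

Let N n : R := n.+1%:R.

Let N0 n : 0 < N n. Proof. by rewrite ltr0n. Qed.

(** The geometric sum is (1 - exp (- N y)) / (1 - exp (- y)). *)
Lemma cvg_geom_mean (y : nat -> R) (v : R) : 0 < v -> (forall n, 0 < y n) ->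
  y n @[n --> \oo] --> 0 -> N n * y n @[n --> \oo] --> v ->
  geom_sum (expR (- y n)) n / N n @[n --> \oo] --> exp_mean v.
Proof.
move=> v0 y0 yc Nyc.
have h1 := cvg_scaled_one_sub_exp N0 y0 yc Nyc.
have h2 : 1 - expR (- (N n * y n)) @[n --> \oo] --> 1 - expR (- v).
  apply: cvgB; first exact: cvg_cst.
  by apply: cvg_expR; exact: cvgN.
rewrite (_ : (fun n => _) =
  fun n => (1 - expR (- (N n * y n))) * (N n * (1 - expR (- y n)))^-1).
  by apply: cvgM => //; apply: cvgV => //; rewrite gt_eqF.
apply/funext => n.
have r1 : expR (- y n) < 1 by rewrite expR_lt1 oppr_lt0.
rewrite geom_sumE ?lt_eqF// -expRM_natl -/(N n) mulrN invfM.
by rewrite mulrAC mulrA.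
Qed.

(** With u = lam / x, this is exp_mean u ^ m plus m u times the integral over
[0, 1] of ((1 - exp (- u r)) / u)^m, the integral being expanded by the binomial
theorem so that only means of exponentials are left. *)
Definition limit_kernel (x : R) : R := let u := lam / x in
  exp_mean u ^+ m + m%:R * u * u ^- m *
  \sum_(i < m.+1) 'C(m, i)%:R * ((-1) ^+ i * (if i == 0 :> nat then 1 else exp_mean (i%:R * u))).

Section at_point.
Variable x : R.
Hypothesis x0 : 0 < x.
Let k n := (Num.truncn (N n * x)).+1.
Let y n : R := lam / (k n)%:R.
Let u := lam / x.
Let rho n := expR (- y n).

Let u0 : 0 < u. Proof. by rewrite divr_gt0. Qed.
Let y0 n : 0 < y n. Proof. by rewrite divr_gt0// ltr0n. Qed.
Let rho0 n : 0 < rho n. Proof. exact: expR_gt0. Qed.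
Let rho1 n : rho n < 1. Proof. by rewrite expR_lt1 oppr_lt0. Qed.

Let Ny : N n * y n @[n --> \oo] --> u.
Proof.
have h : (k n)%:R / N n @[n --> \oo] --> x.
  apply: cvg_truncnS => //.
  apply/cvgryPge => A; near=> n.
  apply: (@le_trans _ _ n%:R); last by rewrite ler_nat leqnSn.
  near: n; exact: nbhs_infty_ger.
rewrite (_ : (fun n => _) = fun n => lam * ((k n)%:R / N n)^-1).
  by apply: cvgM; [exact: cvg_cst|apply: cvgV => //; rewrite gt_eqF].
apply/funext => n; rewrite /y invf_div; ring.
Unshelve. all: by end_near. Qed.

Let invN : (N n)^-1 @[n --> \oo] --> (0 : R).
Proof. exact: cvg_harmonic. Qed.

Let yc : y n @[n --> \oo] --> (0 : R).
Proof.
rewrite -(mulr0 u) (_ : (fun n => _) = fun n => N n * y n * (N n)^-1).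
  exact: cvgM.
by apply/funext => n; rewrite mulrAC mulfV ?mul1r// gt_eqF.
Qed.

Let rhoX i n : rho n ^+ i = expR (- (i%:R * y n)).
Proof. by rewrite /rho -expRM_natl mulrN. Qed.

Let rhoc i : rho n ^+ i @[n --> \oo] --> (1 : R).
Proof.
have h : expR (- (i%:R * y n)) @[n --> \oo] --> expR (- (i%:R * 0)).
  by apply: cvg_expR; apply: cvgN; apply: cvgM => //; exact: cvg_cst.
by move: h; rewrite mulr0 oppr0 expR0; under eq_fun do rewrite -rhoX.
Qed.

Let scaled i : (0 < i)%N -> [/\ forall n, 0 < i%:R * y n,
  i%:R * y n @[n --> \oo] --> (0 : R) & N n * (i%:R * y n) @[n --> \oo] --> i%:R * u].
Proof.
move=> i0; split.
- by move=> n; rewrite mulr_gt0// ltr0n.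
- by rewrite -(mulr0 i%:R); apply: cvgM => //; exact: cvg_cst.
- rewrite (_ : (fun n => _) = fun n => i%:R * (N n * y n)).
    by apply: cvgM => //; exact: cvg_cst.
  by apply/funext => n; rewrite mulrCA.
Qed.

Let meanc i : (N n)^-1 * \sum_(j < n.+1) (rho n ^+ j.+1) ^+ i @[n --> \oo] -->
  (if i == 0%N then 1 else exp_mean (i%:R * u)).
Proof.
case: eqP => [->|/eqP].
  rewrite (_ : (fun n => _) = cst 1); first exact: cvg_cst.
  apply/funext => n; under eq_bigr do rewrite expr0.
  by rewrite sumr_const card_ord mulVf// gt_eqF.
rewrite -lt0n => i0; have [p1 p2 p3] := scaled i0.
rewrite (_ : (fun n => _) = fun n => rho n ^+ i *
   (geom_sum (expR (- (i%:R * y n))) n / N n)).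
  rewrite -[X in _ --> X]mul1r; apply: cvgM; first exact: rhoc.
  by apply: cvg_geom_mean => //; rewrite mulr_gt0// ltr0n.
apply/funext => n; rewrite mulrA [RHS]mulrC; congr (_ * _).
rewrite /geom_sum big_distrr; apply: eq_bigr => j _ /=.
by rewrite -rhoX -!exprM -exprD mulSn mulnC.
Qed.

Let second : (1 - rho n ^+ m) * (\sum_(j < n.+1) geom_sum (rho n) j ^+ m) / N n ^+ m
  @[n --> \oo] --> m%:R * u * u ^- m *
  \sum_(i < m.+1) 'C(m, i)%:R * ((-1) ^+ i * (if i == 0 :> nat then 1 else exp_mean (i%:R * u))).
Proof.
have m0 : (0 < m)%N by exact: leq_trans m2.
have [p1 p2 p3] := scaled m0.
rewrite (_ : (fun n => _) = fun n => N n * (1 - rho n ^+ m) *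
    (N n * (1 - rho n)) ^- m *
    \sum_(i < m.+1) 'C(m, i)%:R * ((-1) ^+ i *
      ((N n)^-1 * \sum_(j < n.+1) (rho n ^+ j.+1) ^+ i))).
  apply: cvgM; [apply: cvgM|].
  - have := cvg_scaled_one_sub_exp N0 p1 p2 p3.
    by under eq_fun do rewrite -rhoX.
  - apply: cvgV; first by rewrite expf_neq0// gt_eqF.
    by apply: cvg_exprn; exact: cvg_scaled_one_sub_exp.
  - apply: cvg_sumr => i; apply: cvgM; first exact: cvg_cst.
    by apply: cvgM; [exact: cvg_cst|exact: meanc].
apply/funext => n.
have r1 : 1 - rho n != 0 by rewrite subr_eq0 gt_eqF.
have Nn0 : N n != 0 by rewrite gt_eqF.
have -> : \sum_(i < m.+1) 'C(m, i)%:R * ((-1) ^+ i *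
      ((N n)^-1 * \sum_(j < n.+1) (rho n ^+ j.+1) ^+ i)) =
    (N n)^-1 * \sum_(j < n.+1) (1 - rho n ^+ j.+1) ^+ m.
  have E j : (1 - rho n ^+ j.+1) ^+ m =
      \sum_(i < m.+1) 'C(m, i)%:R * ((-1) ^+ i * (rho n ^+ j.+1) ^+ i).
    rewrite exprBn; apply: eq_bigr => i _.
    by rewrite expr1n mulr1 mulr_natl.
  under [in RHS]eq_bigr do rewrite E.
  rewrite exchange_big big_distrr; apply: eq_bigr => i _ /=.
  by rewrite -!mulr_sumr; ring.
have -> : \sum_(j < n.+1) geom_sum (rho n) j ^+ m =
    (1 - rho n) ^- m * \sum_(j < n.+1) (1 - rho n ^+ j.+1) ^+ m.
  rewrite big_distrr; apply: eq_bigr => j _ /=.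
  by rewrite geom_sumE ?lt_eqF// expr_div_n mulrC.
rewrite exprMn invfM; set S := \sum_(j < n.+1) _.
have := expf_neq0 m r1; have := expf_neq0 m Nn0.
move: (N n ^+ m) ((1 - rho n) ^+ m) => A B A0 B0.
move: (N n) Nn0 => M M0; field.
by rewrite ?A0 ?B0 ?M0.
Qed.

Lemma ar_kernel_cvg :
  ar_kernel m (rho n) n / N n ^+ m @[n --> \oo] --> limit_kernel x.
Proof.
rewrite (_ : (fun n => _) = fun n =>
  (rho n ^+ 1 * (geom_sum (rho n) n / N n)) ^+ m +
  (1 - rho n ^+ m) * (\sum_(j < n.+1) geom_sum (rho n) j ^+ m) / N n ^+ m).
  apply: cvgD; last exact: second.
  apply: cvg_exprn; rewrite -[X in _ --> X]mul1r; apply: cvgM; first exact: rhoc.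
  exact: cvg_geom_mean.
by apply/funext => n; rewrite /ar_kernel mulrDl expr1 mulrA expr_div_n.
Qed.

(** The first term is positive and the second is a limit of nonnegative terms. *)
Lemma limit_kernel_gt0 : 0 < limit_kernel x.
Proof.
rewrite /limit_kernel ltr_pwDl//; first by rewrite exprn_gt0// exp_mean_gt0.
rewrite -(cvg_lim (@Rhausdorff R) second); apply: limr_ge.
  by apply/cvg_ex; eexists; exact: second.
apply: nearW => n; rewrite divr_ge0 ?exprn_ge0 ?(ltW (N0 n))// mulr_ge0//.
  by rewrite subr_ge0 exprn_ile1// ltW.
by apply: sumr_ge0 => j _; apply: exprn_ge0; apply: geom_sum_ge0; exact: ltW.
Qed.

End at_point.

End partial_sum_kernel_limit.

Section asymptotics.
Context {R : realType}.
Variables (lam alpha : R).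
Hypothesis lam0 : 0 < lam.
Hypothesis alpha01 : 0 < alpha < 1.

Lemma cvg_natS_infty : (n.+1%:R : R) @[n --> \oo] --> +oo.
Proof.
apply/cvgryPge => A; near=> n.
apply: (@le_trans _ _ n%:R); last by rewrite ler_nat leqnSn.
near: n; exact: nbhs_infty_ger.
Unshelve. all: by end_near. Qed.

(** The terms that matter have k of order n: there rho^n = exp (- lam n / k) is
bounded away from 0 and 1, and the kernel divided by n^m has a limit as a
function of k / n. *)
Theorem partial_sum_asymptotics m : (2 <= m)%N ->
  exists2 K : R, 0 < K & exists2 A : nat -> R,
    (forall n, \sum_(1 <= k < M) k%:R `^ (- (1 + alpha)) *
        ar_kernel m (expR (- (lam / k%:R))) n @[M --> \oo] --> A n) &
    A n / n.+1%:R `^ (m%:R - alpha) @[n --> \oo] --> K.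
Proof.
move=> m2; pose N n : R := n.+1%:R.
have N0 n : 0 < N n by rewrite ltr0n.
pose phi n k := ar_kernel m (expR (- (lam / k%:R))) n / N n ^+ m.
have phi0 n k : (1 <= k)%N -> 0 <= phi n k.
  by move=> k1; rewrite divr_ge0 ?exprn_ge0 ?ar_kernel_ge0// ltW.
have phic n k (k1 : (1 <= k)%N) := ar_kernel_le1 lam0 m2 n k1.
have phik n k (k1 : (1 <= k)%N) := ar_kernel_lek lam0 m2 n k1.
have phig x (x0 : 0 < x) := ar_kernel_cvg lam0 m2 x0.
have g0 x (x0 : 0 < x) := limit_kernel_gt0 lam0 m2 x0.
have I0 := weighted_integral_gt0 alpha01 N0 phi0 phic phik phig g0 cvg_natS_infty.
have [A cA AI] := series_scaling alpha01 N0 phi0 phic phik phig cvg_natS_infty.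
exists (weighted_integral alpha (limit_kernel lam m)) => //.
exists (fun n => N n ^+ m * A n) => [n|].
  rewrite (_ : (fun M => _) = fun M => N n ^+ m *
      \sum_(1 <= k < M) k%:R `^ (- (1 + alpha)) * phi n k).
    by apply: cvgM => //; exact: cvg_cst.
  apply/funext => M; rewrite big_distrr; apply: eq_bigr => k _ /=.
  rewrite /phi [RHS]mulrCA; congr (_ * _).
  by rewrite [RHS]mulrC divfK// expf_neq0// gt_eqF.
rewrite (_ : (fun n => _) = fun n => N n `^ alpha * A n)//.
apply/funext => n; rewrite powRB; last by rewrite (gt_eqF (N0 n)) implybT.
rewrite powR_mulrn ?(ltW (N0 n))// invf_div.
have := expf_neq0 m (lt0r_neq0 (N0 n)); rewrite -/(N n).
move: (N n ^+ m) (N n `^ alpha) => B C B0.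
by field.
Qed.

(** Along sequences tending to infinity this is the scaling limit with kernel
exp (- lam s / k), bounded both by 1 and by k / (lam s). *)
Theorem covariance_asymptotics : exists2 K : R, 0 < K & exists2 A : R -> R,
    (forall s, 0 < s -> \sum_(1 <= k < M) k%:R `^ (- (1 + alpha)) *
        expR (- (lam / k%:R * s)) @[M --> \oo] --> A s) &
    s `^ alpha * A s @[s --> +oo] --> K.
Proof.
pose phi (s : nat -> R) n (k : nat) := expR (- (lam / k%:R * s n)).
pose c := 1 + lam^-1.
pose g x := expR (- (lam / x)).
have key (s : nat -> R) : (forall n, 0 < s n) -> s n @[n --> \oo] --> +oo ->
  [/\ 0 < weighted_integral alpha g & exists2 A : nat -> R,
   (forall n, \sum_(1 <= k < M) k%:R `^ (- (1 + alpha)) * phi s n k @[M --> \oo] --> A n) &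
   s n `^ alpha * A n @[n --> \oo] --> weighted_integral alpha g].
  move=> s0 soo.
  have phi0 n k : (1 <= k)%N -> 0 <= phi s n k by move=> _; exact: expR_ge0.
  have z0 n k : (1 <= k)%N -> 0 < lam / k%:R * s n.
    by move=> k1; rewrite mulr_gt0// divr_gt0// ltr0n.
  have li0 : 0 < lam^-1 by rewrite invr_gt0.
  have phic n k : (1 <= k)%N -> phi s n k <= c.
    move=> k1; apply: (@le_trans _ _ 1); last by rewrite /c lerDl ltW.
    by rewrite /phi ltW// expR_lt1 oppr_lt0 z0.
  have phik n k : (1 <= k)%N -> phi s n k <= c * (k%:R / s n).
    move=> k1; have k0 : 0 < k%:R :> R by rewrite ltr0n.
    have ks : 0 < k%:R / s n by rewrite divr_gt0.
    apply: (@le_trans _ _ (lam^-1 * (k%:R / s n))); last first.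
      by rewrite ler_pM2r// /c lerDr.
    have -> : lam^-1 * (k%:R / s n) = (lam / k%:R * s n)^-1.
      by field; rewrite !gt_eqF.
    rewrite /phi expRN lef_pV2 ?posrE ?expR_gt0 ?z0//.
    by apply: le_trans (expR_ge1Dx _); rewrite lerDr.
  have phig x : 0 < x -> phi s n (Num.truncn (s n * x)).+1 @[n --> \oo] --> g x.
    move=> x0; have h := cvg_truncnS s0 soo x0.
    rewrite /phi (_ : (fun n => _) = fun n =>
      expR (- (lam * ((Num.truncn (s n * x)).+1%:R / s n)^-1))).
      apply: cvg_expR; apply: cvgN; apply: cvgM; first exact: cvg_cst.
      by apply: cvgV => //; rewrite gt_eqF.
    by apply/funext => n; rewrite invf_div mulrAC mulrA.
  have g0 x : 0 < x -> 0 < g x by move=> _; exact: expR_gt0.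
  split; first exact: (weighted_integral_gt0 alpha01 s0 phi0 phic phik phig g0 soo).
  exact: (series_scaling alpha01 s0 phi0 phic phik phig soo).
have [I0 _] := key _ (fun n => ltr0Sn R n) cvg_natS_infty.
exists (weighted_integral alpha g) => //.
have exA s : exists a : R, 0 < s -> \sum_(1 <= k < M) k%:R `^ (- (1 + alpha)) *
        expR (- (lam / k%:R * s)) @[M --> \oo] --> a.
  case: (ltP 0 s) => s0; last by exists 0.
  have [||_ [A cA _]] := key (fun n => s * n.+1%:R).
  - by move=> n; rewrite mulr_gt0.
  - apply/cvgryPge => B; near=> n; rewrite -ler_pdivrMl//.
    apply: (@le_trans _ _ n%:R); last by rewrite ler_nat leqnSn.
    by near: n; exact: nbhs_infty_ger.
  - by exists (A 0%N) => _; have := cA 0%N; rewrite /phi mulr1.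
pose A s := projT1 (cid (exA s)).
have hA s : 0 < s -> \sum_(1 <= k < M) k%:R `^ (- (1 + alpha)) *
        expR (- (lam / k%:R * s)) @[M --> \oo] --> A s.
  by move=> s0; rewrite /A; case: (cid (exA s)) => a /= /(_ s0).
exists A => //; apply/cvg_pinftyP => u uoo.
(* Positive everywhere, and equal to u n for large n. *)
pose v n := Num.max (u n) 1.
have v0 n : 0 < v n by rewrite lt_max ltr01 orbT.
have voo : v n @[n --> \oo] --> +oo.
  apply/cvgryPge => B; near=> n; rewrite le_max; apply/orP; left.
  by near: n; move/cvgryPge : uoo; exact.
have [_ [A' cA' A'I]] := key v v0 voo.
apply: cvg_trans A'I; apply: near_eq_cvg; near=> n.
have -> : u n = v n.
  apply/esym/max_idPl; near: n; move/cvgryPge : uoo; exact.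
by congr (_ * _); exact: (cvg_uniqR (fun _ => erefl) (cA' n) (hA _ (v0 n))).
Unshelve. all: by end_near. Qed.

End asymptotics.

(** * Variances, covariances and the degenerate case *)

Section second_cumulant.
Context {R : realType} {d : measure_display} {T : measurableType d}.
Variable P : probability T R.
Implicit Types X Y : T -> R.
Local Notation EE X := (\int[P]_w X w).

Lemma cum2E X : has_moments P X -> cum P X 2 = moment P X 2 - EE X ^+ 2.
Proof.
move=> hX; have := cumulants_of_moments hX 1.
rewrite /bconv !big_ord_recr big_ord0 /= moment0 moment1 cum1//= => ->.
by rewrite !bin0 binn expr2; ring.
Qed.

Lemma cum2_var X : has_moments P X ->
  cum P X 2 = \int[P]_w ((X w - EE X) ^+ 2).
Proof.
move=> hX; rewrite cum2E// /moment.
have iX := has_moments_L1 hX.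
have -> : \int[P]_w ((X w - EE X) ^+ 2) =
    \int[P]_w (X w ^+ 2 + (- (2 * EE X)) * X w + EE X ^+ 2).
  by apply: eq_EE => w; ring.
rewrite EED; [|by apply: L1D; [exact: hX|exact: L1Z]|exact: L1_cst].
rewrite EE_cst (@EED _ _ _ P (fun w => X w ^+ 2) (fun w => - (2 * EE X) * X w));
  [|exact: hX|exact: L1Z].
by rewrite EEZ//; ring.
Qed.

Lemma cum2_ge0 X : has_moments P X -> 0 <= cum P X 2.
Proof. by move=> hX; rewrite cum2_var// EE_ge0// => w; exact: sqr_ge0. Qed.

(** A variable of variance 0 is almost surely constant. *)
Lemma cum2_eq0 X m : has_moments P X -> cum P X 2 = 0 -> (2 <= m)%N ->
  cum P X m = 0.
Proof.
move=> hX; rewrite cum2_var// => v0 m2.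
set mean := EE X in v0; pose f w := (X w - mean) ^+ 2.
have if2 : L1 P f.
  have := has_momentsB hX (has_moments_cst P mean).
  by move=> /(_ 2%N).
have int0 : (\int[P]_w `|(EFin \o f) w| = 0)%E.
  rewrite (_ : (\int[P]_w _)%E = (\int[P]_w (f w)%:E)%E); last first.
    by apply: eq_integral => w _ /=; rewrite ger0_norm// sqr_ge0.
  by rewrite -(fineK (integrable_fin_num measurableT if2)); congr (_%:E).
have mf : measurable_fun setT (EFin \o f).
  by apply/measurable_EFinP; exact: L1_measurable if2.
have [+ _] := @ae_eq_integral_abs _ _ _ P setT measurableT (EFin \o f) mf.
move=> /(_ int0) ae0.
rewrite (@cum_ae _ _ _ P X (fun=> mean))//; [exact: cum_cst| |exact: leq_trans m2].
apply: filterS ae0 => w /= /(_ I) /eqP.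
by rewrite eqe sqrf_eq0 subr_eq0 => /eqP.
Qed.

(** Polarization: covariances reduce to cumulants of sums. *)
Lemma covariance_cum2 X Y : has_moments P X -> has_moments P Y ->
  covariance P X Y =
  ((cum P (fun w => X w + Y w) 2 - cum P X 2 - cum P Y 2) / 2)%:E.
Proof.
move=> hX hY; have hXY := has_momentsD hX hY.
have iX := has_moments_L1 hX; have iY := has_moments_L1 hY.
have iXY : L1 P (fun w => X w * Y w).
  by apply: eq_L1 (L1_mixed 1 1 hX hY) => w; rewrite !expr1.
set a := EE X; set b := EE Y.
have i1 : L1 P (fun w => X w * Y w + - b * X w) by apply: L1D => //; exact: L1Z.
have i2 : L1 P (fun w => X w * Y w + - b * X w + - a * Y w).
  by apply: L1D => //; exact: L1Z.
have i3 : L1 P (fun w => X w * Y w + - b * X w + - a * Y w + a * b).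
  by apply: L1D => //; exact: L1_cst.
have E w : X w * Y w + - b * X w + - a * Y w + a * b = (X w - a) * (Y w - b).
  by ring.
have -> : covariance P X Y = ('E_P[(fun w => ((X w - a) * (Y w - b))%R)])%E.
  by rewrite unlock !EE_expectation.
rewrite expectation_EE; last exact: eq_L1 E i3.
congr (_%:E); rewrite -(eq_EE _ E).
rewrite (@EED _ _ _ P (fun w => X w * Y w + - b * X w + - a * Y w) (fun=> a * b)) ?EE_cst//;
  last exact: L1_cst.
rewrite (@EED _ _ _ P (fun w => X w * Y w + - b * X w) (fun w => - a * Y w))//; last exact: L1Z.
rewrite (@EED _ _ _ P (fun w => X w * Y w) (fun w => - b * X w))//; last exact: L1Z.
rewrite (@EEZ _ _ _ P (- b) X)// (@EEZ _ _ _ P (- a) Y)//.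
rewrite !cum2E// (@EED _ _ _ P X Y)// -/a -/b.
have -> : moment P (fun w => X w + Y w) 2 =
    moment P X 2 + 2 * \int[P]_w (X w * Y w) + moment P Y 2.
  have j1 : L1 P (fun w => 2 * (X w * Y w)) by exact: L1Z.
  have j2 : L1 P (fun w => X w ^+ 2 + 2 * (X w * Y w)).
    by apply: L1D => //; exact: hX.
  have jX : L1 P (fun w => X w ^+ 2) by exact: hX.
  have jY : L1 P (fun w => Y w ^+ 2) by exact: hY.
  rewrite -(@EEZ _ _ _ P 2 (fun w => X w * Y w))// /moment.
  rewrite -(@EED _ _ _ P (fun w => X w ^+ 2) (fun w => 2 * (X w * Y w)))//.
  rewrite -(@EED _ _ _ P (fun w => X w ^+ 2 + 2 * (X w * Y w)) (fun w => Y w ^+ 2))//.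
  by apply: eq_EE => w; ring.
by field.
Qed.

End second_cumulant.

Lemma series_comparison {R : realType} (u v : nat -> R) (c l : R) :
  (forall k, (1 <= k)%N -> 0 <= u k <= c * v k) -> 0 <= c ->
  (forall k, (1 <= k)%N -> 0 <= v k) ->
  \sum_(1 <= k < n) v k @[n --> \oo] --> l ->
  exists l' : R, \sum_(1 <= k < n) u k @[n --> \oo] --> l'.
Proof.
move=> uv c0 v0 vl; apply/cvg_ex; apply: nondecreasing_is_cvgn.
  apply/nondecreasing_seqP => n; case: n => [|n]; first by rewrite !big_geq.
  rewrite [leRHS]big_nat_recr//= lerDl.
  by have /andP[] := uv n.+1 isT.
have [C hC] := cvg_bounded_above vl.
exists (c * C) => _ [n _ <-]; apply: (@le_trans _ _ (c * \sum_(1 <= k < n) v k)).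
  by rewrite big_distrr; apply: ler_sum_nat => k /andP[k1 _]; have /andP[] := uv k k1.
exact: ler_wpM2l.
Qed.

(** * The superposition *)

Section superposition_of_OU_processes.
Context {R : realType} {d : measure_display} {T : measurableType d}.
Variable P : probability T R.
Variables (X Z : nat -> R -> {RV P >-> R}) (Xinf : R -> {RV P >-> R}).
Variables (lam H : R) (C : nat -> R).
Hypothesis lam_gt0 : 0 < lam.
Hypothesis H_itv : 2^-1 < H < 1.
Let delta (k : nat) : R := k%:R `^ (- (1 + 2 * (1 - H))).
Hypothesis hA : forall p : nat, (2 <= p)%N ->
  condition_A X Z (fun k => lam / k%:R) delta C p.
Hypothesis hB : condition_B X.
Hypothesis hXinf : superposition X Xinf.
Local Notation EE X := (\int[P]_w X w).

Let delta_ge0 k : 0 <= delta k. Proof. exact: powR_ge0. Qed.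

Let alpha01 : 0 < 2 * (1 - H) < 1.
Proof. by move/andP: H_itv => [h1 h2]; apply/andP; split; lra. Qed.

Let rate_gt0 k : (1 <= k)%N -> 0 < lam / k%:R.
Proof. exact: (A_rate (hA (leqnn 2))). Qed.

Let levyZ k : (1 <= k)%N -> levy_process (Z k).
Proof. exact: (A_levy (hA (leqnn 2))). Qed.

Let OUX k : (1 <= k)%N -> stationary_OU (lam / k%:R) (X k) (Z k).
Proof. exact: (A_OU (hA (leqnn 2))). Qed.

Let hX k t : (1 <= k)%N -> 0 <= t -> has_moments P (X k t).
Proof.
move=> k1 t0; apply: has_moments_even => // n n0.
have p2 : (2 <= 2 * n)%N by rewrite -{1}[2%N]muln1 leq_mul2l.
have := A_moment (hA p2) k1 t0; rewrite unlock => h.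
apply/integrableP; split; first by apply/measurable_EFinP; exact: measurable_funX.
apply: le_lt_trans h; rewrite le_eqVlt; apply/orP; left; apply/eqP.
by apply: eq_integral => w _ /=; rewrite normrX.
Qed.

Let cumX k t m : (1 <= k)%N -> 0 <= t -> (2 <= m)%N ->
  cum P (X k t) m = C m * delta k.
Proof.
move=> k1 t0 m2.
by rewrite /cum (A_cumulant (hA m2) k1 t0)// m2 leqnn.
Qed.

(** Comparison with the covariance series at lag 1. *)
Let delta_summable : exists l : R, \sum_(1 <= k < n) delta k @[n --> \oo] --> l.
Proof.
have [_ _ [A hA' _]] := covariance_asymptotics lam_gt0 alpha01.
apply: (series_comparison (c := expR lam) _ _ _ (hA' 1 ltr01)).
- move=> k k1; rewrite delta_ge0 /= mulr1 mulrCA -expRD.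
  rewrite ler_peMr ?powR_ge0// -[leLHS]expR0 ler_expR subr_ge0.
  by rewrite ler_pdivrMr ?ltr0n// ler_peMr ?ler1n// ltW.
- exact: expR_ge0.
- by move=> k k1; rewrite mulr_ge0 ?powR_ge0// expR_ge0.
Qed.

Let pcvg_Xinf t : 0 <= t -> pcvg P (fun n w => \sum_(1 <= k < n) X k t w) (Xinf t).
Proof.
move=> t0; have mS n : measurable_fun setT (fun w => \sum_(1 <= k < n) X k t w).
  by apply: measurable_sum => k.
case: (hXinf t0) => h; first exact: pcvg_ae_cvg.
exact: pcvg_L2.
Qed.

(** A finite sum of values of the superposition is the sum of the
corresponding finite sums for the components, which are independent. *)
Theorem superposition_cumulants (I : Type) (s : seq I) (t : I -> R)
    (w : nat -> nat -> R) :
  (forall i, 0 <= t i) ->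
  (forall m k, (2 <= m)%N -> (1 <= k)%N ->
     cum P (fun z => \sum_(i <- s) X k (t i) z) m = w m k * (C m * delta k)) ->
  (forall m, (2 <= m)%N -> exists b : R,
     \sum_(1 <= k < n) delta k * w m k @[n --> \oo] --> b) ->
  has_moments P (fun z => \sum_(i <- s) Xinf (t i) z) /\
  forall m (b : R), (2 <= m)%N ->
    \sum_(1 <= k < n) delta k * w m k @[n --> \oo] --> b ->
    cum P (fun z => \sum_(i <- s) Xinf (t i) z) m = C m * b.
Proof.
move=> t0 cw summ.
pose B m := if (2 <= m)%N =P true is ReflectT m2 then projT1 (cid (summ m m2)) else 0.
have wB m : (2 <= m)%N -> \sum_(1 <= k < n) delta k * w m k @[n --> \oo] --> B m.
  by move=> m2; rewrite /B; case: eqP => // m2'; exact: (projT2 (cid (summ m m2'))).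
pose W k z := \sum_(i <- s) X k (t i) z.
have hW k : (1 <= k)%N -> has_moments P (W k).
  by move=> k1; apply: has_moments_sum => i; exact: hX.
have WI : forall K, (1 <= K)%N -> windep P (fun z => \sum_(1 <= k < K) W k z) (W K).
  apply: (mutual_indep_windep (A_indep (hA (leqnn 2)))) => k k1.
    exact: has_moments_measurable (hW k k1).
  rewrite (_ : W k = fun z => \sum_(i <- s) 1 * X k (t i) z).
    apply: sigma_rv_lincomb => i A hA'; apply: sub_sigma_algebra.
    by exists (t i).
  by apply/funext => z; apply: eq_bigr => i _; rewrite mul1r.
have WV : pcvg P (fun n z => \sum_(1 <= k < n) W k z)
    (fun z => \sum_(i <- s) Xinf (t i) z).
  under eq_fun do under eq_fun do rewrite exchange_big.
  by apply: pcvg_sum => i; exact: pcvg_Xinf.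
have mean i : exists l : R, \sum_(1 <= k < n) EE (X k (t i)) @[n --> \oo] --> l.
  have [/cvg_ex[l hl] _] := hB (t0 i); exists l.
  by move: hl; under eq_fun do under eq_bigr do rewrite EE_expectation.
pose ml i := projT1 (cid (mean i)).
have hml i : \sum_(1 <= k < n) EE (X k (t i)) @[n --> \oo] --> ml i.
  exact: (projT2 (cid (mean i))).
(* The first cumulants are the means, which converge separately. *)
pose S m := if m == 1%N then \sum_(i <- s) ml i else C m * B m.
have [|hV cV] := @cum_series _ _ _ P W _ S hW WI WV.
  case=> // -[|m] _; rewrite /S /=.
    rewrite (_ : (fun n => _) = fun n => \sum_(i <- s) \sum_(1 <= k < n) EE (X k (t i))).
      by apply: cvg_sumr => i.
    apply/funext => n; rewrite exchange_big; apply: eq_big_nat => k /andP[k1 _] /=.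
    rewrite cum1; last exact: hW.
    by apply: EE_sum => i; apply: has_moments_L1; exact: hX.
  rewrite (_ : (fun n => _) = fun n => C m.+2 * \sum_(1 <= k < n) delta k * w m.+2 k).
    by apply: cvgM; [exact: cvg_cst|exact: wB].
  apply/funext => n; rewrite big_distrr; apply: eq_big_nat => k /andP[k1 _] /=.
  by rewrite cw//; ring.
split=> // m b m2 hb; rewrite cV; last exact: leq_trans m2.
rewrite (cvg_uniqR (fun _ => erefl) hb (wB m m2)) /S.
by case: eqP m2 => // ->.
Qed.

(** By polarization and the cumulants of X_k(0) + X_k(s), the component k
contributes C 2 delta_k exp (- lam s / k). *)
Lemma superposition_covariance : exists2 K : R, 0 < K & exists A : R -> R, [/\
  forall s, 0 < s -> covariance P (Xinf 0) (Xinf s) = (C 2 * A s)%:E,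
  forall s, 0 < s -> \sum_(1 <= k < M) delta k *
        expR (- (lam / k%:R * s)) @[M --> \oo] --> A s &
  s `^ (2 * (1 - H)) * A s @[s --> +oo] --> K].
Proof.
have [K K0 [A hA' AK]] := covariance_asymptotics lam_gt0 alpha01.
exists K => //; exists A; split => // s s0.
have [l hl] := delta_summable.
have one t : 0 <= t -> has_moments P (Xinf t) /\ cum P (Xinf t) 2 = C 2 * l.
  move=> t0; have [|||] := @superposition_cumulants unit [:: tt] (fun=> t) (fun _ _ => 1).
  - by [].
  - move=> m k m2 k1; rewrite mul1r -(cumX k1 t0 m2); congr (cum P _ m).
    by apply/funext => z; rewrite big_seq1.
  - by move=> m _; exists l; under eq_fun do under eq_bigr do rewrite mulr1.
  - have -> : (fun z => \sum_(i <- [:: tt]) Xinf t z) = Xinf t.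
      by apply/funext => z; rewrite big_seq1.
    move=> h h2; split=> //; apply: (h2 2%N l isT).
    by under eq_fun do under eq_bigr do rewrite mulr1.
pose r k := expR (- (lam / k%:R * s)).
pose w m k := (1 + r k) ^+ m + (1 - r k ^+ m).
have r01 k : (1 <= k)%N -> 0 <= r k <= 1.
  move=> k1; rewrite expR_ge0 /= -[leRHS]expR0 ler_expR oppr_le0.
  by rewrite mulr_ge0// ltW// rate_gt0.
have summ m : (2 <= m)%N -> exists b : R, \sum_(1 <= k < n) delta k * w m k @[n --> \oo] --> b.
  move=> m2; have c0 : 0 <= 2 ^+ m + 1 :> R by rewrite addr_ge0// exprn_ge0.
  have v0 k : (1 <= k)%N -> 0 <= delta k by move=> _; exact: delta_ge0.
  apply: (series_comparison _ c0 v0 hl).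
  move=> k k1; have /andP[r0 r1] := r01 k k1.
  have rm1 : r k ^+ m <= 1 by exact: exprn_ile1.
  have rm0 : 0 <= r k ^+ m by exact: exprn_ge0.
  have p0 : 0 <= (1 + r k) ^+ m by rewrite exprn_ge0// addr_ge0.
  have p1 : (1 + r k) ^+ m <= 2 ^+ m.
    by apply: lerXn2r; rewrite ?nnegrE ?addr_ge0//; lra.
  rewrite mulr_ge0//= ?/w; last by lra.
  by rewrite [leRHS]mulrC ler_wpM2l// /w; lra.
have B2 : \sum_(1 <= k < n) delta k * w 2%N k @[n --> \oo] --> 2 * (l + A s).
  rewrite (_ : (fun n => _) = fun n => 2 * (\sum_(1 <= k < n) delta k +
      \sum_(1 <= k < n) delta k * r k)).
    apply: cvgM; first exact: cvg_cst.
    by apply: cvgD => //; exact: hA'.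
  apply/funext => n; rewrite -big_split big_distrr; apply: eq_bigr => k _ /=.
  by rewrite /w; ring.
pose t (b : bool) := if b then s else 0.
have t0 b : 0 <= t b by rewrite /t; case: b => //; exact: ltW.
have [|h1 h2] := @superposition_cumulants bool [:: false; true] t w t0 _ summ.
  move=> m k m2 k1.
  have -> : (fun z => \sum_(i <- [:: false; true]) X k (t i) z) =
      fun z => X k 0 z + X k s z.
    by apply/funext => z; rewrite big_cons big_seq1.
  rewrite (cum_OU_sum0 (rate_gt0 k1) (levyZ k1) (OUX k1) (fun u u0 => hX k1 u0) s0 m2
    (fun u u0 => cumX k1 u0 m2)).
  by rewrite /w /r mulNr.
have [hX0 c0] := one 0 (lexx 0); have [hXs cs] := one s (ltW s0).
have E : (fun z => \sum_(i <- [:: false; true]) Xinf (t i) z) =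
    fun z => Xinf 0 z + Xinf s z.
  by apply/funext => z; rewrite big_cons big_seq1.
rewrite covariance_cum2// c0 cs; move: (h2 2%N _ isT B2); rewrite E => ->.
by congr (_%:E); field.
Qed.

Lemma superposition_partial_sum m : (2 <= m)%N ->
  exists2 K : R, 0 < K & exists2 A : nat -> R,
    A n / n.+1%:R `^ (m%:R - 2 * (1 - H)) @[n --> \oo] --> K &
    forall n, cumulant P m (centered P (partial_sum Xinf n.+1%:R)) = (C m * A n)%:C.
Proof.
move=> m2; have key p := partial_sum_asymptotics lam_gt0 alpha01 (m := p).
have [K K0 [A hA' AK]] := key m m2.
exists K => //; exists A => // n.
pose w p k := ar_kernel p (expR (- (lam / k%:R))) n.
have [|||hV cV] := @superposition_cumulants 'I_n.+1 (index_enum 'I_n.+1)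
  (fun i => i.+1%:R) w.
- by [].
- move=> p k p2 k1.
  have := cum_OU_partial_sum (rate_gt0 k1) (levyZ k1) (OUX k1)
    (fun u u0 => hX k1 u0) ltr01 p2 (fun u u0 => cumX k1 u0 p2) n.
  rewrite mulr1; under eq_fun do under eq_bigr do rewrite mulr1.
  by move=> ->.
- move=> p p2; have [_ _ [A' hA'' _]] := key p p2.
  by exists (A' n); exact: hA''.
have E : centered P (partial_sum Xinf n.+1%:R) =
    fun z => \sum_(i < n.+1) Xinf i.+1%:R z + - fine 'E_P[partial_sum Xinf n.+1%:R]%E.
  apply/funext => z; rewrite /centered /partial_sum natrK; congr (_ - _).
  by rewrite big_add1 /= big_mkord.
have hc : has_moments P (centered P (partial_sum Xinf n.+1%:R)).
  by rewrite E; apply: has_momentsD => //; exact: has_moments_cst.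
rewrite cumulant_real//; last exact: leq_trans m2.
congr (_%:C); rewrite E cum_shift//.
by apply: cV => //; exact: hA'.
Qed.

Lemma C2_ge0 : 0 <= C 2.
Proof.
have := cum2_ge0 (hX (leqnn 1) (lexx 0)).
by rewrite cumX// /delta powR1 mulr1.
Qed.

Lemma C2_eq0 m : C 2 = 0 -> (2 <= m)%N -> C m = 0.
Proof.
move=> C20 m2; have h := hX (leqnn 1) (lexx 0).
have := cum2_eq0 h _ m2; rewrite !cumX// /delta powR1 !mulr1; exact.
Qed.

End superposition_of_OU_processes.

(** * Slow variation and the conclusion *)

Section slow_variation_of_convergent_functions.
Context {R : realType}.

Lemma cvg_slowly_varying (L : R -> R) (l : R) : 0 < l ->
  measurable_fun ([set` `]0, +oo[] : set R) L -> L x @[x --> +oo] --> l -> slowly_varying L.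
Proof.
move=> l0 mL Ll; split.
  have [a [ar ha]] : \forall x \near +oo, 0 < L x by exact: (cvgr_gt _ Ll).
  exists (Num.max 1 (a + 1)); first by rewrite lt_max ltr01.
  split.
    apply: measurable_funS mL => //.
    move=> x /=; rewrite !in_itv /= !andbT ge_max => /andP[x1 _].
    exact: lt_le_trans x1.
  by move=> x; rewrite ge_max => /andP[_ ax]; apply: ha; rewrite (lt_le_trans _ ax)// ltrDl.
move=> c c0; have Lc : L (c * x) @[x --> +oo] --> l.
  have cx : c * x @[x --> +oo] --> +oo.
    apply/cvgryPge => a; apply: filterS (nbhs_pinfty_ge (num_real (c^-1 * a))) => x.
    by rewrite ler_pdivrMl.
  exact: (cvg_comp _ _ cx Ll).
rewrite -(mulfV (lt0r_neq0 l0)); apply: cvgM => //.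
by apply: cvgV => //; exact: lt0r_neq0.
Unshelve. all: by end_near. Qed.

End slow_variation_of_convergent_functions.

Theorem theorem2 (R : realType) (d : measure_display) (T : measurableType d)
    (P : probability T R) (X Z : nat -> R -> {RV P >-> R})
    (Xinf : R -> {RV P >-> R}) (lam H : R) (C : nat -> R) (L : R -> R)
    (lam_gt0 : 0 < lam) (H_itv : 2^-1 < H < 1)
    (hA : forall p : nat, (2 <= p)%N ->
       condition_A X Z (fun k => lam / k%:R)
         (fun k => k%:R `^ (- (1 + 2 * (1 - H)))) C p)
    (hB : condition_B X)
    (hXinf : superposition X Xinf)
    (hL : forall s : R, 0 < s ->
       covariance P (Xinf 0) (Xinf s) = (L s / s `^ (2 * (1 - H)))%:E) :
  (C 2%N != 0 -> slowly_varying L) /\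
  forall m : nat, (2 <= m)%N ->
    exists2 K : R, 0 < K &
    forall t : R, 0 < t ->
    exists2 eps : nat -> R, eps n @[n --> \oo] --> (0 : R) &
      \forall N \near \oo,
        let Nt : R := (Num.truncn (N%:R * t))%:R in
        cumulant P m (centered P (partial_sum Xinf Nt)) =
        (C m * K * L N%:R * Nt `^ (m%:R - 2 * (1 - H)) * (1 + eps N))%:C.
Proof.
have [K0 K00 [A [covA cA AK]]] :=
  superposition_covariance lam_gt0 H_itv hA hB hXinf.
have LE s : 0 < s -> L s = C 2 * (s `^ (2 * (1 - H)) * A s).
  move=> s0; have := hL s s0; rewrite covA// => -[e].
  by rewrite mulrCA e mulrC divfK// gt_eqF// powR_gt0.
have Lc : L s @[s --> +oo] --> C 2 * K0.
  have h : C 2 * (s `^ (2 * (1 - H)) * A s) @[s --> +oo] --> C 2 * K0.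
    by apply: cvgM => //; exact: cvg_cst.
  apply: cvg_trans h; apply: near_eq_cvg.
  by apply: filterS (nbhs_pinfty_gt (num_real 0)) => s /LE.
have C20 : 0 <= C 2 := C2_ge0 hA.
have CK : C 2 != 0 -> 0 < C 2 * K0.
  by move=> C2n0; rewrite mulr_gt0// lt_neqAle eq_sym C2n0.
split=> [C2n0|m m2].
  apply: (cvg_slowly_varying (CK C2n0) _ Lc).
  apply: (measurable_fun_cvg (h := fun M s => C 2 * (s `^ (2 * (1 - H)) *
      \sum_(1 <= k < M) k%:R `^ (- (1 + 2 * (1 - H))) * expR (- (lam / k%:R * s))))).
    move=> M; apply: measurable_funTS; apply: measurable_funM => //.
    apply: measurable_funM; first exact: measurable_powR.
    apply: measurable_sum => k; apply: measurable_funM => //.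
    apply: (measurableT_comp (@measurable_expR R)).
    by apply: measurableT_comp => //; exact: measurable_funM.
  move=> s; rewrite /= in_itv /= andbT => s0; rewrite LE//.
  apply: cvgM; first exact: cvg_cst.
  by apply: cvgM; [exact: cvg_cst|exact: cA].
have [Km Km0 [B BK cumB]] := superposition_partial_sum lam_gt0 H_itv hA hB hXinf m2.
have nt_infty (t : R) : 0 < t ->
    (fun N => (Num.truncn (N%:R * t)).-1) @ \oo --> \oo.
  move=> t0; apply/cvgnyPge => M; near=> N.
  rewrite -ltnS; have h : (M.+1 <= Num.truncn (N%:R * t))%N.
    rewrite truncn_ge_nat; last by rewrite mulr_ge0// ltW.
    by rewrite -ler_pdivrMr//; near: N; exact: nbhs_infty_ger.
  by case: (Num.truncn _) h.
have nt_pos (t : R) : 0 < t -> \forall N \near \oo, (0 < Num.truncn (N%:R * t))%N.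
  move=> t0; near=> N; rewrite truncn_gt0 -ler_pdivrMr// mul1r.
  by near: N; exact: nbhs_infty_ger.
(* If C 2 = 0 then C m = 0 as well, and both sides are 0. *)
have [C2z|C2n0] := eqVneq (C 2) 0.
  exists 1 => // t t0; exists (fun=> 0); first exact: cvg_cst.
  have Cm0 := C2_eq0 hA C2z m2.
  near=> N.
  have Npos : (0 < Num.truncn (N%:R * t))%N by near: N; exact: nt_pos.
  have NtE : (Num.truncn (N%:R * t))%:R = (Num.truncn (N%:R * t)).-1.+1%:R :> R.
    by rewrite prednK.
  by rewrite NtE cumB Cm0 !mul0r.
have CK0 := CK C2n0.
(* Km comes from the partial sums and C 2 * K0 is the limit of L. *)
pose K := Km / (C 2 * K0).
have Kp : 0 < K by rewrite divr_gt0.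
exists K => // t t0.
pose n N := (Num.truncn (N%:R * t)).-1.
pose eps N := B (n N) / (n N).+1%:R `^ (m%:R - 2 * (1 - H)) / (K * L N%:R) - 1.
have LNc : L N%:R @[N --> \oo] --> C 2 * K0.
  apply: (cvg_comp (fun N : nat => N%:R : R) L _ Lc).
  by apply/cvgryPge => a; exact: nbhs_infty_ger.
exists eps.
  have h1 : B (n N) / (n N).+1%:R `^ (m%:R - 2 * (1 - H)) @[N --> \oo] --> Km.
    exact: (cvg_comp _ _ (nt_infty t t0) BK).
  have KE : K * (C 2 * K0) = Km by rewrite /K divfK// gt_eqF.
  have h3 : (K * L N%:R)^-1 @[N --> \oo] --> Km^-1.
    rewrite -KE; apply: cvgV; first by rewrite KE gt_eqF.
    by apply: cvgM => //; exact: cvg_cst.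
  have : B (n N) / (n N).+1%:R `^ (m%:R - 2 * (1 - H)) * (K * L N%:R)^-1 - 1
      @[N --> \oo] --> Km * Km^-1 - 1.
    by apply: cvgB; [exact: cvgM|exact: cvg_cst].
  by rewrite mulfV ?subrr// gt_eqF.
near=> N.
have Npos : (0 < Num.truncn (N%:R * t))%N by near: N; exact: nt_pos.
have Lpos : 0 < L N%:R.
  by near: N; exact: (cvgr_gt _ LNc).
have NtE : (Num.truncn (N%:R * t))%:R = (n N).+1%:R :> R by rewrite /n prednK.
rewrite NtE cumB /eps; congr (_%:C).
have pn0 : (n N).+1%:R `^ (m%:R - 2 * (1 - H)) != 0 :> R.
  by rewrite gt_eqF// powR_gt0.
move: (_ `^ _) pn0 => Q Q0; move: (lt0r_neq0 Lpos) (lt0r_neq0 Kp).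
move: (L _) (K) => l k l0 k0.
by field; rewrite l0 k0 Q0.
Unshelve. all: by end_near. Qed.
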